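(* The condition $$\int_{\mathbb{R}^d}\frac{1}{1+(\Psi(\xi))^{1-\beta_0}}\,\mu(d\xi)<\infty$$ is necessary and sufficient for $$\mathbb{E}\int_0^t\int_0^t |r-s|^{-\beta_0}\gamma(X_r-X_s)\,dr\,ds<\infty\quad\text{for all } t>0 .$$
   Context: Let $d\ge 1$ and $\beta_0\in(0,1)$. $X=\{X_t,t\ge 0\}$ is a symmetric Lévy process in $\mathbb{R}^d$ with $X_0=0$ and characteristic exponent $\Psi$, i.e. $\mathbb{E}\exp(i\xi\cdot X_t)=\exp(-t\Psi(\xi))$; by symmetry $\Psi$ is real-valued and nonnegative. It is assumed that $X$ has transition density functions $q_t(x)$, $t>0$; consequently $\lim_{|\xi|\to\infty}\Psi(\xi)=\infty$. Fourier transform: $\widehat\varphi(\xi)=\int_{\mathbb{R}^d}e^{-i\xi\cdot x}\varphi(x)\,dx$ for $\varphi\in L^1(\mathbb{R}^d)$, extended to tempered distributions $\mathcal{S}'(\mathbb{R}^d)$. $\gamma$ is a symmetric, nonnegative-definite function on $\mathbb{R}^d$ such that: (1) $\gamma$ is nonnegative and locally integrable; (2) its Fourier transform $\widehat\gamma\in\mathcal{S}'(\mathbb{R}^d)$ is a measurable function that is nonnegative almost everywhere; (3) $\gamma:\mathbb{R}^d\to[0,\infty]$ is continuous, where $[0,\infty]$ is the one-point compactification of $[0,\infty)$; (4) either [$\gamma(x)<\infty$ if and only if $x\neq 0$], or [$\widehat\gamma\in L^\infty(\mathbb{R}^d)$ and $\gamma(x)<\infty$ whenever $x\ne 0$]. The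 spectral measure is $\mu(d\xi)=\widehat\gamma(\xi)\,d\xi$, a positive tempered measure. *)

(* Defs.v *)
From HB Require Import structures.
From mathcomp Require Import all_boot all_order all_algebra complex.
From mathcomp Require Import all_classical all_reals all_analysis.
From mathcomp Require Import measurable_realfun.

Set Implicit Arguments.
Unset Strict Implicit.
Unset Printing Implicit Defensive.

Import Order.TTheory GRing.Theory Num.Theory.
Import numFieldTopology.Exports numFieldNormedType.Exports.

Local Open Scope classical_set_scope.
Local Open Scope ring_scope.

(* R^n is ['rV[R]_n], normed by the sup norm.  The sigma-algebra generated by
   the coordinates is its Borel sigma-algebra. *)

Definition rV_display : measure_display. Proof. exact. Qed.

Section rV_measurable.
Context {R : realType} {n : nat}.

Let coord (i : 'I_n) (x : 'rV[R]_n) : measurableTypeR R := x 0 i.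

Let rV_set0 : g_sigma_preimage coord set0.
Proof. exact: sigma_algebra0. Qed.

Let rV_setC A : g_sigma_preimage coord A -> g_sigma_preimage coord (~` A).
Proof. exact: sigma_algebraC. Qed.

Let rV_bigcup (F : (set 'rV[R]_n)^nat) : (forall i, g_sigma_preimage coord (F i)) ->
  g_sigma_preimage coord (\bigcup_i (F i)).
Proof. exact: sigma_algebra_bigcup. Qed.

HB.instance Definition _ := @isMeasurable.Build rV_display
  'rV[R]_n (g_sigma_preimage coord) rV_set0 rV_setC rV_bigcup.

Lemma measurable_coord (i : 'I_n) :
  measurable_fun [set: 'rV[R]_n] (fun x : 'rV[R]_n => x 0 i : measurableTypeR R).
Proof.
move=> _ Y mY; rewrite setTI; apply: sub_sigma_algebra => /=.
rewrite -bigcup_seq/=; exists i => /=; first by rewrite mem_index_enum.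
by exists Y => //; rewrite setTI.
Qed.

Lemma measurable_fun_rVP d (T : measurableType d) (f : T -> 'rV[R]_n) :
  (forall i, measurable_fun [set: T] (fun t => f t 0 i : measurableTypeR R)) ->
  measurable_fun [set: T] f.
Proof.
move=> mf; apply: (@measurability _ _ _ _ setT f
  (\big[setU/set0]_(i < n) preimage_set_system setT (coord i) measurable)) => //.
move=> _ [B + <-]; rewrite -bigcup_seq/= => -[i _ [A mA <-]].
by rewrite setTI; exact: (mf i measurableT A mA).
Qed.

End rV_measurable.

Section rV_lebesgue.
Context {R : realType}.

Definition rV_rcons n (p : 'rV[R]_n * measurableTypeR R) : 'rV[R]_n.+1 :=
  \row_i oapp (p.1 0) p.2 (unlift ord_max i).

Lemma measurable_rV_rcons n : measurable_fun setT (@rV_rcons n).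
Proof.
apply: measurable_fun_rVP => i; rewrite /rV_rcons.
under eq_fun do rewrite mxE.
case: (unlift _ _) => [j|] /=; last exact: measurable_snd.
exact: (measurableT_comp (measurable_coord j) measurable_fst).
Qed.

(* lambda_0 is the unit mass on the one-point space R^0, and lambda_(n+1) is the
   image of lambda_n \x lambda_1 under the identification R^n * R = R^(n+1). *)
Fixpoint lebesgue_rV n : {measure set 'rV[R]_n -> \bar R} :=
  if n is m.+1 then
    measure_function_pushforward__canonical__measure_function_Measure
      (lebesgue_rV m
         \x [the {sigma_finite_measure set (measurableTypeR R) -> \bar R}
              of @lebesgue_measure R])%E
      (@measurable_rV_rcons m)
  else [the measure _ _ of dirac (0 : 'rV[R]_0)].

End rV_lebesgue.

Lemma lebesgue_rV_box {R : realType} n (A : 'I_n -> set R) :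
  (forall i, measurable (A i : set (measurableTypeR R))) ->
  lebesgue_rV n [set x : 'rV[R]_n | forall i, A i (x 0 i)] =
  (\prod_(i < n) lebesgue_measure (A i))%E.
Proof.
elim: n A => [|n IH] A mA.
  rewrite big_ord0 /= diracE mem_set //; by case.
rewrite big_ord_recr /= /pushforward.
rewrite [X in product_measure1 _ _ X](_ : _ =
   [set x : 'rV[R]_n | forall i, A (widen_ord (leqnSn n) i) (x 0 i)] `*` A ord_max).
  rewrite product_measure1E //; first by congr (_ * _)%E;
    exact: (IH (fun i => A (widen_ord (leqnSn n) i))).
  rewrite [X in measurable X](_ : _ = \bigcap_(i in [set: 'I_n])
     ((fun x : 'rV[R]_n => x 0 i : measurableTypeR R) @^-1` A (widen_ord (leqnSn n) i))).
    apply: fin_bigcap_measurable => // i _; rewrite -[X in measurable X]setTI.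
    by apply: (measurable_coord i) => //; exact: mA.
  by apply/seteqP; split=> x /= h i; [move=> _|]; apply: h.
apply/seteqP; split=> -[x y] /=.
  move=> h; split.
    move=> i; have := h (widen_ord (leqnSn n) i); rewrite mxE.
    have -> : widen_ord (leqnSn n) i = lift ord_max i.
      by apply/val_inj; rewrite /= /bump leqNgt ltn_ord.
    by rewrite liftK.
  by have := h ord_max; rewrite mxE unlift_none.
move=> [h1 h2] i; rewrite mxE; case: unliftP => [j ->|-> //] /=.
have -> : lift ord_max j = widen_ord (leqnSn n) j.
  by apply/val_inj; rewrite /= /bump leqNgt ltn_ord.
exact: h1.
Qed.

Section fourier.
Context {R : realType}.
Local Notation C := R[i].

Definition cis (theta : R) : C := (cos theta +i* sin theta)%C.

Definition dot n (x y : 'rV[R]_n) : R := \sum_(i < n) x 0 i * y 0 i.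

Definition cintegral d (T : measurableType d) (mu : {measure set T -> \bar R})
    (f : T -> C) : C :=
  ((\int[mu]_x complex.Re (f x))%R +i* (\int[mu]_x complex.Im (f x))%R)%C.

Variable n : nat.
Local Notation rV := 'rV[R]_n.
Local Notation leb := (lebesgue_rV n).

Definition partials (s : seq 'I_n) (f : rV -> R) : rV -> R :=
  foldr (fun i g => 'D_(delta_mx 0 i) g) f s.

Definition smooth (f : rV -> R) := forall s : seq 'I_n,
  continuous (partials s f) /\
  forall x i, derivable (partials s f) x (delta_mx 0 i).

Definition rapidly_decreasing (f : rV -> R) := forall (s : seq 'I_n) (k : nat),
  exists M, forall x, `|x| ^+ k * `|partials s f x| <= M.

Definition re_fun (phi : rV -> C) : rV -> R := fun x => complex.Re (phi x).
Definition im_fun (phi : rV -> C) : rV -> R := fun x => complex.Im (phi x).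

Definition csmooth (phi : rV -> C) := smooth (re_fun phi) /\ smooth (im_fun phi).

Definition schwartz (phi : rV -> C) :=
  [/\ csmooth phi, rapidly_decreasing (re_fun phi) &
      rapidly_decreasing (im_fun phi)].

Definition test_function (phi : rV -> C) :=
  csmooth phi /\ compact (closure [set x | phi x != 0]).

(* M bounds the Schwartz seminorms sup_x |x|^k |d^s phi(x)|, k, |s| <= N. *)
Definition seminorms_le (N : nat) (phi : rV -> C) (M : R) :=
  forall (s : seq 'I_n) (k : nat) (x : rV), (size s <= N)%N -> (k <= N)%N ->
    `|x| ^+ k * `|partials s (re_fun phi) x| <= M /\
    `|x| ^+ k * `|partials s (im_fun phi) x| <= M.

(* Continuous linear forms on the Schwartz space; values outside it are junk. *)
Definition tempered_distribution (T : (rV -> C) -> C) :=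
  (forall (a : C) phi psi, schwartz phi -> schwartz psi ->
     T (fun x => a * phi x + psi x) = a * T phi + T psi) /\
  exists (N : nat) (K : R), forall phi M, schwartz phi -> seminorms_le N phi M ->
    `|T phi| <= (K * M)%:C%C.

Definition fourier (phi : rV -> C) : rV -> C :=
  fun xi => cintegral leb (fun x => cis (- dot xi x) * phi x).

Definition fourier_distr (T : (rV -> C) -> C) : (rV -> C) -> C :=
  fun phi => T (fourier phi).

(* phi |-> \int f phi, for f with values in [-oo, +oo]. *)
Definition pairing (f : rV -> \bar R) (phi : rV -> C) : C :=
  (fine (\int[leb]_x (f x * (re_fun phi x)%:E))%E +i*
   fine (\int[leb]_x (f x * (im_fun phi x)%:E))%E)%C.

(* f, seen as the distribution [pairing f], is tempered, with absolutely
   convergent pairings.  For f >= 0 a.e., absolute convergence against Schwartz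
   functions is automatic when the distribution f dx is tempered. *)
Definition tempered_fun (f : rV -> \bar R) :=
  (forall phi, schwartz phi ->
     leb.-integrable setT (fun x => f x * (re_fun phi x)%:E)%E /\
     leb.-integrable setT (fun x => f x * (im_fun phi x)%:E)%E) /\
  tempered_distribution (pairing f).

Definition has_fourier_transform (f g : rV -> \bar R) :=
  [/\ tempered_fun f, tempered_fun g &
      forall phi, schwartz phi -> pairing g phi = fourier_distr (pairing f) phi].

(* (phi * phi~)(z) = \int phi(z + y) conj(phi(y)) dy, so that
   \int f (phi * phi~) = \iint f(x - y) phi(x) conj(phi(y)) dx dy. *)
Definition autocorrelation (phi : rV -> C) : rV -> C :=
  fun z => cintegral leb (fun y => phi (z + y) * (phi y)^*%C).

Definition nonnegative_definite (f : rV -> \bar R) :=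
  forall phi, test_function phi -> 0 <= pairing f (autocorrelation phi).

Definition locally_integrable_rV (f : rV -> \bar R) :=
  forall K : set rV, compact K -> leb.-integrable K f.

(* Continuity is for the topology of [\bar R]; the topology it induces on
   [0, +oo] is that of the one-point compactification of [0, +oo[. *)
Record admissible_kernel (gamma ghat : rV -> \bar R) : Prop := {
  kernel_sym : forall x, gamma (- x) = gamma x ;
  kernel_nonnegdef : nonnegative_definite gamma ;
  kernel_ge0 : forall x, (0 <= gamma x)%E ;
  kernel_locint : locally_integrable_rV gamma ;
  kernel_fourier : has_fourier_transform gamma ghat ;
  kernel_fourier_meas : measurable_fun [set: rV] ghat ;
  kernel_fourier_ge0 : {ae leb, forall xi, (0 <= ghat xi)%E} ;
  kernel_cont : continuous gamma ;
  kernel_sing :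
    (forall x, (gamma x < +oo)%E <-> x != 0) \/
    ('N[leb]_+oo%E [ghat] < +oo)%E /\ (forall x, x != 0 -> (gamma x < +oo)%E)
}.

End fourier.

Section levy.
Context {R : realType} {n : nat} {d : measure_display} {Omega : measurableType d}.
Variable P : probability Omega R.
Local Notation rV := 'rV[R]_n.

Definition mutually_independent m (Y : 'I_m -> Omega -> rV) :=
  forall B : 'I_m -> set rV, (forall i, measurable (B i)) ->
    P (\bigcap_(i in [set: 'I_m]) Y i @^-1` B i) =
    (\prod_(i < m) P (Y i @^-1` B i))%E.

Definition cadlag (x : R -> rV) :=
  (forall t, 0 <= t -> x s @[s --> t^'+] --> x t) /\
  (forall t, 0 < t -> cvg (x s @[s --> t^'-])).

(* Processes are indexed by R; only the times t >= 0 are meaningful. *)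
Record levy_process (X : R -> Omega -> rV) : Prop := {
  levy_meas : forall t, 0 <= t -> measurable_fun [set: Omega] (X t) ;
  levy_0 : {ae P, forall w, X 0 w = 0} ;
  levy_indep : forall m (t : nat -> R), 0 <= t 0%N -> {homo t : i j / (i <= j)%N >-> i <= j} ->
    mutually_independent (fun (i : 'I_m) w => X (t i.+1) w - X (t i) w) ;
  levy_stat : forall s t (B : set rV), 0 <= s -> 0 <= t -> measurable B ->
    P ((fun w => X (s + t) w - X s w) @^-1` B) = P ((fun w => X t w - X 0 w) @^-1` B) ;
  levy_cadlag : {ae P, forall w, cadlag (X ^~ w)}
}.

Definition symmetric_process (X : R -> Omega -> rV) :=
  forall t (B : set rV), 0 <= t -> measurable B ->
    P ((fun w => - X t w) @^-1` B) = P (X t @^-1` B).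

Definition characteristic_exponent (X : R -> Omega -> rV) (Psi : rV -> R) :=
  forall t xi, 0 <= t ->
    cintegral P (fun w => cis (dot xi (X t w))) = (expR (- (t * Psi xi)))%:C%C.

Definition has_transition_densities (X : R -> Omega -> rV) :=
  exists q : R -> rV -> R, forall t, 0 < t ->
    [/\ measurable_fun [set: rV] (q t), forall x, 0 <= q t x &
        forall B, measurable B ->
          P (X t @^-1` B) = (\int[lebesgue_rV n]_(x in B) (q t x)%:E)%E].

End levy.

(* Main.v *)
From HB Require Import structures.
Require Import Defs.
From mathcomp Require Import all_boot all_order all_algebra complex.
From mathcomp Require Import all_classical all_reals all_analysis.
From mathcomp Require Import measurable_realfun.
From mathcomp Require Import ring lra.

Set Implicit Arguments.
Unset Strict Implicit.
Unset Printing Implicit Defensive.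

Import Order.TTheory GRing.Theory Num.Theory.
Import numFieldTopology.Exports numFieldNormedType.Exports.

Local Open Scope classical_set_scope.
Local Open Scope ring_scope.

(** Everything is expressed through the nonnegative spectral density [spec] and
    the mass A = [gmass ^+ n] of the Gaussian on R^n. The core is the energy
    identity [levy_energyE]: for u > 0,

      A^2 E gamma(X_u) = int spec(xi) exp (- u Psi(xi)) dxi   in [0, +oo].

    The hypotheses give such a formula only against Schwartz functions. Tested
    against modulated Gaussians, whose transforms are Gaussians, they yield it for
    the kernel regularised by a Gaussian ([smooth_kernelE], then
    [integral_smooth_kernelE] after integration against a measure), with an extra
    Gaussian factor on the spectral side; the width of the Gaussian has to go to 0.

    - Since gamma is continuous as a map into [0, +oo], Fatou's lemma bounds the
      energy by the spectral integral ([energy_le_spectral]).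

    - Conversely, the regularised energies must not exceed the energy in the limit,
      in spite of the singularity of gamma at 0. By independence and symmetry, X_u
      is the difference of two independent copies of X_(u/2), whose law has a
      density q. Replace q by a truncation h. Then h(a) h(b) is dominated by a
      multiple of a Gaussian density whose regularised energies are under control
      ([gauss_energy_le]), and Fatou's lemma for the difference of the two
      densities excludes an excess ([spectral_le_energy]). The transform of the
      autocorrelation of h is a squared modulus, hence nonnegative, so nothing is
      lost on the spectral side, and the truncation can be removed
      ([density_spectral_le_energy]).

    The paths are jointly measurable up to a null set
    ([jointly_measurable_modification]). Hence, by Tonelli's theorem and
    stationarity, A^2 times the expected double time integral is

      int spec(xi) J_t(Psi(xi)) dxi,
      J_t(psi) = int_0^t int_0^t |r - s|^(-beta) exp (- |r - s| psi) dr ds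

    ([expected_path_energyE]). Finally J_t(psi) is at most a constant times
    1 / (1 + psi^(1 - beta)) for every t, and at least such a constant for t = 2
    ([time_energy_le], [time_energy_ge]). *)

(** * Lebesgue measure on R^n *)

Section lebesgue1.
Context {R : realType}.
Local Notation mu := (@lebesgue_measure R).

Lemma measurable_affine1 (a b : R) :
  measurable_fun [set: measurableTypeR R] (fun x : measurableTypeR R => b + a * x : measurableTypeR R).
Proof.
by apply: measurable_funD => //; apply: measurable_funM.
Qed.

(** Both sides are measures in [A], and they agree on half-open intervals. *)
Lemma lebesgue_measure_affine (a b : R) (A : set (measurableTypeR R)) :
  0 < a -> measurable A ->
  (a%:E * mu ((fun x : R => (b + a * x)%R) @^-1` A) = mu A)%E.
Proof.
move=> a0 mA; have a0' := ltW a0.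
pose phi (x : measurableTypeR R) : measurableTypeR R := b + a * x.
have mphi : measurable_fun setT phi by exact: measurable_affine1.
pose nu := mscale (NngNum a0')
  (measure_function_pushforward__canonical__measure_function_Measure mu mphi).
apply/esym; apply: (@lebesgue_measure_unique _ nu) => // _ [[u v]] _ <-.
rewrite /nu /= /mscale /= /pushforward.
have -> : phi @^-1` `]u, v] = `](u - b) / a, (v - b) / a]%classic.
  apply/seteqP; split => x /=; rewrite !in_itv /= /phi ltr_pdivrMr// ler_pdivlMr//;
  rewrite [x * a]mulrC; by rewrite ltrBlDl lerBrDl.
rewrite !lebesgue_measure_itv /= !lte_fin.
rewrite ltr_pM2r ?invr_gt0// ltrD2r.
case: ifP => _; last by rewrite mule0.
rewrite -!EFinD -EFinM; congr (_%:E); field; lra.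
Qed.

Lemma ge0_integral_affine1 (a b : R) (f : measurableTypeR R -> \bar R) : 0 < a ->
  measurable_fun setT f -> (forall x, 0 <= f x)%E ->
  (a%:E * \int[mu]_x f (b + a * x)%R = \int[mu]_x f x)%E.
Proof.
move=> a0 mf f0; have a0' := ltW a0.
pose phi (x : measurableTypeR R) : measurableTypeR R := b + a * x.
have mphi : measurable_fun setT phi by exact: measurable_affine1.
pose nu := mscale (NngNum a0')
  (measure_function_pushforward__canonical__measure_function_Measure mu mphi).
transitivity (\int[nu]_x f x)%E; last first.
  apply: eq_measure_integral => A mA _; exact: lebesgue_measure_affine.
rewrite ge0_integral_mscale//=; congr (_ * _)%E.
rewrite ge0_integral_pushforward//.
Qed.

Lemma ge0_integral_opp1 (f : measurableTypeR R -> \bar R) :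
  measurable_fun setT f -> (forall x, 0 <= f x)%E ->
  (\int[mu]_x f (- x)%R = \int[mu]_x f x)%E.
Proof.
move=> mf f0.
pose phi (x : measurableTypeR R) : measurableTypeR R := - x.
have mphi : measurable_fun setT phi by exact: oppr_measurable.
transitivity (\int[pushforward mu phi]_x f x)%E.
  by rewrite ge0_integral_pushforward//.
apply: eq_measure_integral => A mA _; exact: lebesgue_measureN.
Qed.

End lebesgue1.

Section rV.
Context {R : realType}.

(** The cubes with vertices at integer coordinates exhaust the space and have
    finite volume. *)
Lemma sigma_finite_lebesgue_rV n : sigma_finite setT (@lebesgue_rV R n).
Proof.
exists (fun k => [set x : 'rV[R]_n | forall i, `[- k%:R, k%:R]%classic (x 0 i)]).
  apply/seteqP; split => // x _.
  have [k Hk] : exists k : nat, forall i, `|x 0 i| <= k%:R.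
    exists (\big[maxn/0%N]_(i < n) Num.bound `|x 0 i|) => i.
    apply: (le_trans (ltW (archi_boundP (normr_ge0 (x 0 i))))).

    rewrite ler_nat. exact: (leq_bigmax (F := fun i => Num.bound `|x 0 i|)).
  by exists k => //= i; rewrite in_itv /= -ler_norml.
move=> k; split.
  rewrite [X in measurable X](_ : _ = \bigcap_(i in [set: 'I_n])
     ((fun x : 'rV[R]_n => x 0 i : measurableTypeR R) @^-1` `[- k%:R, k%:R]%classic)).
    apply: fin_bigcap_measurable => // i _; rewrite -[X in measurable X]setTI.
    by apply: (measurable_coord i) => //; exact: measurable_itv.
  by apply/seteqP; split=> x /= h i; [move=> _|]; apply: h.
rewrite (@lebesgue_rV_box R n (fun=> `[- k%:R, k%:R]%classic)).
  rewrite ltey_eq; apply/orP; left; elim/big_ind: _ => //; first exact: fin_numM.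
  by move=> i _; rewrite lebesgue_measure_itv /=; case: ifP.
move=> i; exact: measurable_itv.
Qed.

(** [lebesgue_rV n] under a name of its own, so that it can carry the structure
    of sigma-finite measure that Tonelli's theorem requires. *)
Definition leb n : set 'rV[R]_n -> \bar R := lebesgue_rV n.
Arguments leb : clear implicits.

HB.instance Definition _ n := Measure.copy (leb n) (lebesgue_rV n).

HB.instance Definition _ n :=
  Measure_isSigmaFinite.Build _ _ _ (leb n) (sigma_finite_lebesgue_rV n).

Lemma integral_leb0 (f : 'rV[R]_0 -> \bar R) : measurable_fun setT f -> (forall x, 0 <= f x)%E ->
  (\int[leb 0]_x f x = f 0%R)%E.
Proof.
by move=> mf f0; rewrite integral_dirac// diracE mem_set// mul1e.
Qed.

(** Coordinates are integrated one at a time: this is the induction step of all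
    computations on R^n. *)
Lemma integral_lebS n (f : 'rV[R]_n.+1 -> \bar R) : measurable_fun setT f -> (forall x, 0 <= f x)%E ->
  (\int[leb n.+1]_x f x =
   \int[leb n]_p \int[lebesgue_measure]_y f (rV_rcons (p, y)))%E.
Proof.
move=> mf f0.
rewrite [LHS]ge0_integral_pushforward//; last exact: measurable_rV_rcons.
rewrite preimage_setT.
rewrite -[LHS]/(\int[leb n \x lebesgue_measure]_x f (rV_rcons x))%E.
rewrite (fubini_tonelli1 (f \o (@rV_rcons R n)))//; last by move=> x; exact: f0.
by apply: measurableT_comp => //; exact: measurable_rV_rcons.
Qed.

Lemma rV_rconsE_last n (p : 'rV[R]_n * measurableTypeR R) : rV_rcons p 0 ord_max = p.2.
Proof. by rewrite mxE unlift_none. Qed.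

Lemma rV_rconsE n (p : 'rV[R]_n * measurableTypeR R) i :
  rV_rcons p 0 (widen_ord (leqnSn n) i) = p.1 0 i.
Proof.
rewrite mxE; have -> : widen_ord (leqnSn n) i = lift ord_max i.
  by apply/val_inj; rewrite /= /bump leqNgt ltn_ord.
by rewrite liftK.
Qed.

Lemma rV_rconsP n (x : 'rV[R]_n.+1) : exists p, x = rV_rcons p.
Proof.
exists (\row_i x 0 (widen_ord (leqnSn n) i), x 0 ord_max).
apply/rowP => i; rewrite mxE; case: unliftP => [j ->|-> //] /=.
rewrite mxE; congr (x 0 _).
by apply/val_inj; rewrite /= /bump leqNgt ltn_ord.
Qed.

Lemma rV_rcons_affine n (p q : 'rV[R]_n * measurableTypeR R) (a : R) :
  rV_rcons p + a *: rV_rcons q = rV_rcons (p.1 + a *: q.1, p.2 + a * q.2 : measurableTypeR R).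
Proof.
apply/rowP => i; rewrite !mxE; case: unliftP => [j _|_] //=; by rewrite !mxE.
Qed.

Lemma measurable_rVD d (T : measurableType d) n (f g : T -> 'rV[R]_n) :
  measurable_fun setT f -> measurable_fun setT g ->
  measurable_fun setT (fun t => f t + g t).
Proof.
move=> mf mg; apply: measurable_fun_rVP => i.
under eq_fun do rewrite mxE.
by apply: measurable_funD; apply: (measurableT_comp (measurable_coord i)).
Qed.

Lemma measurable_rVZ d (T : measurableType d) n (f : T -> 'rV[R]_n) (a : R) :
  measurable_fun setT f -> measurable_fun setT (fun t => a *: f t).
Proof.
move=> mf; apply: measurable_fun_rVP => i.
under eq_fun do rewrite mxE.
by apply: measurable_funM => //; apply: (measurableT_comp (measurable_coord i)).
Qed.

Lemma measurable_rVB d (T : measurableType d) n (f g : T -> 'rV[R]_n) :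
  measurable_fun setT f -> measurable_fun setT g ->
  measurable_fun setT (fun t => f t - g t).
Proof.
move=> mf mg; under eq_fun do rewrite -scaleN1r.
by apply: measurable_rVD => //; exact: measurable_rVZ.
Qed.

Lemma measurable_dot d (T : measurableType d) n (f g : T -> 'rV[R]_n) :
  measurable_fun setT f -> measurable_fun setT g ->
  measurable_fun setT (fun t => dot (f t) (g t) : measurableTypeR R).
Proof.
move=> mf mg; rewrite /dot; apply: measurable_sum => i.
by apply: measurable_funM; apply: (measurableT_comp (measurable_coord i)).
Qed.

(** Translation and dilation invariance, obtained coordinate by coordinate from
    the one-dimensional case. *)
Lemma ge0_integral_affine n (a : R) (x : 'rV[R]_n) (f : 'rV[R]_n -> \bar R) : 0 < a ->
  measurable_fun setT f -> (forall x, 0 <= f x)%E ->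
  ((a ^+ n)%:E * \int[leb n]_z f (x + a *: z)%R = \int[leb n]_z f z)%E.
Proof.
elim: n x f => [|n IH] x f a0 mf f0.
  rewrite expr0 mul1e !integral_leb0//.
    by congr f; apply/rowP; case.
  by apply: measurableT_comp => //; apply: measurable_rVD => //; exact: measurable_rVZ.
have [p ->] := rV_rconsP x.
have mfp : measurable_fun setT (fun z : 'rV[R]_n.+1 => f (rV_rcons p + a *: z)).
  by apply: measurableT_comp => //; apply: measurable_rVD => //; exact: measurable_rVZ.
have mfr : measurable_fun setT (f \o @rV_rcons R n).
  by apply: measurableT_comp => //; exact: measurable_rV_rcons.
rewrite !integral_lebS// exprS mulrC EFinM -muleA.
under eq_integral => q _ do under eq_integral => y _ do rewrite rV_rcons_affine /=.
pose F q := (\int[lebesgue_measure]_y f (rV_rcons (q, y)))%E.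
have mF : measurable_fun setT F by exact: (measurable_fun_fubini_tonelli_F (f \o @rV_rcons R n) mfr (fun=> f0 _)).
have F0 q : (0 <= F q)%E by exact: integral_ge0.
have EF q : (a%:E * \int[lebesgue_measure]_y f (rV_rcons (q, (p.2 + a * (y : measurableTypeR R))%R)) = F q)%E.
  rewrite (@ge0_integral_affine1 R a p.2 (fun y => f (rV_rcons (q, y))))//.
  by apply: (measurableT_comp mfr); exact: measurable_pair1.
rewrite -[RHS](IH p.1 F a0 mF F0); congr (_ * _)%E.
under [RHS]eq_integral do rewrite -EF.
rewrite ge0_integralZl//.
- apply: (measurable_fun_fubini_tonelli_F (fun z : 'rV[R]_n * measurableTypeR R =>
    f (rV_rcons (p.1 + a *: z.1, p.2 + a * z.2 : measurableTypeR R)))) => //.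
  apply: (measurableT_comp mfr); apply/measurable_fun_pair => /=.
    by apply: measurable_rVD => //; apply: measurable_rVZ; exact: measurable_fst.
  by apply: measurable_funD => //; apply: measurable_funM => //; exact: measurable_snd.
- by move=> q _; exact: integral_ge0.
- by rewrite lee_fin ltW.
Qed.

End rV.
Arguments leb {R} n.

(** * Fourier transform of the Gaussian on the line *)

Section gauss1.
Context {R : realType}.
Local Notation mu := (@lebesgue_measure R).

Definition gauss1 (x : R) : R := expR (- (x ^+ 2 / 2)).

Lemma gauss1_ge0 x : 0 <= gauss1 x. Proof. exact: expR_ge0. Qed.

Lemma measurable_gauss1 : measurable_fun [set: measurableTypeR R] (gauss1 : measurableTypeR R -> measurableTypeR R).
Proof.
apply: measurableT_comp => //; apply: measurableT_comp => //.
by apply: measurable_funM => //; exact: measurable_funX.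
Qed.

(** A dilated Gaussian is the integrable envelope used for the moments below. *)
Lemma gauss_fun_lty (a : R) : 0 < a -> (\int[mu]_x (gauss_fun (a * x))%:E < +oo)%E.
Proof.
move=> a0.
have := @ge0_integral_affine1 R a 0 (fun x => (gauss_fun x)%:E) a0.
rewrite integralT_gauss => h.
have {h} := h (iffRL (measurable_EFinP _ _) (@measurable_gauss_fun R))
              (fun x => gauss_fun_ge0 x).
under eq_integral do rewrite add0r.
move=> h; rewrite ltNge leye_eq; apply/eqP => oo; move: h; rewrite oo.
by rewrite gt0_muley ?lte_fin.
Qed.

Lemma integrable_gauss1M : mu.-integrable setT (fun x : R => (`|x| * gauss1 x)%:E).
Proof.
have m : measurable_fun [set: measurableTypeR R] (fun x => `|x| * gauss1 x : measurableTypeR R).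
  by apply: measurable_funM; [exact: normr_measurable|exact: measurable_gauss1].
apply/integrableP; split; first exact/measurable_EFinP.
apply: le_lt_trans (gauss_fun_lty (a := 1 / 2) _); last lra.
apply: ge0_le_integral => //.
- by apply: measurableT_comp => //; exact/measurable_EFinP.
- apply/measurable_EFinP; apply: measurableT_comp; first exact: measurable_gauss_fun.
  exact: measurable_funM.
- move=> x _; rewrite /= lee_fin ger0_norm ?mulr_ge0 ?gauss1_ge0//.
  (* One factor absorbs [|x|], since [|x| <= 1 + x^2/4 <= exp (x^2/4)]. *)
  have -> : gauss1 x = expR (- (x ^+ 2 / 4)) * expR (- (x ^+ 2 / 4)).
    by rewrite -expRD; congr expR; lra.
  have -> : gauss_fun (1 / 2 * x) = expR (- (x ^+ 2 / 4)).
    by congr expR; rewrite exprMn; lra.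
  rewrite mulrA ler_piMl ?expR_ge0// expRN ler_pdivrMr ?expR_gt0// mul1r.
  apply: le_trans (expR_ge1Dx _).
  rewrite -[x ^+ 2]real_normK ?num_real//; have := sqr_ge0 (`|x| - 2); nra.
Qed.

Lemma integrable_gauss1 : mu.-integrable setT (fun x : R => (gauss1 x)%:E).
Proof.
apply/integrableP; split; first by apply/measurable_EFinP; exact: measurable_gauss1.
apply: le_lt_trans (gauss_fun_lty (a := 1 / 2) _); last lra.
apply: ge0_le_integral => //.
- by apply: measurableT_comp => //; apply/measurable_EFinP; exact: measurable_gauss1.
- apply/measurable_EFinP; apply: measurableT_comp; first exact: measurable_gauss_fun.
  exact: measurable_funM.
- move=> x _; rewrite /= lee_fin ger0_norm ?gauss1_ge0//.
  rewrite ler_expR exprMn lerN2; have := sqr_ge0 x; nra.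
Qed.

(** Integration by parts on the whole line, without boundary terms: the
    fundamental theorem of calculus on [-n, n], then dominated convergence. *)
Lemma Rintegral_derive_eq0 (F f : R -> R) :
  (forall x : R, is_derive x (1 : R) F (f x)) -> continuous f ->
  mu.-integrable setT (EFin \o f) ->
  F n%:R @[n --> \oo] --> (0 : R) -> F (- n%:R) @[n --> \oo] --> (0 : R) ->
  (\int[mu]_x (f x)%:E = 0)%E.
Proof.
move=> dF cf intf Fp Fm.
have mf : measurable_fun setT (fun x : R => (f x)%:E) by case/integrableP : intf.
pose f_ (n : nat) (x : R) := (\1_(`[- n%:R, n%:R]%classic : set R) x * f x)%:E.
have cF : continuous F.
  move=> x; apply/differentiable_continuous/derivable1_diffP.
  by case: (dF x).
have E n : (\int[mu]_x f_ n.+1 x = (F n.+1%:R - F (- n.+1%:R))%:E)%E.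
  have nn : - n.+1%:R < n.+1%:R :> R by rewrite gtrN ?ltr0Sn.
  rewrite EFinB -(@continuous_FTC2 R f F _ _ nn).
  - rewrite [RHS]integral_mkcond; apply: eq_integral => x _.
    rewrite epatch_indic /= muleC -EFinM; by [].
  - exact: continuous_subspaceT.
  - split.
    + by move=> x _; case: (dF x).
    + by apply: cvg_at_right_filter; exact: cF.
    + by apply: cvg_at_left_filter; exact: cF.
  - by move=> x _; rewrite derive1E; case: (dF x).
have mI n : measurable_fun [set: measurableTypeR R]
   (\1_(`[- n%:R, n%:R]%classic : set (measurableTypeR R)) : _ -> R).
  by apply: measurable_indic; exact: measurable_itv.
have mf_ n : measurable_fun [set: measurableTypeR R] (f_ n).
  by apply/measurable_EFinP; apply: measurable_funM => //; exact/measurable_EFinP.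
have [|||_ _] := @dominated_convergence _ (measurableTypeR R) R mu setT measurableT
  f_ (fun x => (f x)%:E) (fun x => `|(f x)%:E|)%E mf_ mf.
- apply: aeW => x _; apply: cvg_near_cst.
  exists (Num.bound `|x|) => // n /= bn; rewrite /f_ indicE mem_set ?mul1r//=.
  rewrite in_itv /= -ler_norml; apply: le_trans (ltW (archi_boundP (normr_ge0 x))) _.
  by rewrite ler_nat.
- exact: integrable_abse.
- apply: aeW => x n _; rewrite /f_ /= lee_fin normrM ler_piMl// indicE.
  by rewrite ger0_norm ?ler0n// lern1 leq_b1.
rewrite -cvg_shiftS => h; apply: (cvg_unique _ h) => //.
rewrite [X in X @ _](_ : _ = (fun n => (F n.+1%:R - F (- n.+1%:R))%:E)); last first.
  by apply/funext => n; rewrite -E.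
apply: cvg_EFin; first exact: nearW.
have -> : 0 = 0 - 0 :> R by rewrite subr0.
apply: cvgB; [move: Fp|move: Fm]; by rewrite -cvg_shiftS.
Unshelve. all: end_near. Qed.

Definition gcos (y x : R) := cos (y * x) * gauss1 x.
Definition gsin (y x : R) := sin (y * x) * gauss1 x.

Lemma is_derive_gauss1 (x : R) : is_derive x (1 : R) gauss1 (- (x * gauss1 x)).
Proof.
rewrite /gauss1.
apply: is_derive_eq.
rewrite /GRing.scale /=; field; by [].
Qed.

Lemma measurable_mulr_fun (h : R -> R) (y : R) : continuous h ->
  measurable_fun [set: measurableTypeR R] (fun x => h (y * x) : measurableTypeR R).
Proof.
move=> ch; apply: (measurableT_comp (f := h)) => //.
by apply: continuous_measurable_fun.
Qed.

Lemma integrable_gauss1_bounded (h : R -> R) (y : R) : continuous h -> (forall x, `|h x| <= 1) ->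
  mu.-integrable setT (fun x : R => (h (y * x) * gauss1 x)%:E).
Proof.
move=> ch h1; apply: (le_integrable _ _ _ integrable_gauss1) => //.
  apply/measurable_EFinP; apply: measurable_funM; first exact: measurable_mulr_fun.
  exact: measurable_gauss1.
move=> x _; rewrite /= lee_fin normrM ler_piMl//; exact: h1.
Qed.

Lemma normr_cos_le1 (x : R) : `|cos x| <= 1.
Proof. by rewrite ler_norml cos_geN1 cos_le1. Qed.

Lemma normr_sin_le1 (x : R) : `|sin x| <= 1.
Proof. by rewrite ler_norml sin_geN1 sin_le1. Qed.

Lemma integrable_gcos y : mu.-integrable setT (EFin \o gcos y).
Proof. by apply: integrable_gauss1_bounded; [exact: continuous_cos|exact: normr_cos_le1]. Qed.

Lemma integrable_gsin y : mu.-integrable setT (EFin \o gsin y).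
Proof. by apply: integrable_gauss1_bounded; [exact: continuous_sin|exact: normr_sin_le1]. Qed.

Lemma integrable_Mgsin y : mu.-integrable setT (fun x : R => (x * gsin y x)%:E).
Proof.
apply: (le_integrable _ _ _ integrable_gauss1M) => //.
  apply/measurable_EFinP; apply: measurable_funM => //; apply: measurable_funM.
    by apply: measurable_mulr_fun; exact: continuous_sin.
  exact: measurable_gauss1.
move=> x _; rewrite /= lee_fin !normrM normr_id ler_wpM2l// ler_piMl//.
exact: normr_sin_le1.
Qed.

Lemma gauss1_cvg0 (u : R^nat) : (forall n, n%:R <= `|u n|) ->
  gauss1 (u n) @[n --> \oo] --> (0 : R).
Proof.
move=> un; apply: (@squeeze_cvgr _ _ _ _ (cst 0) (fun n => 2 * (n.+1%:R)^-1)).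
- apply: nearW => n /=; rewrite gauss1_ge0 /=.
  rewrite /gauss1 expRN ler_pdivlMr ?ltr0Sn// ler_pdivrMl ?expR_gt0//.
  apply: (@le_trans _ _ ((1 + u n ^+ 2 / 2) * 2)); last by rewrite ler_pM2r ?expR_ge1Dx.
  rewrite -natr1.
  have := un n; have := ler0n R n; rewrite -[u n ^+ 2]real_normK ?num_real//.
  have := sqr_ge0 (`|u n| - 1); nra.
- exact: cvg_cst.
- rewrite -(mulr0 2); apply: cvgMr; exact: cvg_harmonic.
Qed.

(** Differentiation under the integral sign, with [|x| * gauss1 x] as majorant. *)
Lemma is_derive_int_gcos (y : R) :
  is_derive y (1 : R) (fun y => \int[mu]_x gcos y x) (- (\int[mu]_x (x * gsin y x))).
Proof.
have der x z : is_derive z (1 : R) (gcos ^~ x) (- (x * gsin z x)).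
  rewrite /gcos; apply: is_derive_eq; rewrite /GRing.scale /= /gsin; ring.
have d1 z x : partial1of2 gcos z x = - (x * gsin z x).
  by rewrite partial1of2E; case: (der x z).
have yI : `]y - 1, y + 1[%classic y by rewrite /= in_itv /=; apply/andP; split; lra.
have H1 : forall z : R, `]y - 1, y + 1[%classic z -> mu.-integrable setT (EFin \o gcos z).
  by move=> z _; exact: integrable_gcos.
have H2 : forall x y0 : R, `]y - 1, y + 1[%classic x -> [set: R] y0 -> derivable (gcos^~ y0) x 1.
  by move=> x z _ _; case: (der z x).
have H3 : forall x, 0 <= `|x| * gauss1 x by move=> x; rewrite mulr_ge0// gauss1_ge0.
have H4 : forall z x, `]y - 1, y + 1[%classic z -> [set: R] x ->
    `|partial1of2 gcos z x| <= `|x| * gauss1 x.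
  move=> z x _ _; rewrite d1 normrN /gsin !normrM (ger0_norm (gauss1_ge0 x)).
  by rewrite ler_wpM2l// ler_piMl// ?gauss1_ge0// normr_sin_le1.
apply: DeriveDef.
  exact: (@derivable_under_integral _ _ (measurableTypeR R) mu gcos setT measurableT
    y _ _ yI H1 H2 _ H3 integrable_gauss1M H4).
rewrite -derive1E.
rewrite (@differentiation_under_integral _ _ (measurableTypeR R) mu gcos setT measurableT
    y _ _ yI H1 H2 _ H3 integrable_gauss1M H4).
rewrite -mulN1r -RintegralZl//; last exact: integrable_Mgsin.
by apply: eq_Rintegral => x _; rewrite d1 mulN1r.
Qed.

(** With [is_derive_int_gcos], this turns the cosine transform of the Gaussian
    into a solution of the differential equation F' = - y F. *)
Lemma int_gcos_parts (y : R) :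
  y * \int[mu]_x gcos y x - \int[mu]_x (x * gsin y x) = 0.
Proof.
have i1 : mu.-integrable setT (fun x : R => (y * gcos y x)%:E).
  have := integrableZl measurableT y (integrable_gcos y).
  by apply: eq_integrable.
rewrite -RintegralZl//; last exact: integrable_gcos.
rewrite -RintegralB//; last exact: integrable_Mgsin.
have dS (x : R) : is_derive x (1 : R) (gsin y) (y * gcos y x - x * gsin y x).
  by rewrite /gsin /gcos; apply: is_derive_eq; rewrite /GRing.scale /= /gauss1; field; by [].
rewrite /Rintegral (Rintegral_derive_eq0 dS)//.
- have cg : continuous gauss1.
    move=> x; apply/differentiable_continuous/derivable1_diffP.
    by case: (is_derive_gauss1 x).
  have cy (h : R -> R) : continuous h -> continuous (fun x => h (y * x)).
    by move=> ch x; apply: continuous_comp; [apply: cvgM; [exact: cvg_cst|exact: cvg_id]|exact: ch].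
  move=> x; apply: cvgB; apply: cvgM; (try exact: cvg_cst); (try exact: cvg_id).
    by apply: cvgM; [apply: cy; exact: continuous_cos|exact: cg].
  by apply: cvgM; [apply: cy; exact: continuous_sin|exact: cg].
- have := integrableB measurableT i1 (integrable_Mgsin y).
  by apply: eq_integrable.
- apply: norm_cvg0; apply: (@squeeze_cvgr _ _ _ _ (cst 0) (fun n => gauss1 n%:R)).
  + apply: nearW => n /=; rewrite normr_ge0 normrM (ger0_norm (gauss1_ge0 _)).
    by rewrite ler_piMl ?gauss1_ge0// normr_sin_le1.
  + exact: cvg_cst.
  + by apply: (gauss1_cvg0 (u := fun n => n%:R)) => n; rewrite ger0_norm.
- apply: norm_cvg0; apply: (@squeeze_cvgr _ _ _ _ (cst 0) (fun n => gauss1 (- n%:R))).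
  + apply: nearW => n /=; rewrite normr_ge0 normrM (ger0_norm (gauss1_ge0 _)).
    by rewrite ler_piMl ?gauss1_ge0// normr_sin_le1.
  + exact: cvg_cst.
  + by apply: (gauss1_cvg0 (u := fun n => - n%:R)) => n; rewrite normrN ger0_norm.
Qed.

(** The mass is sqrt (2 pi); only its positivity matters, because the Gaussian
    appears on both sides of every identity below. *)
Definition gmass : R := \int[mu]_x gauss1 x.

Lemma gmassE : (\int[mu]_x (gauss1 x)%:E = gmass%:E)%E.
Proof.
by rewrite /gmass /Rintegral fineK//; apply: integrable_fin_num => //; exact: integrable_gauss1.
Qed.

Lemma gmass_gt0 : 0 < gmass.
Proof.
pose a : R := Num.sqrt (1 / 2).
have a0 : 0 < a by rewrite sqrtr_gt0; lra.
have := @ge0_integral_affine1 R a 0 (fun x => (gauss_fun x)%:E) a0.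
rewrite integralT_gauss => h.
have {h} := h (iffRL (measurable_EFinP _ _) (@measurable_gauss_fun R))
              (fun x => gauss_fun_ge0 x).
have -> : (\int[mu]_x (gauss_fun (0 + a * x)%R)%:E = gmass%:E)%E.
  rewrite -gmassE; apply: eq_integral => x _; congr (_%:E); rewrite /gauss_fun /gauss1.
  by rewrite add0r exprMn sqr_sqrtr ?divr_ge0// mulrC mulrA mulr1.
rewrite -EFinM => -[h]; rewrite -(pmulr_rgt0 _ a0) h.
by rewrite sqrtr_gt0 pi_gt0.
Qed.

(** The Gaussian is, up to its mass, its own Fourier transform: the quotient of
    both sides has zero derivative. *)
Lemma int_gcosE (y : R) : \int[mu]_x gcos y x = gmass * gauss1 y.
Proof.
pose F y := \int[mu]_x gcos y x.
have dF z : is_derive z (1 : R) F (- (z * F z)).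
  have := int_gcos_parts z; rewrite -/(F z) => /eqP; rewrite subr_eq0 => /eqP ->.
  exact: is_derive_int_gcos.
pose G z := F z * expR (z ^+ 2 / 2).
have dG z : is_derive z (1 : R) G 0.
  rewrite /G; apply: is_derive_eq; rewrite /GRing.scale /=; field; by [].
have := is_derive_0_is_cst y 0 dG.
rewrite /G expr0n /= mul0r expR0 mulr1 => h.
have F0 : F 0 = gmass.
  by apply: eq_Rintegral => x _; rewrite /gcos mul0r cos0 mul1r.
by rewrite -[LHS](mulfK (lt0r_neq0 (expR_gt0 (y ^+ 2 / 2)))) -/(F y) h F0 /gauss1 expRN.
Qed.

Lemma integral_gcos (y : R) : (\int[mu]_x (cos (y * x) * gauss1 x)%:E = (gmass * gauss1 y)%:E)%E.
Proof.
rewrite -int_gcosE /Rintegral fineK//; apply: integrable_fin_num => //; exact: integrable_gcos.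
Qed.

(** The integrand is odd. *)
Lemma integral_gsin (y : R) : (\int[mu]_x (sin (y * x) * gauss1 x)%:E = 0)%E.
Proof.
pose f (x : measurableTypeR R) := (sin (y * x) * gauss1 x)%:E.
have mf : measurable_fun setT f by case/integrableP: (integrable_gsin y).
have oddE (x : R) : f (- x)%R = (- f x)%E.
  by rewrite /f -EFinN /gauss1 sqrrN mulrN sinN mulNr.
rewrite -[LHS]/(\int[mu]_x f x)%E integralE.
have -> : (\int[mu]_x f^\-%E x = \int[mu]_x f^\+%E x)%E.
  rewrite -(@ge0_integral_opp1 _ f^\+%E)//; last exact: measurable_funepos.
  by apply: eq_integral => x _; rewrite funenegE funeposE oddE.
rewrite subee//; apply: integrable_pos_fin_num => //; exact: integrable_gsin.
Qed.
End gauss1.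

(** * Fourier transform of the Gaussian on R^n *)

Section gaussn.
Context {R : realType}.
Local Notation mu := (@lebesgue_measure R).

Definition gauss n (x : 'rV[R]_n) : R := expR (- (dot x x / 2)).

Lemma gauss_gt0 n (x : 'rV[R]_n) : 0 < gauss x. Proof. exact: expR_gt0. Qed.
Lemma gauss_ge0 n (x : 'rV[R]_n) : 0 <= gauss x. Proof. exact: expR_ge0. Qed.

Lemma dot_ge0 n (x : 'rV[R]_n) : 0 <= dot x x.
Proof. by apply: sumr_ge0 => i _; rewrite -expr2 sqr_ge0. Qed.

Lemma gauss_le1 n (x : 'rV[R]_n) : gauss x <= 1.
Proof. by rewrite -expR0 ler_expR oppr_le0 divr_ge0// dot_ge0. Qed.

Lemma measurable_gauss n :
  measurable_fun setT (@gauss n : 'rV[R]_n -> measurableTypeR R).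
Proof.
apply: measurableT_comp => //; apply: measurableT_comp => //.
by apply: measurable_funM => //; exact: measurable_dot.
Qed.

Lemma dotC n (x y : 'rV[R]_n) : dot x y = dot y x.
Proof. by apply: eq_bigr => i _; rewrite mulrC. Qed.

Lemma dotDr n (z x y : 'rV[R]_n) : dot z (x + y) = dot z x + dot z y.
Proof. by rewrite -big_split /=; apply: eq_bigr => i _; rewrite mxE mulrDr. Qed.

Lemma dotZr n (a : R) (z x : 'rV[R]_n) : dot z (a *: x) = a * dot z x.
Proof. by rewrite mulr_sumr; apply: eq_bigr => i _; rewrite mxE mulrCA. Qed.

Lemma dotDl n (z x y : 'rV[R]_n) : dot (x + y) z = dot x z + dot y z.
Proof. by rewrite dotC dotDr !(dotC z). Qed.

Lemma dotZl n (a : R) (z x : 'rV[R]_n) : dot (a *: x) z = a * dot x z.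
Proof. by rewrite dotC dotZr dotC. Qed.

Lemma dotNl n (z x : 'rV[R]_n) : dot (- x) z = - dot x z.
Proof. by rewrite -scaleN1r dotZl mulN1r. Qed.

Lemma dotBl n (z x y : 'rV[R]_n) : dot (x - y) z = dot x z - dot y z.
Proof. by rewrite dotDl dotNl. Qed.

Lemma dot_rcons n (p q : 'rV[R]_n * measurableTypeR R) :
  dot (rV_rcons p) (rV_rcons q) = dot p.1 q.1 + p.2 * q.2.
Proof.
rewrite /dot big_ord_recr /= !rV_rconsE_last; congr (_ + _).
by apply: eq_bigr => i _; rewrite !rV_rconsE.
Qed.

Lemma gauss_rcons n (p : 'rV[R]_n * measurableTypeR R) :
  gauss (rV_rcons p) = gauss p.1 * gauss1 p.2.
Proof. by rewrite /gauss /gauss1 -expRD dot_rcons; congr expR; lra. Qed.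

(** Signed counterpart of [integral_lebS], by Fubini's theorem. *)
Lemma integral_lebS_signed n (f : 'rV[R]_n.+1 -> \bar R) : (leb n.+1).-integrable setT f ->
  (\int[leb n.+1]_x f x = \int[leb n]_p \int[mu]_y f (rV_rcons (p, y)))%E.
Proof.
move=> intf; have mf : measurable_fun setT f by case/integrableP : intf.
have intr : (leb n \x mu)%E.-integrable setT (f \o @rV_rcons R n).
  apply/integrableP; split.
    by apply: measurableT_comp => //; exact: measurable_rV_rcons.
  case/integrableP : intf => _; rewrite integral_lebS//; last exact: measurableT_comp.
  rewrite (fubini_tonelli1 (fun z => `|f (rV_rcons z)|)%E)//.
  apply: measurableT_comp => //; apply: measurableT_comp => //.
  exact: measurable_rV_rcons.
rewrite (integral12_prod_meas1 intr) -[LHS]/(\int[lebesgue_rV n.+1]_x f x)%E /=.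
by rewrite (integral_pushforward (@measurable_rV_rcons R n)).
Qed.

Lemma integral_gauss n : (\int[leb n]_x (gauss x)%:E = (gmass ^+ n : R)%:E)%E.
Proof.
elim: n => [|n IH].
  rewrite integral_leb0; last 2 first.
  - by apply/measurable_EFinP; exact: measurable_gauss.
  - by move=> x; rewrite lee_fin gauss_ge0.
  by rewrite expr0 /gauss /dot big_ord0 mul0r oppr0 expR0.
rewrite integral_lebS//; last 2 first.
- by apply/measurable_EFinP; exact: measurable_gauss.
- by move=> x; rewrite lee_fin gauss_ge0.
have E p : (\int[mu]_y (gauss (rV_rcons (p, y)))%:E = gmass%:E * (@gauss n p)%:E)%E.
  under eq_integral do rewrite gauss_rcons /= EFinM.
  rewrite ge0_integralZl//.
  - by rewrite gmassE muleC.
  - by apply/measurable_EFinP; exact: measurable_gauss1.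
  - by move=> x _; rewrite lee_fin gauss1_ge0.
  - by rewrite lee_fin gauss_ge0.
under eq_integral do rewrite E.
rewrite ge0_integralZl//.
- by rewrite IH -EFinM exprS.
- by apply/measurable_EFinP; exact: measurable_gauss.
- by move=> x _; rewrite lee_fin gauss_ge0.
- by rewrite lee_fin ltW// gmass_gt0.
Qed.

Lemma integrable_gauss n : (leb n).-integrable setT (fun x => (gauss x)%:E).
Proof.
apply/integrableP; split; first by apply/measurable_EFinP; exact: measurable_gauss.
under eq_integral do rewrite gee0_abs ?lee_fin ?gauss_ge0//.
by rewrite integral_gauss ltry.
Qed.

Lemma integrable_bounded_gauss n (h : 'rV[R]_n -> R) :
  measurable_fun setT (h : 'rV[R]_n -> measurableTypeR R) -> (forall x, `|h x| <= 1) ->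
  (leb n).-integrable setT (fun x => (h x * gauss x)%:E).
Proof.
move=> mh h1; apply: (le_integrable _ _ _ (integrable_gauss n)) => //.
  by apply/measurable_EFinP; apply: measurable_funM => //; exact: measurable_gauss.
by move=> x _; rewrite /= lee_fin normrM ler_piMl.
Qed.

Lemma measurable_cos_dot d (T : measurableType d) n (f g : T -> 'rV[R]_n) :
  measurable_fun setT f -> measurable_fun setT g ->
  measurable_fun setT (fun t => cos (dot (f t) (g t)) : measurableTypeR R).
Proof.
move=> mf mg; apply: (measurableT_comp (f := cos : R -> measurableTypeR R)).
  by apply: continuous_measurable_fun; exact: continuous_cos.
exact: measurable_dot.
Qed.

(** Tensorisation of the one-dimensional transform: in the addition formula for
    [cos] the sine term integrates to zero over the last coordinate. *)
Lemma integral_cos_gauss n (z : 'rV[R]_n) :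
  (\int[leb n]_x (cos (dot z x) * gauss x)%:E = (gmass ^+ n * gauss z)%:E)%E.
Proof.
elim: n z => [|n IH] z.
  rewrite expr0 mul1r (_ : gauss z = gmass ^+ 0); last first.
    by rewrite expr0 /gauss /dot big_ord0 mul0r oppr0 expR0.
  rewrite -integral_gauss; apply: eq_integral => x _.
  by rewrite {1}/dot big_ord0 cos0 mul1r.
have icg m (t : 'rV[R]_m) : (leb m).-integrable setT (fun x => (cos (dot t x) * gauss x)%:E).
  apply: integrable_bounded_gauss; last by move=> x; exact: normr_cos_le1.
  by apply: measurable_cos_dot => //; exact: measurable_cst.
rewrite integral_lebS_signed//.
have [[t s] ->] := rV_rconsP z.
have E p : (\int[mu]_y (cos (dot (rV_rcons (t, s)) (rV_rcons (p, y))) * gauss (rV_rcons (p, y)))%:E =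
    (gmass * gauss1 s)%:E * (cos (dot t p) * @gauss n p)%:E)%E.
  transitivity (\int[mu]_y ((cos (dot t p) * gauss p)%:E * (gcos s y)%:E +
     (- (sin (dot t p) * gauss p))%:E * (gsin s y)%:E))%E.
    apply: eq_integral => y _; rewrite dot_rcons gauss_rcons /= cosD -!EFinM -EFinD.
    by congr (_%:E); rewrite /gcos /gsin; ring.
  rewrite integralD//=; last 2 first.
  - by apply: integrableZl => //; exact: integrable_gcos.
  - by apply: integrableZl => //; exact: integrable_gsin.
  rewrite !integralZl//; last 2 first.
  - exact: integrable_gsin.
  - exact: integrable_gcos.
  by rewrite integral_gcos integral_gsin mule0 adde0 muleC.
under eq_integral do rewrite E.
rewrite integralZl//; rewrite IH -EFinM gauss_rcons exprS; congr (_%:E) => /=; ring.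
Qed.

(** Signed counterpart of [ge0_integral_affine], through positive and negative
    parts. *)
Lemma integral_affine n (a : R) (x : 'rV[R]_n) (f : 'rV[R]_n -> \bar R) : 0 < a ->
  (leb n).-integrable setT f ->
  ((a ^+ n)%:E * \int[leb n]_z f (x + a *: z)%R = \int[leb n]_z f z)%E.
Proof.
move=> a0 intf; have mf : measurable_fun setT f by case/integrableP : intf.
have an0 : 0 < a ^+ n by rewrite exprn_gt0.
rewrite [in RHS]integralE [X in (_ * X)%E]integralE.
have P := @ge0_integral_affine R n a x f^\+%E a0 (measurable_funepos mf) (funepos_ge0 f).
have N := @ge0_integral_affine R n a x f^\-%E a0 (measurable_funeneg mf) (funeneg_ge0 f).
rewrite -P -N.
have fP := integrable_pos_fin_num measurableT intf.
have fN := integrable_neg_fin_num measurableT intf.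
have fin (u : \bar R) : ((a ^+ n)%:E * u)%E \is a fin_num -> u \is a fin_num.
  by case: u => [//||] /=; rewrite ?gt0_muley ?gt0_muleNy ?lte_fin.
rewrite (_ : (fun z => f (x + a *: z)%R)^\+%E = fun z => f^\+%E (x + a *: z)); last first.
  by apply/funext => z; rewrite !funeposE.
rewrite (_ : (fun z => f (x + a *: z)%R)^\-%E = fun z => f^\-%E (x + a *: z)); last first.
  by apply/funext => z; rewrite !funenegE.
by rewrite muleBr//; apply: fin_num_adde_defr; apply: fin; rewrite P.
Qed.

(** A flat Gaussian has a concentrated transform: as [e] tends to 0 the
    right-hand side is an approximate identity. *)
Lemma integral_cos_gauss_scale n (e : R) (z : 'rV[R]_n) : 0 < e ->
  (\int[leb n]_x (cos (dot z x) * gauss (e *: x))%:E =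
   ((gmass / e) ^+ n * gauss (e^-1 *: z))%:E)%E.
Proof.
move=> e0; have en0 : 0 < e ^+ n by rewrite exprn_gt0.
have icg : (leb n).-integrable setT (fun x => (cos (dot (e^-1 *: z) x) * gauss x)%:E).
  apply: integrable_bounded_gauss; last by move=> x; exact: normr_cos_le1.
  by apply: measurable_cos_dot => //; exact: measurable_cst.
have := integral_affine 0 e0 icg.
rewrite integral_cos_gauss.
under eq_integral do rewrite add0r dotZl dotZr mulrA mulVf ?gt_eqF// mul1r.
move=> h; rewrite exprMn mulrAC EFinM -h.
rewrite muleAC -EFinM exprVn mulfV ?gt_eqF// mul1e //.
Qed.
End gaussn.

(** * Modulated Gaussians are Schwartz functions *)

Section schwartz_gauss.
Context {R : realType} {n : nat}.
Local Notation rV := 'rV[R]_n.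

(** This algebra is stable under partial derivatives, and so is its product with
    a Gaussian. Hence all the derivatives of a modulated Gaussian are such
    products, and their decay can be read off at once. *)
Inductive trigpoly (a : rV) : (rV -> R) -> Prop :=
| TrigCst c : trigpoly a (fun=> c)
| TrigCoord i : trigpoly a (fun x => x 0 i)
| TrigCos : trigpoly a (fun x => cos (dot a x))
| TrigSin : trigpoly a (fun x => sin (dot a x))
| TrigAdd f g : trigpoly a f -> trigpoly a g -> trigpoly a (fun x => f x + g x)
| TrigMul f g : trigpoly a f -> trigpoly a g -> trigpoly a (fun x => f x * g x).

Local Notation unitv i := (delta_mx 0 i : rV).

(** Directional derivatives are derivatives along a line, so that the rules of
    one-variable calculus apply. *)
Lemma is_derive_line (f : rV -> R) (x v : rV) (d : R) :
  is_derive (0 : R) (1 : R) (fun t : R => f (t *: v + x)) d -> is_derive x v f d.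
Proof.
move=> [D E].
have K : (fun h : R => h^-1 *: (((fun t : R => f (t *: v + x)) \o shift 0) (h *: (1 : R)) - f (0 *: v + x)))
   = (fun h : R => h^-1 *: ((f \o shift x) (h *: v) - f x)).
  by apply/funext => h /=; rewrite scale0r add0r /GRing.scale /= mulr1 addr0.
by apply: DeriveDef; [move: D|move: E]; rewrite /derivable /derive K.
Qed.

Lemma dot_unitv (a : rV) i : dot a (unitv i) = a 0 i.
Proof.
rewrite /dot (bigD1 i)//= !mxE !eqxx mulr1 big1 ?addr0// => j ji.
by rewrite !mxE (negbTE ji) andbF mulr0.
Qed.

Lemma dot_delta (a x : rV) (i : 'I_n) (t : R) : dot a (t *: 'e_i + x) = t * a 0 i + dot a x.
Proof.
by rewrite dotDr dotZr dot_unitv.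
Qed.

Lemma trigpoly_derive (a : rV) (i : 'I_n) (f : rV -> R) : trigpoly a f ->
  exists2 f', trigpoly a f' & forall x, is_derive x (unitv i) f (f' x).
Proof.
elim=> {f} [c|j|||f g _ [f' Tf' df] _ [g' Tg' dg]|f g Tf [f' Tf' df] Tg [g' Tg' dg]].
- exists (fun=> 0); first exact: TrigCst.
  by move=> x; exact: is_derive_cst.
- exists (fun=> (j == i)%:R); first exact: TrigCst.
  move=> x; apply: is_derive_line.
  under eq_fun do rewrite !mxE eqxx /=.
  by apply: is_derive_eq; rewrite /GRing.scale /=; ring.
- exists (fun x => (- a 0 i) * sin (dot a x)).
    by apply: TrigMul; [exact: TrigCst|exact: TrigSin].
  move=> x; apply: is_derive_line.
  under eq_fun do rewrite dot_delta.
  by apply: is_derive_eq; rewrite /GRing.scale /= mul0r add0r; ring.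
- exists (fun x => a 0 i * cos (dot a x)).
    by apply: TrigMul; [exact: TrigCst|exact: TrigCos].
  move=> x; apply: is_derive_line.
  under eq_fun do rewrite dot_delta.
  by apply: is_derive_eq; rewrite /GRing.scale /= mul0r add0r; ring.
- exists (fun x => f' x + g' x); first exact: TrigAdd.
  by move=> x; apply: is_deriveD.
- exists (fun x => f x * g' x + g x * f' x); first by apply: TrigAdd; exact: TrigMul.
  by move=> x; apply: is_deriveM.
Qed.

Lemma continuous_dot (a : rV) : continuous (dot a).
Proof.
rewrite /dot; elim: (index_enum _) => [|i r IH] x; have Fx : Filter (nbhs x) by apply: nbhs_filter.
  by under eq_fun do rewrite big_nil; exact: cst_continuous.
under eq_fun do rewrite big_cons.
apply: cvgD; last exact: IH.
by apply: cvgM; [exact: cvg_cst|exact: coord_continuous].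
Qed.

Lemma trigpoly_continuous (a : rV) (f : rV -> R) : trigpoly a f -> continuous f.
Proof.
elim=> {f} [c|j|||f g _ cf _ cg|f g _ cf _ cg] x; have Fx : Filter (nbhs x) by apply: nbhs_filter.
- exact: cvg_cst.
- exact: coord_continuous.
- by apply: continuous_comp; [exact: continuous_dot|exact: continuous_cos].
- by apply: continuous_comp; [exact: continuous_dot|exact: continuous_sin].
- by apply: cvgD; [exact: cf|exact: cg].
- by apply: cvgM; [exact: cf|exact: cg].
Qed.

(** Growth slower than every Gaussian centred at [b]. Asking for all rates [c] at
    once makes the class stable under products: split [c] into halves. *)
Definition subgauss (b : rV) (f : rV -> R) := forall c, 0 < c ->
  exists M, forall x, `|f x| * expR (- (c * dot (x - b) (x - b))) <= M.

Lemma subgauss_cst b c : subgauss b (fun=> c).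
Proof.
move=> d d0; exists `|c| => x; rewrite ler_piMr// -expR0 ler_expR oppr_le0.
by rewrite mulr_ge0 ?dot_ge0// ltW.
Qed.

Lemma subgaussD b f g : subgauss b f -> subgauss b g -> subgauss b (fun x => f x + g x).
Proof.
move=> sf sg c c0; have [M hM] := sf c c0; have [N hN] := sg c c0.
exists (M + N) => x; apply: le_trans (lerD (hM x) (hN x)).
by rewrite -mulrDl ler_wpM2r ?expR_ge0// ler_normD.
Qed.

Lemma subgaussM b f g : subgauss b f -> subgauss b g -> subgauss b (fun x => f x * g x).
Proof.
move=> sf sg c c0; have c2 : 0 < c / 2 by lra.
have [M hM] := sf _ c2; have [N hN] := sg _ c2.
exists (M * N) => x.
have -> : - (c * dot (x - b) (x - b)) =
  - (c / 2 * dot (x - b) (x - b)) - (c / 2 * dot (x - b) (x - b)) by lra.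
rewrite expRD normrM mulrACA; apply: ler_pM => //;
  by rewrite mulr_ge0 ?expR_ge0.
Qed.

Lemma subgauss_le b f g : (forall x, `|f x| <= `|g x|) -> subgauss b g -> subgauss b f.
Proof.
move=> fg sg c c0; have [M hM] := sg c c0; exists M => x; apply: le_trans (hM x).
by rewrite ler_wpM2r ?expR_ge0.
Qed.

Lemma sqr_norm_le_dot (x : rV) : `|x| ^+ 2 <= dot x x.
Proof.
have [->|x0] := eqVneq x 0; first by rewrite normr0 expr0n dot_ge0.
have [[j i] /= E] : exists i, mx_norm x = `|x i.1 i.2| by apply: mx_norm_neq0; rewrite -[mx_norm x]/`|x| normr_eq0.
rewrite (_ : `|x| = `|x j i|)// real_normK ?num_real//.
rewrite /dot (bigD1 i)//= (ord1 j) -expr2 lerDl.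
by apply: sumr_ge0 => k _; rewrite -expr2 sqr_ge0.
Qed.

(** From [|x| <= |b| + 1 + |x - b|^2] and [s <= exp s]. *)
Lemma subgauss_norm b : subgauss b (fun x => `|x|).
Proof.
move=> c c0; exists (`|b| + (1 + c^-1)) => x; rewrite normr_id.
set E := expR _.
have E1 : E <= 1 by rewrite -expR0 ler_expR oppr_le0 mulr_ge0 ?dot_ge0// ltW.
have E0 : 0 <= E by exact: expR_ge0.
have h1 : `|x| <= `|b| + `|x - b| by rewrite (le_trans _ (ler_normD _ _))// addrC subrK.
have h2 := sqr_norm_le_dot (x - b).
have h3 : dot (x - b) (x - b) * E <= c^-1.
  rewrite /E expRN ler_pdivrMr ?expR_gt0// ler_pdivlMl//.
  by apply: le_trans (expR_ge1Dx _); rewrite lerDr.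
have h4 : `|x - b| <= 1 + `|x - b| ^+ 2 by have := normr_ge0 (x - b); nra.
have h5 : `|x| * E <= (`|b| + (1 + dot (x - b) (x - b))) * E.
  rewrite ler_wpM2r//; lra.
apply: (le_trans h5); rewrite !mulrDl mul1r.
by apply: lerD; [rewrite ler_piMr|exact: lerD].
Qed.

Lemma trigpoly_subgauss a b f : trigpoly a f -> subgauss b f.
Proof.
elim=> {f} [c|j|||f g _ cf _ cg|f g _ cf _ cg].
- exact: subgauss_cst.
- apply: (subgauss_le _ (@subgauss_norm b)) => x; rewrite normr_id.
  have [->|x0] := eqVneq x 0; first by rewrite mxE !normr0.
  rewrite [leRHS]mx_normrE.
  exact: (le_bigmax _ (fun ij : 'I_1 * 'I_n => `|x ij.1 ij.2|) (0, j)).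
- apply: (subgauss_le _ (@subgauss_cst b 1)) => x.
  by rewrite normr1 normr_cos_le1.
- apply: (subgauss_le _ (@subgauss_cst b 1)) => x.
  by rewrite normr1 normr_sin_le1.
- exact: subgaussD.
- exact: subgaussM.
Qed.

Lemma subgauss_normX b k : subgauss b (fun x => `|x| ^+ k).
Proof.
elim: k => [|k IH]; first exact: subgauss_cst.
by under eq_fun do rewrite exprS; apply: subgaussM => //; exact: subgauss_norm.
Qed.

Section weight.
Variables (e : R) (a b : rV).
Hypothesis e0 : 0 < e.

Let w (x : rV) : R := gauss (e *: (x - b)).

Let wE x : w x = expR (- ((e ^+ 2 / 2) * dot (x - b) (x - b))).
Proof. by rewrite /w /gauss dotZl dotZr; congr (expR (- _)); ring. Qed.

Lemma is_derive_weight x i : is_derive x (unitv i) w (- (e ^+ 2 * (x - b) 0 i) * w x).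
Proof.
apply: is_derive_line; under eq_fun do rewrite wE -addrA dotDl dotZl !dot_delta.
rewrite wE (dotC _ (x - b)) dot_unitv.
have -> : (unitv i) 0 i = 1 by rewrite mxE !eqxx.
move: (dot _ _) ((x - b) 0 i) => D q.
by apply: is_derive_eq; rewrite /GRing.scale /= !(mul0r, add0r, addr0); field.
Qed.

Lemma weight_continuous : continuous w.
Proof.
move=> x; have Fx : Filter (nbhs x) by apply: nbhs_filter.
have cb : continuous (fun x : rV => dot (x - b) (x - b)).
  rewrite (_ : (fun _ => _) = (fun x => dot x x + (dot b b - 2 * dot b x))); last first.
    by apply/funext => y; rewrite dotBl !(dotC _ (y - b)) !dotBl (dotC y b); ring.
  move=> y; have Fy : Filter (nbhs y) by apply: nbhs_filter.
  apply: cvgD; last first.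
    apply: cvgB; first exact: cvg_cst.
    by apply: cvgM; [exact: cvg_cst|exact: continuous_dot].
  rewrite /dot; elim: (index_enum _) => [|i r IH].
    by under eq_fun do rewrite big_nil; rewrite big_nil; exact: cvg_cst.
  under eq_fun do rewrite big_cons.
  rewrite big_cons; apply: cvgD; last exact: IH.
  by apply: cvgM; exact: coord_continuous.
rewrite (_ : w = (fun x => expR (- ((e ^+ 2 / 2) * dot (x - b) (x - b))))); last exact/funext.
apply: continuous_comp; last exact: continuous_expR.
by apply: cvgN; apply: cvgM; [exact: cvg_cst|exact: cb].
Qed.

Lemma schwartz_weight f : trigpoly a f -> smooth (fun x => f x * w x) /\
  rapidly_decreasing (fun x => f x * w x).
Proof.
move=> Tf.
have D i g : trigpoly a g -> exists2 g', trigpoly a g' &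
    forall x, is_derive x (unitv i) (fun x => g x * w x) (g' x * w x).
  move=> Tg; have [g' Tg' dg] := trigpoly_derive i Tg.
  exists (fun x => g' x + g x * (- e ^+ 2 * (x 0 i + - b 0 i))).
    apply: TrigAdd => //; apply: TrigMul => //; apply: TrigMul; first exact: TrigCst.
    by apply: TrigAdd; [exact: TrigCoord|exact: TrigCst].
  move=> x; have dw := is_derive_weight x i.
  apply: is_derive_eq; rewrite /GRing.scale /= !mxE; ring.
have P s : exists2 g, trigpoly a g & partials s (fun x => f x * w x) = (fun x => g x * w x).
  elim: s => [|i s [g Tg E]] /=; first by exists f.
  rewrite E; have [g' Tg' dg] := D i g Tg.
  by exists g' => //; apply/funext => x; case: (dg x).
split => s.
  have [g Tg ->] := P s; split.
    move=> x; have Fx : Filter (nbhs x) by apply: nbhs_filter.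
    by apply: cvgM; [exact: (trigpoly_continuous Tg)|exact: weight_continuous].
  by move=> x i; have [g' _ dg] := D i g Tg; case: (dg x).
move=> k; have [g Tg ->] := P s.
have e2 : 0 < e ^+ 2 / 2 by rewrite divr_gt0// exprn_gt0.
have [M hM] := subgaussM (@subgauss_normX b k) (trigpoly_subgauss b Tg) e2.
exists M => x; apply: le_trans (hM x).
by rewrite !normrM mulrA wE normrX normr_id (ger0_norm (expR_ge0 _)).
Qed.

End weight.

(** Modulated and translated Gaussians are the Schwartz functions against which
    the two tempered functions are tested. *)
Lemma schwartz_cis_gauss (e : R) (a b : rV) : 0 < e ->
  schwartz (fun x => (cis (dot a x) * (gauss (e *: (x - b)))%:C)%C).
Proof.
move=> e0.
have Er : re_fun (fun x => (cis (dot a x) * (gauss (e *: (x - b)))%:C)%C) =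
  fun x => cos (dot a x) * gauss (e *: (x - b)).
  by apply/funext => x; rewrite /re_fun /= mulr0 subr0.
have Ei : im_fun (fun x => (cis (dot a x) * (gauss (e *: (x - b)))%:C)%C) =
  fun x => sin (dot a x) * gauss (e *: (x - b)).
  by apply/funext => x; rewrite /im_fun /= mulr0 add0r.
have [sc rc] := schwartz_weight b e0 (TrigCos a).
have [ss rs] := schwartz_weight b e0 (TrigSin a).
by split; rewrite /csmooth ?Er ?Ei.
Qed.

End schwartz_gauss.

(** * The regularised kernel and its spectral formula *)

Section smoothing.
Context {R : realType} {n : nat} (gamma ghat : 'rV[R]_n -> \bar R).
Hypothesis K : admissible_kernel gamma ghat.
Local Notation rV := 'rV[R]_n.

Let K0 x : (0 <= gamma x)%E. Proof. exact: (kernel_ge0 K). Qed.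

Lemma integrable_kernel_gauss (e : R) (b : rV) : 0 < e ->
  (leb n).-integrable setT (fun x => gamma x * (gauss (e *: (x - b)))%:E)%E.
Proof.
move=> e0; have [[int _] _ _] := kernel_fourier K.
have [ir _] := int _ (schwartz_cis_gauss 0 b e0).
apply: eq_integrable ir => // x _; rewrite /re_fun /= mulr0 subr0.
by rewrite /dot big1 ?cos0 ?mul1r// => i _; rewrite mxE mul0r.
Qed.

Lemma integrable_spectral_gauss (e : R) (b : rV) : 0 < e ->
  (leb n).-integrable setT (fun x => ghat x * (gauss (e *: (x - b)))%:E)%E.
Proof.
move=> e0; have [_ [int _] _] := kernel_fourier K.
have [ir _] := int _ (schwartz_cis_gauss 0 b e0).
apply: eq_integrable ir => // x _; rewrite /re_fun /= mulr0 subr0.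
by rewrite /dot big1 ?cos0 ?mul1r// => i _; rewrite mxE mul0r.
Qed.

(** The pairing with a Gaussian is integrable, hence measurable; divide by the
    Gaussian, which does not vanish. *)
Lemma measurable_kernel : measurable_fun setT gamma.
Proof.
have /integrableP[mg _] := @integrable_kernel_gauss 1 0 ltr01.
rewrite (_ : gamma = fun x => (gamma x * (gauss (1 *: (x - 0)))%:E * ((gauss (1 *: (x - 0)))^-1)%:E)%E).
  apply: emeasurable_funM => //; apply/measurable_EFinP.
  rewrite (_ : (fun _ => _) = fun x : rV => expR (dot (x - 0) (x - 0) / 2)).
    apply: measurableT_comp => //; apply: measurable_funM => //.
    by apply: measurable_dot; apply: measurable_rVB.
  by apply/funext => x; rewrite scale1r /gauss expRN invrK.
apply/funext => x; rewrite -muleA -EFinM mulfV ?mule1// gt_eqF//.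
exact: gauss_gt0.
Qed.

(** The spectral density as a finite and nonnegative function; it agrees with
    [ghat] almost everywhere, see [ae_spec]. *)
Definition spec (x : rV) : R := Order.max (fine (ghat x)) 0.

Lemma spec_ge0 x : 0 <= spec x.
Proof. by rewrite /spec le_max lexx orbT. Qed.

Lemma measurable_spec : measurable_fun setT (spec : rV -> measurableTypeR R).
Proof.
apply: measurable_maxr => //.
by apply: measurableT_comp => //; exact: (kernel_fourier_meas K).
Qed.

(** Finiteness almost everywhere comes from integrability against a Gaussian. *)
Lemma ae_spec : {ae leb n, forall x, ghat x = (spec x)%:E}.
Proof.
have := kernel_fourier_ge0 K; have := integrable_ae measurableT (integrable_spectral_gauss 0 ltr01).
apply: filterS2 => x /(_ I) fg g0.
have g : ghat x \is a fin_num.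
  move: fg g0; case: (ghat x) => [//||//] /=.
  by rewrite gt0_mulye ?lte_fin ?gauss_gt0.
by rewrite /spec (max_idPl _) ?fineK// fine_ge0.
Qed.

Lemma integral_spec (h : rV -> R) : measurable_fun setT (h : rV -> measurableTypeR R) ->
  (\int[leb n]_x (ghat x * (h x)%:E) = \int[leb n]_x (spec x * h x)%:E)%E.
Proof.
move=> mh; apply: ae_eq_integral => //.
- apply: emeasurable_funM; first exact: (kernel_fourier_meas K).
  exact/measurable_EFinP.
- by apply/measurable_EFinP; apply: measurable_funM => //; exact: measurable_spec.
by have := ae_spec; apply: filterS => x -> _; rewrite EFinM.
Qed.

Lemma integrable_spec_gauss (h : rV -> R) (e : R) : 0 < e ->
  measurable_fun setT (h : rV -> measurableTypeR R) -> (forall x, `|h x| <= 1) ->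
  (leb n).-integrable setT (fun x => (spec x * (h x * gauss (e *: x)))%:E)%E.
Proof.
move=> e0 mh h1.
have mhg : measurable_fun setT (fun x : rV => h x * gauss (e *: x) : measurableTypeR R).
  apply: measurable_funM => //.
  by apply: measurableT_comp; [exact: measurable_gauss|exact: measurable_rVZ].
have mf : measurable_fun setT (fun x => (spec x * (h x * gauss (e *: x)))%:E)%E.
  by apply/measurable_EFinP; apply: measurable_funM => //; exact: measurable_spec.
apply/integrableP; split => //.
have /integrableP[mg] := integrable_spectral_gauss 0 e0.
apply: le_lt_trans; apply: ae_ge0_le_integral => //.
- exact: measurableT_comp.
- exact: measurableT_comp.
- have := ae_spec; apply: filterS => x -> _ /=.
  rewrite subr0 lee_fin !normrM ler_wpM2l// ler_piMl//.
Qed.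

(** Up to the constant [gmass ^+ n], the convolution of the kernel with a
    centred Gaussian of standard deviation [e]. *)
Definition smooth_kernel (e : R) (x : rV) : \bar R :=
  (\int[leb n]_z (gamma (x + e *: z)%R * (gauss z)%:E))%E.

Lemma smooth_kernel_ge0 e x : (0 <= smooth_kernel e x)%E.
Proof. by apply: integral_ge0 => z _; rewrite mule_ge0 ?lee_fin ?gauss_ge0. Qed.

Lemma gauss_opp (x : rV) : gauss (- x) = gauss x.
Proof. by rewrite /gauss dotNl dotC dotNl opprK. Qed.

Lemma re_fourier_gauss (e : R) (x y : rV) : 0 < e ->
  re_fun (fourier (fun u => cis (dot x u) * (gauss (e *: (u - 0)))%:C)%C) y =
  (gmass / e) ^+ n * gauss (e^-1 *: (y - x)).
Proof.
move=> e0; rewrite /re_fun /fourier /cintegral /=.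
rewrite /Rintegral -[RHS]/(fine ((gmass / e) ^+ n * gauss (e^-1 *: (y - x)))%:E).
rewrite -opprB scalerN gauss_opp -integral_cos_gauss_scale//.
congr fine; apply: eq_integral => u _ /=.
rewrite !(mulr0, subr0, add0r) dotBl cosB cosN sinN; congr (_%:E); ring.
Qed.

Lemma measurable_gauss_shift (e : R) (x : rV) :
  measurable_fun setT (fun y : rV => (gauss (e *: (y - x)))%:E).
Proof.
apply/measurable_EFinP; apply: measurableT_comp; first exact: measurable_gauss.
by apply: measurable_rVZ; exact: measurable_rVB.
Qed.

Lemma smooth_kernel_scale (e : R) (x : rV) : 0 < e ->
  ((e ^+ n)%:E * smooth_kernel e x =
   \int[leb n]_y (gamma y * (gauss (e^-1 *: (y - x)))%:E))%E.
Proof.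
move=> e0; pose f y := (gamma y * (gauss (e^-1 *: (y - x)))%:E)%E.
have mf : measurable_fun setT f.
  by apply: emeasurable_funM; [exact: measurable_kernel|exact: measurable_gauss_shift].
have f0 y : (0 <= f y)%E by rewrite mule_ge0 ?lee_fin ?gauss_ge0.
have <- : ((e ^+ n)%:E * \int[leb n]_z f (x + e *: z)%R = \int[leb n]_y f y)%E.
  exact: ge0_integral_affine.
suff -> : (\int[leb n]_z f (x + e *: z)%R = smooth_kernel e x)%E by [].
apply: eq_integral => z _; rewrite /f.
have -> : e^-1 *: (x + e *: z - x) = z by rewrite addrC addKr scalerA mulVf ?gt_eqF// scale1r.
by [].
Qed.

Lemma smooth_kernel_fin_num (e : R) (x : rV) : 0 < e -> smooth_kernel e x \is a fin_num.
Proof.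
move=> e0; have ei0 : 0 < e^-1 by rewrite invr_gt0.
have : ((e ^+ n)%:E * smooth_kernel e x)%E \is a fin_num.
  rewrite smooth_kernel_scale//; apply: integrable_fin_num => //.
  exact: integrable_kernel_gauss.
have en0 : (0 < (e ^+ n)%:E)%E by rewrite lte_fin exprn_gt0.
by case: (smooth_kernel e x) => [//||]; rewrite ?gt0_muley// gt0_muleNy.
Qed.

(** The identity between distributions, tested against a modulated Gaussian: its
    Fourier transform is a Gaussian centred at [x], by [re_fourier_gauss]. *)
Lemma smooth_kernelE (e : R) (x : rV) : 0 < e ->
  ((gmass ^+ n)%:E * smooth_kernel e x =
  \int[leb n]_xi (spec xi * (cos (dot x xi) * gauss (e *: xi)))%:E)%E.
Proof.
move=> e0.
have ei0 : 0 < e^-1 by rewrite invr_gt0.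
have := (let: And3 _ _ H := kernel_fourier K in H) _ (schwartz_cis_gauss x 0 e0).
rewrite /fourier_distr /pairing => /(congr1 (@complex.Re _)) /=.
have mcg : measurable_fun setT (fun xi : rV => cos (dot x xi) * gauss (e *: xi) : measurableTypeR R).
  apply: measurable_funM; first by apply: measurable_cos_dot => //; exact: measurable_cst.
  by apply: measurableT_comp; [exact: measurable_gauss|exact: measurable_rVZ].
have -> : (\int[lebesgue_rV n]_u (ghat u * (re_fun (fun u => cis (dot x u) *
     (gauss (e *: (u - 0)))%:C%C) u)%:E) =
   \int[leb n]_xi (spec xi * (cos (dot x xi) * gauss (e *: xi)))%:E)%E.
  rewrite -integral_spec//.
  by apply: eq_integral => u _; rewrite /re_fun /= mulr0 !subr0.
have en0 : 0 < e ^+ n by rewrite exprn_gt0.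
have gn0 : 0 < (gmass : R) ^+ n by rewrite exprn_gt0 ?gmass_gt0.
have -> : (\int[lebesgue_rV n]_u (gamma u * (re_fun (fourier (fun u => cis (dot x u) *
     (gauss (e *: (u - 0)))%:C%C)) u)%:E) = (gmass ^+ n)%:E * smooth_kernel e x)%E.
  under eq_integral do rewrite re_fourier_gauss// EFinM muleCA.
  rewrite -[LHS]/(\int[leb n]_u (((gmass / e) ^+ n)%:E * (gamma u * (gauss (e^-1 *: (u - x)))%:E)))%E.
  have mf : measurable_fun setT (fun u => gamma u * (gauss (e^-1 *: (u - x)))%:E)%E.
    by apply: emeasurable_funM; [exact: measurable_kernel|exact: measurable_gauss_shift].
  have f0 u : setT u -> (0 <= gamma u * (gauss (e^-1 *: (u - x)))%:E)%E.
    by move=> _; rewrite mule_ge0 ?lee_fin ?gauss_ge0.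
  have k0 : (0 <= ((gmass / e) ^+ n)%:E)%E.
    by rewrite lee_fin exprn_ge0// divr_ge0 ?ltW// gmass_gt0.
  rewrite (ge0_integralZl (leb n) measurableT mf f0 k0).
  by rewrite -smooth_kernel_scale// muleA -EFinM -exprMn mulfVK ?gt_eqF.
have f1 : (\int[leb n]_xi (spec xi * (cos (dot x xi) * gauss (e *: xi)))%:E)%E \is a fin_num.
  apply: integrable_fin_num => //; apply: integrable_spec_gauss => //.
    by apply: measurable_cos_dot => //; exact: measurable_cst.
  by move=> u; exact: normr_cos_le1.
have f2 : ((gmass ^+ n)%:E * smooth_kernel e x)%E \is a fin_num.
  by rewrite fin_numM// smooth_kernel_fin_num.
by move=> h; rewrite -[LHS]fineK// -h fineK.
Qed.

End smoothing.

(** * Energies and their spectral form *)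

Section fatou_cvg.
Context {R : realType} {d : measure_display} {T : measurableType d}.
Variable mu : {measure set T -> \bar R}.

(** Fatou's lemma without lower limits: a strict lower bound of the limit is
    eventually a strict lower bound of the integrals. *)
Lemma fatou_near (f : (T -> \bar R)^nat) (g : T -> \bar R) (a : \bar R) :
  (forall k, measurable_fun setT (f k)) -> (forall k x, 0 <= f k x)%E ->
  (forall x, f k x @[k --> \oo] --> g x) ->
  (a < \int[mu]_x g x)%E -> \forall k \near \oo, (a < \int[mu]_x f k x)%E.
Proof.
move=> mf f0 fg ag.
have := fatou mu measurableT mf (fun k x _ => f0 k x).
under eq_integral do rewrite (cvg_limn_einf_sup (fg _)).1.
move=> /(lt_le_trans ag); rewrite limn_einf_lim.
move=> aL.
have [N aN] : exists N, (a < einfs (fun k => \int[mu]_x f k x) N)%E.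
  apply: contrapT => /forallNP h; move: aL; rewrite ltNge => /negP; apply.
  apply: lime_le; first exact: is_cvg_einfs.
  by apply: nearW => N; rewrite leNgt; apply/negP.
exists N => // k Nk; apply: (lt_le_trans aN); apply: ereal_inf_lbound.
by exists k.
Qed.

Lemma fatou_le (f : (T -> \bar R)^nat) (g : T -> \bar R) (a : \bar R) :
  (forall k, measurable_fun setT (f k)) -> (forall k x, 0 <= f k x)%E ->
  (forall x, f k x @[k --> \oo] --> g x) ->
  (forall k, \int[mu]_x f k x <= a)%E -> (\int[mu]_x g x <= a)%E.
Proof.
move=> mf f0 fg fa; rewrite leNgt; apply/negP => /(fatou_near mf f0 fg)[N _ h].
by have := h N (leqnn N); rewrite ltNge fa.
Qed.

End fatou_cvg.

Section spectral_energy.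
Context {R : realType} {n : nat} (gamma ghat : 'rV[R]_n -> \bar R).
Hypothesis K : admissible_kernel gamma ghat.
Local Notation rV := 'rV[R]_n.
Local Notation spec := (spec ghat).
Local Notation smooth_kernel := (smooth_kernel gamma).
Context {d : measure_display} {T : measurableType d}.
Variable lam : {sigma_finite_measure set T -> \bar R}.
Variables (Y : T -> rV) (D : T -> R).
Hypothesis mY : measurable_fun setT Y.
Hypothesis mD : measurable_fun setT (D : T -> measurableTypeR R).
Hypothesis D0 : forall t, 0 <= D t.
Hypothesis Dfin : (\int[lam]_t (D t)%:E < +oo)%E.

(** Real part of the characteristic function of [Y] under the measure of density
    [D] with respect to [lam]. *)
Definition weighted_chf (xi : rV) : R := \int[lam]_t (D t * cos (dot (Y t) xi)).

Lemma integrable_weighted_cos xi :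
  lam.-integrable setT (fun t => (D t * cos (dot (Y t) xi))%:E).
Proof.
have m : measurable_fun setT (fun t => D t * cos (dot (Y t) xi) : measurableTypeR R).
  apply: measurable_funM => //; apply: measurable_cos_dot => //; exact: measurable_cst.
apply/integrableP; split; first exact/measurable_EFinP.
apply: le_lt_trans Dfin; apply: ge0_le_integral => //.
- by apply: measurableT_comp => //; exact/measurable_EFinP.
- exact/measurable_EFinP.
- move=> t _; rewrite lee_fin normrM (ger0_norm (D0 t)) ler_piMr//.
  exact: normr_cos_le1.
Qed.

Lemma weighted_chfE xi :
  (\int[lam]_t (D t * cos (dot (Y t) xi))%:E = (weighted_chf xi)%:E)%E.
Proof.
by rewrite /weighted_chf /Rintegral fineK//; apply: integrable_fin_num => //;
  exact: integrable_weighted_cos.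
Qed.

Lemma measurable_kernel_shift (e : R) :
  measurable_fun setT (fun z : T * rV => gamma (Y z.1 + e *: z.2)%R).
Proof.
apply: measurableT_comp; first exact: (measurable_kernel K).
apply: measurable_rVD; last by apply: measurable_rVZ; exact: measurable_snd.
by apply: measurableT_comp => //; exact: measurable_fst.
Qed.

Lemma measurable_smooth_kernel (e : R) : measurable_fun setT (fun t => smooth_kernel e (Y t)).
Proof.
apply: (measurable_fun_fubini_tonelli_F (fun z : T * rV => gamma (Y z.1 + e *: z.2)%R * (gauss z.2)%:E)%E).
  apply: emeasurable_funM; first exact: measurable_kernel_shift.
  apply/measurable_EFinP; apply: measurableT_comp; first exact: measurable_gauss.
  exact: measurable_snd.
by move=> z; rewrite mule_ge0 ?lee_fin ?gauss_ge0// (kernel_ge0 K).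
Qed.

(** Fubini's theorem for [smooth_kernelE]; the Gaussian factor makes the double
    integral absolutely convergent. *)
Lemma integral_smooth_kernelE (e : R) : 0 < e ->
  ((gmass ^+ n)%:E * \int[lam]_t ((D t)%:E * smooth_kernel e (Y t)) =
  \int[leb n]_xi (spec xi * (weighted_chf xi * gauss (e *: xi)))%:E)%E.
Proof.
move=> e0.
have gn0 : 0 <= (gmass : R) ^+ n by rewrite exprn_ge0 ?ltW ?gmass_gt0.
pose F (z : T * rV) : \bar R :=
  (spec z.2 * (D z.1 * cos (dot (Y z.1) z.2) * gauss (e *: z.2)))%:E.
have mF : measurable_fun setT F.
  apply/measurable_EFinP; apply: measurable_funM.
    by apply: measurableT_comp; [exact: (measurable_spec K)|exact: measurable_snd].
  apply: measurable_funM; last first.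
    apply: measurableT_comp; [exact: measurable_gauss|].
    by apply: measurable_rVZ; exact: measurable_snd.
  apply: measurable_funM.
    by apply: measurableT_comp => //; exact: measurable_fst.
  by apply: measurable_cos_dot; [apply: measurableT_comp => //; exact: measurable_fst|exact: measurable_snd].
have i1 : (leb n).-integrable setT (fun x => (spec x * gauss (e *: x))%:E).
  have : (leb n).-integrable setT (fun x => (spec x * (1 * gauss (e *: x)))%:E).
    by apply: (integrable_spec_gauss K) => // x; rewrite normr1.
  by under eq_fun do rewrite mul1r.
have mi1 : measurable_fun setT (fun x => (spec x * gauss (e *: x))%:E) by case/integrableP : i1.
have iF : (lam \x leb n)%E.-integrable setT F.
  apply/(integrable12ltyP _ _ mF).
  set S := (\int[leb n]_x (spec x * gauss (e *: x))%:E)%E.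
  have S0 : (0 <= S)%E by apply: integral_ge0 => x _; rewrite lee_fin mulr_ge0 ?spec_ge0 ?gauss_ge0.
  have Sf : S \is a fin_num by apply: integrable_fin_num.
  apply: (@le_lt_trans _ _ (\int[lam]_t (S * (D t)%:E))%E); last first.
    rewrite ge0_integralZl//; last 2 first.
    - exact/measurable_EFinP.
    - by move=> t _; rewrite lee_fin.
    by rewrite lte_mul_pinfty.
  apply: ge0_le_integral => //.
  - by move=> t _; apply: integral_ge0.
  - by apply: (measurable_fun_fubini_tonelli_F (fun z => `|F z|%E)) => //; exact: measurableT_comp.
  - by apply: emeasurable_funM => //; exact/measurable_EFinP.
  - move=> t _; rewrite muleC /S -ge0_integralZl//; last 2 first.
    + by move=> x _; rewrite lee_fin mulr_ge0 ?spec_ge0 ?gauss_ge0.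
    + by rewrite lee_fin.
    apply: ge0_le_integral => //.
    + by apply: measurableT_comp => //; apply: (measurableT_comp mF); exact: measurable_pair1.
    + exact: emeasurable_funM.
    + move=> x _; rewrite /F /= -EFinM lee_fin [leRHS]mulrCA normrM (ger0_norm (spec_ge0 _ _)).
      rewrite ler_wpM2l ?spec_ge0// !normrM (ger0_norm (gauss_ge0 _)) (ger0_norm (D0 _)).
      by rewrite ler_wpM2r ?gauss_ge0// ler_piMr// normr_cos_le1.
have msk := measurable_smooth_kernel e.
rewrite -ge0_integralZl//; last 2 first.
- by apply: emeasurable_funM => //; exact/measurable_EFinP.
- by move=> t _; rewrite mule_ge0 ?lee_fin// (smooth_kernel_ge0 K).
transitivity (\int[lam]_t \int[leb n]_xi F (t, xi))%E.
  apply: eq_integral => t _; rewrite muleCA (smooth_kernelE K)// -integralZl//.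
    by apply: eq_integral => xi _; rewrite /F /= -EFinM; congr (_%:E); ring.
  apply: (integrable_spec_gauss K) => //; last by move=> x; exact: normr_cos_le1.
  by apply: measurable_cos_dot => //; exact: measurable_cst.
rewrite (Fubini iF); apply: eq_integral => xi _.
transitivity (\int[lam]_t ((spec xi * gauss (e *: xi))%:E * (D t * cos (dot (Y t) xi))%:E))%E.
  by apply: eq_integral => t _; rewrite /F /= -EFinM; congr (_%:E); ring.
rewrite integralZl//; last exact: integrable_weighted_cos.
rewrite weighted_chfE -EFinM; congr (_%:E); ring.
Qed.


(** Continuity of the kernel as a function into [0, +oo]; this includes the
    origin, where the kernel may be infinite. *)
Lemma kernel_shift_cvg (x z : rV) :
  gamma (x + (k.+1%:R)^-1 *: z)%R @[k --> \oo] --> gamma x.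
Proof.
have h : (x + (k.+1%:R)^-1 *: z) @[k --> \oo] --> x.
  rewrite -[X in _ --> X]addr0 -(scale0r z).
  apply: cvgD; first exact: cvg_cst.
  by apply: cvgZl; exact: cvg_harmonic.
exact: (cvg_comp _ _ h (kernel_cont K (x := x))).
Qed.

(** Fatou's lemma on the product of [lam] with the regularising Gaussian. *)
Lemma smooth_kernel_fatou (a : \bar R) :
  (a < (gmass ^+ n)%:E * \int[lam]_t ((D t)%:E * gamma (Y t)))%E ->
  \forall k \near \oo, (a < \int[lam]_t ((D t)%:E * smooth_kernel (k.+1%:R)^-1 (Y t)))%E.
Proof.
pose F k (z : T * rV) : \bar R :=
  ((D z.1 * gauss z.2)%:E * gamma (Y z.1 + (k.+1%:R)^-1 *: z.2)%R)%E.
have mDg : measurable_fun setT (fun z : T * rV => (D z.1 * gauss z.2)%:E).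
  apply/measurable_EFinP; apply: measurable_funM.
    by apply: measurableT_comp => //; exact: measurable_fst.
  by apply: measurableT_comp; [exact: measurable_gauss|exact: measurable_snd].
have Dg0 (z : T * rV) : (0 <= (D z.1 * gauss z.2)%:E)%E by rewrite lee_fin mulr_ge0 ?gauss_ge0.
have g0 := kernel_ge0 K.
have mF k : measurable_fun setT (F k).
  by apply: emeasurable_funM => //; exact: measurable_kernel_shift.
have F0 k z : (0 <= F k z)%E by rewrite mule_ge0.
have Fc z : F k z @[k --> \oo] --> ((D z.1 * gauss z.2)%:E * gamma (Y z.1))%E.
  by apply: cvgeZl => //; exact: kernel_shift_cvg.
have E1 : ((gmass ^+ n)%:E * \int[lam]_t ((D t)%:E * gamma (Y t)) =
   \int[lam \x leb n]_z ((D z.1 * gauss z.2)%:E * gamma (Y z.1)))%E.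
  have mgY : measurable_fun setT (fun t => gamma (Y t)).
    by apply: measurableT_comp => //; exact: (measurable_kernel K).
  rewrite fubini_tonelli1//; last 2 first.
  - apply: emeasurable_funM => //; apply: (measurableT_comp mgY); exact: measurable_fst.
  - by move=> z; rewrite mule_ge0.
  rewrite -ge0_integralZl//; last 3 first.
  - by apply: emeasurable_funM => //; exact/measurable_EFinP.
  - by move=> t _; rewrite mule_ge0 ?lee_fin.
  - by rewrite lee_fin exprn_ge0 ?ltW ?gmass_gt0.
  apply: eq_integral => t _; rewrite /fubini_F /= -integral_gauss.
  rewrite -ge0_integralZr//.
  - by apply: eq_integral => z _; rewrite EFinM; rewrite muleA [X in (X * _)%E]muleC.
  - by apply/measurable_EFinP; exact: measurable_gauss.
  - by move=> x _; rewrite lee_fin gauss_ge0.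
  - by rewrite mule_ge0 ?lee_fin.
have E2 k : (\int[lam]_t ((D t)%:E * smooth_kernel (k.+1%:R)^-1 (Y t)) =
   \int[lam \x leb n]_z F k z)%E.
  rewrite fubini_tonelli1//; apply: eq_integral => t _.
  rewrite /fubini_F /smooth_kernel -ge0_integralZl//.
  - by apply: eq_integral => z _; rewrite /F /= EFinM -muleA [X in (_ * X)%E]muleC.
  - apply: emeasurable_funM; last by apply/measurable_EFinP; exact: measurable_gauss.
    apply: measurableT_comp; first exact: (measurable_kernel K).
    by apply: measurable_rVD => //; exact: measurable_rVZ.
  - by move=> z _; rewrite mule_ge0 ?lee_fin ?gauss_ge0.
  - by rewrite lee_fin.
rewrite E1; under eq_near do rewrite E2.
exact: fatou_near.
Qed.

(** Adding the mass of [D] makes the integrand nonnegative, so that Tonelli's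
    theorem gives measurability. *)
Lemma measurable_weighted_chf :
  measurable_fun setT (weighted_chf : rV -> measurableTypeR R).
Proof.
pose G (xi : rV) := (\int[lam]_t (D t * (1 + cos (dot (Y t) xi)))%:E)%E.
have iD : lam.-integrable setT (fun t => (D t)%:E).
  apply/integrableP; split; first exact/measurable_EFinP.
  by under eq_integral do rewrite gee0_abs ?lee_fin//.
have mG : measurable_fun setT G.
  apply: (measurable_fun_fubini_tonelli_G (fun z : T * rV => (D z.1 * (1 + cos (dot (Y z.1) z.2)))%:E)).
    apply/measurable_EFinP; apply: measurable_funM.
      by apply: measurableT_comp => //; exact: measurable_fst.
    apply: measurable_funD => //; apply: measurable_cos_dot; last exact: measurable_snd.
    by apply: measurableT_comp => //; exact: measurable_fst.
  move=> z; rewrite lee_fin mulr_ge0//; have := cos_geN1 (dot (Y z.1) z.2); lra.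
have GE xi : G xi = (\int[lam]_t (D t)%:E + (weighted_chf xi)%:E)%E.
  rewrite -weighted_chfE -integralD//; last exact: integrable_weighted_cos.
  by apply: eq_integral => t _; rewrite -EFinD mulrDr mulr1.
rewrite (_ : weighted_chf = fun xi => fine (G xi) - fine (\int[lam]_t (D t)%:E)%E).
  by apply: measurable_funB => //; exact: measurableT_comp.
apply/funext => xi; rewrite GE fineD//; last exact: integrable_fin_num.
by rewrite /= addrAC subrr add0r.
Qed.

Lemma measurable_spec_chf (e : R) :
  measurable_fun setT (fun xi => (spec xi * (weighted_chf xi * gauss (e *: xi)))%:E).
Proof.
apply/measurable_EFinP; apply: measurable_funM; first exact: (measurable_spec K).
apply: measurable_funM; first exact: measurable_weighted_chf.
by apply: measurableT_comp; [exact: measurable_gauss|exact: measurable_rVZ].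
Qed.

Let gn0 : 0 < (gmass : R) ^+ n. Proof. by rewrite exprn_gt0 ?gmass_gt0. Qed.

(** Each regularised energy is a spectral integral damped by a Gaussian factor at
    most 1, and Fatou's lemma passes to the limit. *)
Lemma energy_le_spectral : (forall xi, 0 <= weighted_chf xi) ->
  ((gmass ^+ n)%:E * ((gmass ^+ n)%:E * \int[lam]_t ((D t)%:E * gamma (Y t))) <=
   \int[leb n]_xi (spec xi * weighted_chf xi)%:E)%E.
Proof.
move=> W0; set S := (\int[leb n]_xi _)%E.
rewrite -lee_pdivlMl//; rewrite leNgt; apply/negP => /smooth_kernel_fatou[k _] /(_ k (leqnn k)).
rewrite lte_pdivrMl// integral_smooth_kernelE ?invr_gt0//; apply/negP; rewrite -leNgt.
apply: ge0_le_integral => //.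
- by move=> xi _; rewrite lee_fin mulr_ge0 ?spec_ge0// mulr_ge0 ?gauss_ge0.
- exact: measurable_spec_chf.
- apply/measurable_EFinP; apply: measurable_funM; first exact: (measurable_spec K).
  exact: measurable_weighted_chf.
- by move=> xi _; rewrite lee_fin ler_wpM2l ?spec_ge0// ler_piMr ?gauss_le1.
Qed.

Lemma gauss_scale_cvg (xi : rV) : gauss ((k.+1%:R)^-1 *: xi) @[k --> \oo] --> (1 : R).
Proof.
rewrite (_ : (fun k => _) = fun k : nat => expR (- ((k.+1%:R)^-1 * ((k.+1%:R)^-1 * (dot xi xi / 2))))); last first.
  by apply/funext => k; rewrite /gauss dotZl dotZr !mulrA.
rewrite -[X in _ --> X](@expR0 R) -oppr0.
apply: (continuous_cvg _ (@continuous_expR R _)).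
apply: cvgN; rewrite -[X in _ --> X](mul0r (0 * (dot xi xi / 2))).
apply: cvgM; first exact: cvg_harmonic.
by apply: cvgM; [exact: cvg_harmonic|exact: cvg_cst].
Qed.

End spectral_energy.

Section spectral_le_energy.
Context {R : realType} {n : nat} (gamma ghat : 'rV[R]_n -> \bar R).
Hypothesis K : admissible_kernel gamma ghat.
Local Notation rV := 'rV[R]_n.
Local Notation spec := (spec ghat).
Local Notation smooth_kernel := (smooth_kernel gamma).
Context {d : measure_display} {T : measurableType d}.
Variable lam : {sigma_finite_measure set T -> \bar R}.
Variables (Y : T -> rV) (D E : T -> R).
Hypothesis mY : measurable_fun setT Y.
Hypothesis mD : measurable_fun setT (D : T -> measurableTypeR R).
Hypothesis mE : measurable_fun setT (E : T -> measurableTypeR R).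
Hypothesis D0 : forall t, 0 <= D t.
Hypothesis DE : forall t, D t <= E t.
Hypothesis Efin : (\int[lam]_t (E t)%:E < +oo)%E.
Hypothesis EYfin : (\int[lam]_t ((E t)%:E * gamma (Y t)) < +oo)%E.
Hypothesis Ele : forall e, 0 < e ->
  (\int[lam]_t ((E t)%:E * smooth_kernel e (Y t)) <=
   (gmass ^+ n)%:E * \int[lam]_t ((E t)%:E * gamma (Y t)))%E.
Hypothesis W0 : forall xi, 0 <= weighted_chf lam Y D xi.

Let g0 := kernel_ge0 K.
Let gn0 : 0 < (gmass : R) ^+ n. Proof. by rewrite exprn_gt0 ?gmass_gt0. Qed.

Let Dfin : (\int[lam]_t (D t)%:E < +oo)%E.
Proof.
apply: le_lt_trans Efin; apply: ge0_le_integral => //; try exact/measurable_EFinP.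
all: by move=> t _; rewrite lee_fin.
Qed.

(** The regularised energies of [D] could exceed its energy in the limit, the
    kernel being possibly singular at the origin. This does not happen when [D] is
    dominated by an [E] whose regularised energies do not exceed their expected
    limit: Fatou's lemma for [E - D] shows that any excess of [D] would be an
    excess of [E]. On the spectral side Fatou's lemma applies because the
    transform of [D] is nonnegative. *)
Lemma spectral_le_energy :
  (\int[leb n]_xi (spec xi * weighted_chf lam Y D xi)%:E <=
  (gmass ^+ n)%:E * ((gmass ^+ n)%:E * \int[lam]_t ((D t)%:E * gamma (Y t))))%E.
Proof.
have mgY : measurable_fun setT (fun t => gamma (Y t)).
  by apply: measurableT_comp => //; exact: (measurable_kernel K).
have mEF (h : T -> R) (g : T -> \bar R) : measurable_fun setT (h : T -> measurableTypeR R) ->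
    measurable_fun setT g -> measurable_fun setT (fun t => (h t)%:E * g t)%E.
  by move=> mh mg; apply: emeasurable_funM => //; exact/measurable_EFinP.
(* [C], of energy [a], is the complement of [D], of energy [b], in [E]. *)
pose C t := E t - D t.
have C0 t : 0 <= C t by rewrite subr_ge0.
have mC : measurable_fun setT (C : T -> measurableTypeR R) by exact: measurable_funB.
have Cfin : (\int[lam]_t (C t)%:E < +oo)%E.
  apply: le_lt_trans Efin; apply: ge0_le_integral => //; try exact/measurable_EFinP.
    by move=> t _; rewrite lee_fin.
  by move=> t _; rewrite lee_fin /C gerBl.
have split (g : T -> \bar R) : measurable_fun setT g -> (forall t, 0 <= g t)%E ->
    (\int[lam]_t ((E t)%:E * g t) = \int[lam]_t ((C t)%:E * g t) + \int[lam]_t ((D t)%:E * g t))%E.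
  move=> mg gg; rewrite -ge0_integralD//; first last.
  - exact: mEF.
  - by move=> t _; rewrite mule_ge0 ?lee_fin.
  - exact: mEF.
  - by move=> t _; rewrite mule_ge0 ?lee_fin.
  apply: eq_integral => t _; rewrite -ge0_muleDl ?lee_fin//.
  by rewrite -EFinD /C subrK.
set b := (\int[lam]_t ((D t)%:E * gamma (Y t)))%E.
have := split _ mgY (fun t => g0 _); rewrite -/b.
set a := (\int[lam]_t ((C t)%:E * gamma (Y t)))%E => Eab.
have a0 : (0 <= a)%E by apply: integral_ge0 => t _; rewrite mule_ge0 ?lee_fin.
have b0 : (0 <= b)%E by apply: integral_ge0 => t _; rewrite mule_ge0 ?lee_fin.
have afin : a \is a fin_num.
  by rewrite ge0_fin_numE//; apply: le_lt_trans EYfin; rewrite Eab leeDl.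
have bfin : b \is a fin_num.
  by rewrite ge0_fin_numE//; apply: le_lt_trans EYfin; rewrite Eab leeDr.
rewrite leNgt; apply/negP => bS.
have [c bc cS] : exists2 c : R, ((gmass ^+ n)%:E * ((gmass ^+ n)%:E * b) < c%:E)%E &
   (c%:E < \int[leb n]_xi (spec xi * weighted_chf lam Y D xi)%:E)%E.
  move: bS; rewrite -(fineK bfin) -!EFinM; case: (\int[leb n]_xi _)%E => [s||//].
    rewrite lte_fin => bs; exists ((gmass ^+ n * (gmass ^+ n * fine b) + s) / 2); rewrite lte_fin; lra.
  by move=> _; exists (gmass ^+ n * (gmass ^+ n * fine b) + 1); rewrite ?lte_fin ?ltry//; lra.
pose f k xi := (spec xi * (weighted_chf lam Y D xi * gauss ((k.+1%:R)^-1 *: xi)))%:E.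
have [N1 _ h1] : \forall k \near \oo, (c%:E < \int[leb n]_xi f k xi)%E.
  apply: (fatou_near _ _ _ cS).
  - by move=> k; exact: (measurable_spec_chf K).
  - by move=> k xi; rewrite lee_fin mulr_ge0 ?spec_ge0// mulr_ge0 ?gauss_ge0.
  - move=> xi; apply: cvg_EFin; first exact: nearW.
    rewrite -[X in _ --> spec _ * X]mulr1.
    apply: cvgM; first exact: cvg_cst.
    by apply: cvgM; [exact: cvg_cst|exact: gauss_scale_cvg].
(* This level and [c / gmass ^+ n] add up to [gmass ^+ n * (a + b)], the
   largest value allowed by [Ele]. *)
have [N2 _ h2] : \forall k \near \oo,
   (((gmass ^+ n) * fine a - (c / gmass ^+ n - gmass ^+ n * fine b))%:E <
    \int[lam]_t ((C t)%:E * smooth_kernel (k.+1%:R)^-1 (Y t)))%E.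
  apply: (smooth_kernel_fatou K) => //; rewrite -/a -(fineK afin) -EFinM lte_fin.
  move: bc; rewrite -(fineK bfin) -!EFinM lte_fin => bc.
  by rewrite gtrBl subr_gt0 ltr_pdivlMr// mulrC.
pose k := maxn N1 N2; have := h1 k (leq_maxl _ _); have := h2 k (leq_maxr _ _) => {h1 h2} h2.
have ek : 0 < (k.+1%:R : R)^-1 by rewrite invr_gt0.
rewrite -(integral_smooth_kernelE K)// -lte_pdivrMl// => h1.
have msk : measurable_fun setT (fun t => smooth_kernel (k.+1%:R)^-1 (Y t)) by exact: (measurable_smooth_kernel K).
have := Ele ek; rewrite (split _ msk); last by move=> t; exact: (smooth_kernel_ge0 K).
rewrite Eab -(fineK afin) -(fineK bfin) -EFinD -EFinM => h3.
have := lteD h2 h1; rewrite -EFinM -EFinD => /lt_le_trans /(_ h3).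
by rewrite lte_fin (_ : _ - _ + _ = gmass ^+ n * (fine a + fine b)) ?ltxx//; ring.
Qed.

End spectral_le_energy.

(** * Energy of an autocorrelation *)

Section product_density.
Context {R : realType} {n : nat}.
Local Notation rV := 'rV[R]_n.

Let lebX : {measure set (rV * rV) -> \bar R} := (leb n \x leb n)%E.

Let sigma_finite_lebX : sigma_finite setT lebX.
Proof.
have /sigma_finiteP[F [TF ndF Foo]] := sigma_finiteT (@leb R n).
exists (fun n => F n `*` F n).
  rewrite -setXTT TF predeqE => -[x y]; split.
    move=> [/= [k _ Fkx] [l _ Fly]]; exists (maxn k l) => //; split.
    - by move: x Fkx; exact/subsetPset/ndF/leq_maxl.
    - by move: y Fly; exact/subsetPset/ndF/leq_maxr.
  by move=> [k _ []/= ? ?]; split; exists k.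
move=> k; have [? ?] := Foo k.
split; first exact: measurableX.
by rewrite /lebX /= product_measure1E// lte_mul_pinfty// ge0_fin_numE.
Qed.

(** The product measure under a name of its own, for the same purpose as
    [leb]. *)
Definition leb2 : set (rV * rV)%type -> \bar R := lebX.
HB.instance Definition _ := Measure.copy leb2 lebX.
HB.instance Definition _ := Measure_isSigmaFinite.Build _ _ _ leb2 sigma_finite_lebX.

Lemma integral_leb2 (f : rV * rV -> \bar R) : measurable_fun setT f -> (forall z, 0 <= f z)%E ->
  (\int[leb2]_z f z = \int[leb n]_a \int[leb n]_b f (a, b))%E.
Proof. by move=> mf f0; exact: (fubini_tonelli1 f). Qed.

Lemma integral_leb2_sym (f : rV * rV -> \bar R) : measurable_fun setT f -> (forall z, 0 <= f z)%E ->
  (\int[leb2]_z f z = \int[leb n]_b \int[leb n]_a f (a, b))%E.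
Proof. by move=> mf f0; exact: (fubini_tonelli2 f). Qed.

Definition pair_diff (z : rV * rV) : rV := z.1 - z.2.

Lemma measurable_pair_diff : measurable_fun setT pair_diff.
Proof. by apply: measurable_rVB; [exact: measurable_fst|exact: measurable_snd]. Qed.

(** The dominating density [E] of [spectral_le_energy]. It is written in terms of
    the difference, so that energies against it reduce to integrals on R^n, and
    it is bounded below on bounded sets. *)
Definition ref_density (M : R) (z : rV * rV) : R := M * (gauss (pair_diff z) * gauss z.2).

Lemma measurable_ref_density M :
  measurable_fun setT (ref_density M : _ -> measurableTypeR R).
Proof.
apply: measurable_funM => //; apply: measurable_funM.
  by apply: measurableT_comp; [exact: measurable_gauss|exact: measurable_pair_diff].
by apply: measurableT_comp; [exact: measurable_gauss|exact: measurable_snd].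
Qed.

Lemma ref_density_ge0 M z : 0 <= M -> 0 <= ref_density M z.
Proof. by move=> M0; rewrite mulr_ge0// mulr_ge0 ?gauss_ge0. Qed.

(** Translation invariance in the first variable. *)
Lemma integral_ref_density M (G : rV -> \bar R) : 0 <= M -> measurable_fun setT G ->
  (forall x, 0 <= G x)%E ->
  (\int[leb2]_z ((ref_density M z)%:E * G (pair_diff z)) =
   M%:E * ((gmass ^+ n)%:E * \int[leb n]_y ((gauss y)%:E * G y)))%E.
Proof.
move=> M0 mG G0.
have mGg : measurable_fun setT (fun y => (gauss y)%:E * G y)%E.
  by apply: emeasurable_funM => //; apply/measurable_EFinP; exact: measurable_gauss.
have Gg0 y : (0 <= (gauss y)%:E * G y)%E by rewrite mule_ge0 ?lee_fin ?gauss_ge0.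
have S0 : (0 <= \int[leb n]_y ((gauss y)%:E * G y))%E by exact: integral_ge0.
rewrite integral_leb2_sym; last 2 first.
- apply: emeasurable_funM; first by apply/measurable_EFinP; exact: measurable_ref_density.
  by apply: measurableT_comp => //; exact: measurable_pair_diff.
- by move=> z; rewrite mule_ge0 ?lee_fin ?ref_density_ge0.
transitivity (\int[leb n]_b ((M%:E * \int[leb n]_y ((gauss y)%:E * G y)) * (gauss b)%:E))%E.
  apply: eq_integral => b _.
  have sh := @ge0_integral_affine R n 1 (- b) _ ltr01 mGg Gg0.
  rewrite expr1n mul1e in sh.
  have mGb : measurable_fun setT (fun y : rV => (gauss (- b + 1 *: y))%:E * G (- b + 1 *: y)%R)%E.
    have mb : measurable_fun setT (fun y : rV => - b + 1 *: y).
      by apply: measurable_rVD; [exact: measurable_cst|exact: measurable_rVZ].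
    exact: (measurableT_comp mGg mb).
  have k0 : (0 <= (M * gauss b)%:E)%E by rewrite lee_fin mulr_ge0 ?gauss_ge0.
  rewrite -[in RHS]sh muleAC -EFinM.
  rewrite -(ge0_integralZl (leb n) measurableT mGb (fun y _ => Gg0 _) k0).
  apply: eq_integral => a _; rewrite scale1r /ref_density /pair_diff /= addrC muleA -EFinM.
  by congr (_%:E * _)%E; ring.
rewrite ge0_integralZl//.
- by rewrite integral_gauss muleAC muleA.
- by apply/measurable_EFinP; exact: measurable_gauss.
- by move=> b _; rewrite lee_fin gauss_ge0.
- by rewrite mule_ge0 ?lee_fin.
Qed.

Section energy.
Variables (gamma ghat : rV -> \bar R).
Hypothesis K : admissible_kernel gamma ghat.
Local Notation spec := (spec ghat).

Let gn0 : 0 < (gmass : R) ^+ n. Proof. by rewrite exprn_gt0 ?gmass_gt0. Qed.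

Let mid : measurable_fun setT (id : rV -> rV). Proof. exact: measurable_id. Qed.

(** Regularising the kernel does not increase its Gaussian energy, apart from the
    factor [gmass ^+ n] of [smooth_kernel]: on the spectral side it only inserts a
    factor at most 1. *)
Lemma gauss_energy_le e : 0 < e ->
  (\int[leb n]_y ((gauss y)%:E * smooth_kernel gamma e y) <=
   (gmass ^+ n)%:E * \int[leb n]_y ((gauss y)%:E * gamma y))%E.
Proof.
move=> e0.
have gl : (\int[@leb R n]_t (gauss t)%:E < +oo)%E by rewrite integral_gauss ltry.
rewrite -(lee_pmul2l (x := (gmass ^+ n)%:E))// ?lte_fin//.
rewrite (integral_smooth_kernelE K mid (measurable_gauss (n := n)) (@gauss_ge0 R n) gl e0).
have -> : (\int[leb n]_y ((gauss y)%:E * gamma y) = smooth_kernel gamma 1 0)%E.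
  by apply: eq_integral => y _; rewrite muleC add0r scale1r.
have wE xi : weighted_chf (leb n) id (@gauss R n) xi = gmass ^+ n * gauss xi.
  rewrite /weighted_chf /Rintegral.
  under eq_integral do rewrite dotC mulrC.
  by rewrite integral_cos_gauss.
have mg1 (c : R) : measurable_fun setT (fun x : rV => gauss (c *: x) : measurableTypeR R).
  by apply: measurableT_comp; [exact: measurable_gauss|exact: measurable_rVZ].
have ms := measurable_spec K.
rewrite (smooth_kernelE K)//.
have -> : (\int[leb n]_xi (spec xi * (cos (dot 0 xi) * gauss (1 *: xi)))%:E =
  \int[leb n]_xi (spec xi * gauss (1 *: xi))%:E)%E.
  apply: eq_integral => xi _; rewrite /dot big1 ?cos0 ?mul1r// => i _.
  by rewrite mxE mul0r.
have msg : measurable_fun setT (fun xi => (spec xi * gauss (1 *: xi))%:E).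
  by apply/measurable_EFinP; exact: (measurable_funM ms (mg1 1)).
have sg0 xi : setT xi -> (0 <= (spec xi * gauss (1 *: xi))%:E)%E.
  by move=> _; rewrite lee_fin mulr_ge0 ?spec_ge0 ?gauss_ge0.
have k0 : (0 <= (gmass ^+ n : R)%:E)%E by rewrite lee_fin ltW.
rewrite -(ge0_integralZl (leb n) measurableT msg sg0 k0).
apply: ge0_le_integral => //.
- move=> xi _; rewrite lee_fin mulr_ge0 ?spec_ge0// wE mulr_ge0 ?gauss_ge0//.
  by rewrite mulr_ge0 ?gauss_ge0// ltW.
- exact: (measurable_spec_chf K mid (measurable_gauss (n := n)) (@gauss_ge0 R n) gl e).
- by apply: emeasurable_funM => //; apply/measurable_EFinP; exact: (measurable_funM ms (mg1 1)).
- move=> xi _; rewrite -EFinM lee_fin wE scale1r [leRHS]mulrCA ler_wpM2l ?spec_ge0//.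
  by rewrite ler_piMr ?gauss_le1// mulr_ge0 ?gauss_ge0// ltW.
Qed.

Section bounded.
Variables (h : rV -> R) (m r : R).
Hypothesis mh : measurable_fun setT (h : rV -> measurableTypeR R).
Hypothesis h0 : forall x, 0 <= h x.
Hypothesis hm : forall x, h x <= m.
Hypothesis hr : forall x, r < dot x x -> h x = 0.

Let D (z : rV * rV) : R := h z.1 * h z.2.

Let mD : measurable_fun setT (D : _ -> measurableTypeR R).
Proof.
apply: measurable_funM; apply: (measurableT_comp mh).
  exact: measurable_fst.
exact: measurable_snd.
Qed.

Let r' := Num.max r 0.
Let M := m ^+ 2 * expR (5 * r' / 2).

Let DE z : D z <= ref_density M z.
Proof.
have m0 : 0 <= m by exact: (le_trans (h0 0)).
have r0 : 0 <= r' by rewrite le_max lexx orbT.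
have rr x : r' < dot x x -> h x = 0.
  by move=> hx; apply: hr; apply: le_lt_trans hx; rewrite le_max lexx.
have E0 : 0 <= ref_density M z by rewrite ref_density_ge0// mulr_ge0 ?expR_ge0// sqr_ge0.
case: z E0 => a b E0; rewrite /D /=.
have [ra|ar] := ltP r' (dot a a); first by rewrite (rr _ ra) mul0r.
have [rb|br] := ltP r' (dot b b); first by rewrite (rr _ rb) mulr0.
apply: (@le_trans _ _ (m ^+ 2)); first by rewrite expr2 ler_pM.
rewrite /ref_density /M /gauss /= -mulrA ler_peMr ?sqr_ge0// -!expRD.
rewrite -[leLHS]expR0 ler_expR.
have : 0 <= dot (a + b) (a + b) by exact: dot_ge0.
(* Hence [|a - b|^2 + |b|^2 <= 5 r'], which explains the constant [M]. *)
have : dot (a - b) (a - b) + dot (a + b) (a + b) = 2 * dot a a + 2 * dot b b.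
  rewrite dotBl dotDl (dotC a (a - b)) (dotC b (a - b)) (dotC a (a + b)) (dotC b (a + b)).
  by rewrite !dotBl !dotDl (dotC b a); ring.
rewrite /pair_diff /=; lra.
Qed.

Let hfin : (\int[leb n]_x (h x)%:E < +oo)%E.
Proof.
have m0 : 0 <= m by exact: (le_trans (h0 0)).
apply: (@le_lt_trans _ _ (\int[leb n]_x ((m * expR (r / 2))%:E * (gauss x)%:E))%E); last first.
  rewrite ge0_integralZl//.
  - by rewrite integral_gauss -EFinM ltry.
  - by apply/measurable_EFinP; exact: measurable_gauss.
  - by move=> x _; rewrite lee_fin gauss_ge0.
  - by rewrite lee_fin mulr_ge0 ?expR_ge0.
apply: ge0_le_integral => //.
- by move=> x _; rewrite lee_fin.
- exact/measurable_EFinP.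
- by apply: emeasurable_funM => //; apply/measurable_EFinP; exact: measurable_gauss.
- move=> x _; rewrite -EFinM lee_fin.
  have [rx|xr] := ltP r (dot x x).
    by rewrite hr// mulr_ge0 ?gauss_ge0// mulr_ge0 ?expR_ge0.
  apply: (le_trans (hm x)); rewrite -mulrA ler_peMr// /gauss -expRD.
  by rewrite -[leLHS]expR0 ler_expR; lra.
Qed.

Let ih : (leb n).-integrable setT (fun x => (h x)%:E).
Proof.
apply/integrableP; split; first exact/measurable_EFinP.
by under eq_integral do rewrite gee0_abs ?lee_fin//.
Qed.

Let ihb (k : rV -> R) : measurable_fun setT (k : rV -> measurableTypeR R) ->
  (forall x, `|k x| <= 1) -> (leb n).-integrable setT (fun x => (h x * k x)%:E).
Proof.
move=> mk k1; apply: (le_integrable _ _ _ ih) => //.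
  by apply/measurable_EFinP; exact: measurable_funM.
by move=> x _; rewrite /= lee_fin normrM ler_piMr.
Qed.

Let mcos xi : measurable_fun setT (fun x : rV => cos (dot x xi) : measurableTypeR R).
Proof. by apply: measurable_cos_dot => //; exact: measurable_cst. Qed.

Let msin xi : measurable_fun setT (fun x : rV => sin (dot x xi) : measurableTypeR R).
Proof.
apply: (measurableT_comp (f := sin : R -> measurableTypeR R)).
  by apply: continuous_measurable_fun; exact: continuous_sin.
by apply: measurable_dot => //; exact: measurable_cst.
Qed.

Definition cosT (f : rV -> R) (xi : rV) : R := \int[leb n]_x (f x * cos (dot x xi)).
Definition sinT (f : rV -> R) (xi : rV) : R := \int[leb n]_x (f x * sin (dot x xi)).

Let cosTE xi : (\int[leb n]_x (h x * cos (dot x xi))%:E = (cosT h xi)%:E)%E.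
Proof.
rewrite /cosT /Rintegral fineK//; apply: integrable_fin_num => //.
by apply: ihb => // x; exact: normr_cos_le1.
Qed.

Let sinTE xi : (\int[leb n]_x (h x * sin (dot x xi))%:E = (sinT h xi)%:E)%E.
Proof.
rewrite /sinT /Rintegral fineK//; apply: integrable_fin_num => //.
by apply: ihb => // x; exact: normr_sin_le1.
Qed.

Let Dfin : (\int[leb2]_z (D z)%:E < +oo)%E.
Proof.
rewrite integral_leb2//; last 2 first.
- exact/measurable_EFinP.
- by move=> z; rewrite lee_fin mulr_ge0.
have S0 : (0 <= \int[leb n]_x (h x)%:E)%E by apply: integral_ge0 => x _; rewrite lee_fin.
have Sf : (\int[leb n]_x (h x)%:E)%E \is a fin_num by rewrite ge0_fin_numE.
under eq_integral => a _.
  rewrite /D /=; under eq_integral do rewrite EFinM.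
  rewrite ge0_integralZl// ?lee_fin//; last 2 first.
  - exact/measurable_EFinP.
  - by move=> x _; rewrite lee_fin.
  over.
rewrite ge0_integralZr//.
- by rewrite lte_mul_pinfty.
- exact/measurable_EFinP.
- by move=> x _; rewrite lee_fin.
Qed.

(** The transform of an autocorrelation is a squared modulus. This is why the
    density of the difference of two independent copies is truncated factor by
    factor: its transform stays nonnegative. *)
Lemma chf_autocorrelation xi :
  weighted_chf leb2 pair_diff D xi = cosT h xi ^+ 2 + sinT h xi ^+ 2.
Proof.
have D0 z : 0 <= D z by rewrite mulr_ge0.
have iD := @integrable_weighted_cos R n _ _ leb2 pair_diff D measurable_pair_diff mD D0 Dfin xi.
apply: EFin_inj; rewrite -weighted_chfE//; last exact: measurable_pair_diff.
rewrite -[LHS]/(\int[leb n \x leb n]_z (D z * cos (dot (pair_diff z) xi))%:E)%E.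
rewrite -integral12_prod_meas1//.
transitivity (\int[leb n]_a ((cosT h xi)%:E * (h a * cos (dot a xi))%:E +
    (sinT h xi)%:E * (h a * sin (dot a xi))%:E))%E.
  apply: eq_integral => a _.
  transitivity (\int[leb n]_b ((h a * cos (dot a xi))%:E * (h b * cos (dot b xi))%:E +
    (h a * sin (dot a xi))%:E * (h b * sin (dot b xi))%:E))%E.
    apply: eq_integral => b _; rewrite /D /pair_diff /= dotBl cosB -!EFinM -EFinD.
    by congr (_%:E); ring.
  rewrite integralD//; last 2 first.
  - by apply: integrableZl => //; apply: ihb => // x; exact: normr_cos_le1.
  - by apply: integrableZl => //; apply: ihb => // x; exact: normr_sin_le1.
  rewrite !integralZl//; last 2 first.
  - by apply: ihb => // x; exact: normr_sin_le1.
  - by apply: ihb => // x; exact: normr_cos_le1.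
  by rewrite cosTE sinTE; congr (_ + _)%E; exact: muleC.
rewrite integralD//; last 2 first.
- by apply: integrableZl => //; apply: ihb => // x; exact: normr_cos_le1.
- by apply: integrableZl => //; apply: ihb => // x; exact: normr_sin_le1.
rewrite !integralZl//; last 2 first.
- by apply: ihb => // x; exact: normr_sin_le1.
- by apply: ihb => // x; exact: normr_cos_le1.
by rewrite cosTE sinTE -!EFinM -EFinD !expr2.
Qed.

(** [spectral_le_energy] for [h a * h b], dominated by a multiple of
    [ref_density] because [h] is bounded with bounded support. *)
Lemma bounded_spectral_le_energy :
  (\int[leb n]_xi (spec xi * cosT h xi ^+ 2)%:E <=
  (gmass ^+ n)%:E * ((gmass ^+ n)%:E * \int[leb2]_z ((D z)%:E * gamma (pair_diff z))))%E.
Proof.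
have D0 z : 0 <= D z by rewrite mulr_ge0.
have M0 : 0 <= M by rewrite mulr_ge0 ?expR_ge0// sqr_ge0.
have g0 := kernel_ge0 K; have mg := measurable_kernel K.
have mchf := @measurable_weighted_chf R n _ _ leb2 pair_diff D measurable_pair_diff mD D0 Dfin.
have mE := measurable_ref_density M.
have gE : (\int[leb n]_y ((gauss y)%:E * gamma y) = smooth_kernel gamma 1 0)%E.
  by apply: eq_integral => y _; rewrite muleC add0r scale1r.
have gf := smooth_kernel_fin_num K 0 (@ltr01 R).
have sk0 := smooth_kernel_ge0 K 1 0.
apply: (@le_trans _ _ (\int[leb n]_xi (spec xi * weighted_chf leb2 pair_diff D xi)%:E)%E).
  apply: ge0_le_integral => //.
  - by move=> xi _; rewrite lee_fin mulr_ge0 ?spec_ge0// sqr_ge0.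
  - apply/measurable_EFinP; apply: measurable_funM; first exact: (measurable_spec K).
    apply: measurable_funX.
    exact: (@measurable_weighted_chf R n _ _ (leb n) id h mid mh h0 hfin).
  - apply/measurable_EFinP; apply: measurable_funM => //; exact: (measurable_spec K).
  - move=> xi _; rewrite lee_fin ler_wpM2l ?spec_ge0// chf_autocorrelation.
    by rewrite lerDl sqr_ge0.
apply: (spectral_le_energy K (E := ref_density M)) => //.
- exact: measurable_pair_diff.
- have -> : (\int[leb2]_z (ref_density M z)%:E = \int[leb2]_z ((ref_density M z)%:E * cst 1 (pair_diff z)))%E.
    by apply: eq_integral => z _; rewrite mule1.
  rewrite (integral_ref_density (G := cst 1%E))//.
  under eq_integral do rewrite mule1.
  by rewrite integral_gauss -!EFinM ltry.
- by rewrite integral_ref_density// gE -(fineK gf) -!EFinM ltry.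
- move=> e e0; rewrite !integral_ref_density//; last 2 first.
  + exact: (measurable_smooth_kernel K mid).
  + by move=> x; exact: (smooth_kernel_ge0 K).
  rewrite [leRHS]muleCA lee_wpmul2l ?lee_fin//.
  apply: lee_wpmul2l; first by rewrite lee_fin ltW.
  exact: gauss_energy_le.
- by move=> xi; rewrite chf_autocorrelation addr_ge0 ?sqr_ge0.
Qed.

End bounded.

Section density.
Variable q : rV -> R.
Hypothesis mq : measurable_fun setT (q : rV -> measurableTypeR R).
Hypothesis q0 : forall x, 0 <= q x.
Hypothesis qfin : (\int[leb n]_x (q x)%:E < +oo)%E.

Let trunc (k : nat) (x : rV) : R :=
  Num.min (q x) k%:R * \1_[set x : rV | dot x x <= k%:R] x.

Let measurable_trunc k : measurable_fun setT (trunc k : rV -> measurableTypeR R).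
Proof.
apply: measurable_funM; first exact: measurable_minr.
apply: measurable_indic.
rewrite [X in measurable X](_ : _ = setT `&` (fun x : rV => dot x x : measurableTypeR R) @^-1` `]-oo, k%:R]%classic); last first.
  by apply/seteqP; split => x /=; rewrite in_itv /=; [split|case].
by apply: measurable_dot => //; exact: measurable_itv.
Qed.

Let trunc_ge0 k x : 0 <= trunc k x.
Proof. by rewrite mulr_ge0// le_min q0 ler0n. Qed.

Let trunc_le k x : trunc k x <= q x.
Proof.
rewrite /trunc indicE; case: (_ \in _); rewrite ?mulr1 ?mulr0//.
by rewrite ge_min lexx.
Qed.

Let trunc_near x : \forall k \near \oo, trunc k x = q x.
Proof.
exists (maxn (Num.bound (q x)) (Num.bound (dot x x))) => // k /=.
rewrite geq_max => /andP[h1 h2]; rewrite /trunc indicE mem_set /= ?mulr1; last first.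
  apply: le_trans (ltW (archi_boundP (dot_ge0 x))) _; by rewrite ler_nat.
apply/min_idPl; apply: le_trans (ltW (archi_boundP (q0 x))) _; by rewrite ler_nat.
Qed.

(** Truncate [q] both in height and in space. On the right the truncations stay
    below [q]; on the left their transforms converge, and Fatou's lemma applies. *)
Lemma density_spectral_le_energy :
  (\int[leb n]_xi (spec xi * cosT q xi ^+ 2)%:E <=
  (gmass ^+ n)%:E * ((gmass ^+ n)%:E *
    \int[leb2]_z ((q z.1 * q z.2)%:E * gamma (pair_diff z))))%E.
Proof.
have g0 := kernel_ge0 K; have mg := measurable_kernel K.
have iq : (leb n).-integrable setT (fun x => (q x)%:E).
  apply/integrableP; split; first exact/measurable_EFinP.
  by under eq_integral do rewrite gee0_abs ?lee_fin//.
have tfin k : (\int[leb n]_x (trunc k x)%:E < +oo)%E.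
  apply: le_lt_trans qfin; apply: ge0_le_integral => //.
  - by move=> x _; rewrite lee_fin.
  - by apply/measurable_EFinP; exact: measurable_trunc.
  - exact/measurable_EFinP.
  - by move=> x _; rewrite lee_fin.
have mcos xi : measurable_fun setT (fun x : rV => cos (dot x xi) : measurableTypeR R).
  by apply: measurable_cos_dot => //; exact: measurable_cst.
have mpr (f : rV -> R) : measurable_fun setT (f : rV -> measurableTypeR R) ->
    measurable_fun setT (fun z : rV * rV => f z.1 * f z.2 : measurableTypeR R).
  move=> mf; apply: measurable_funM; apply: (measurableT_comp mf).
    exact: measurable_fst.
  exact: measurable_snd.
have mgd : measurable_fun setT (fun z => gamma (pair_diff z)).
  by apply: measurableT_comp => //; exact: measurable_pair_diff.
apply: (fatou_le (f := fun k xi => (spec xi * cosT (trunc k) xi ^+ 2)%:E)).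
- move=> k; apply/measurable_EFinP; apply: measurable_funM; first exact: (measurable_spec K).
  apply: measurable_funX.
  exact: (@measurable_weighted_chf R n _ _ (leb n) id (trunc k) mid (measurable_trunc k) (trunc_ge0 k) (tfin k)).
- by move=> k xi; rewrite lee_fin mulr_ge0 ?spec_ge0// sqr_ge0.
- move=> xi; apply: cvg_EFin; first exact: nearW.
  apply: cvgM; first exact: cvg_cst.
  suff h : cosT (trunc k) xi @[k --> \oo] --> cosT q xi by rewrite expr2; apply: cvgM.
  apply: fine_cvg; rewrite fineK; last first.
    apply: integrable_fin_num => //.
    exact: (@integrable_weighted_cos R n _ _ (leb n) id q mid mq q0 qfin xi).
  have [] := @dominated_convergence _ _ R (leb n) setT measurableT
    (fun k x => (trunc k x * cos (dot x xi))%:E) (fun x => (q x * cos (dot x xi))%:E)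
    (fun x => (q x)%:E) _ _ _ iq _ => //.
  + move=> k; apply/measurable_EFinP.
    exact: (measurable_funM (measurable_trunc k) (mcos xi)).
  + apply/measurable_EFinP; exact: (measurable_funM mq (mcos xi)).
  + apply: aeW => x _; apply: cvg_EFin; first exact: nearW.
    apply: cvgM; last exact: cvg_cst.
    by apply: cvg_near_cst; exact: trunc_near.
  + apply: aeW => x k _; rewrite lee_fin normrM (ger0_norm (trunc_ge0 k x)).
    apply: le_trans (trunc_le k x); rewrite ler_piMr//; exact: normr_cos_le1.
- move=> k.
  apply: (le_trans (@bounded_spectral_le_energy (trunc k) k%:R k%:R _ _ _ _)) => //.
  + move=> x; rewrite /trunc indicE; case: (_ \in _); rewrite ?mulr1 ?mulr0//.
    by rewrite ge_min lexx orbT.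
  + move=> x kx; rewrite /trunc indicE memNset ?mulr0//= => /(lt_le_trans kx).
    by rewrite ltxx.
  do 2 (apply: lee_wpmul2l; first by rewrite lee_fin ltW).
  apply: ge0_le_integral => //.
  + by move=> z _; apply: mule_ge0 => //; rewrite lee_fin mulr_ge0.
  + by apply: emeasurable_funM => //; apply/measurable_EFinP; apply: mpr.
  + by apply: emeasurable_funM => //; apply/measurable_EFinP; exact: mpr.
  + by move=> z _; apply: lee_wpmul2r => //; rewrite lee_fin ler_pM.
Qed.

End density.

End energy.
End product_density.

(** * Integrals against laws *)

Section laws.
Context {R : realType} {d : measure_display} {Omega : measurableType d}.

Import HBNNSimple.

(** By simple functions and monotone convergence. *)
Lemma ge0_integral_density {d'} {T : measurableType d'} (mu nu : {measure set T -> \bar R})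
    (q : T -> R) : measurable_fun setT (q : T -> measurableTypeR R) -> (forall x, 0 <= q x) ->
  (forall B, measurable B -> nu B = \int[mu]_(x in B) (q x)%:E)%E ->
  forall f, measurable_fun setT f -> (forall x, 0 <= f x)%E ->
  (\int[nu]_x f x = \int[mu]_x ((q x)%:E * f x))%E.
Proof.
move=> mq q0 nuE f mf f0.
have mqE : measurable_fun setT (fun x => (q x)%:E) by exact/measurable_EFinP.
pose f_ := nnsfun_approx measurableT mf.
have f_ge0 k x : 0 <= f_ k x by [].
have mf_ k : measurable_fun setT (fun x => (f_ k x)%:E) by exact/measurable_EFinP.
have mI k r : measurable (f_ k @^-1` [set r]).
  by rewrite -[X in measurable X]setTI; exact: measurable_funP.
have nd x : {homo (fun k => f_ k x) : a b / (a <= b)%N >-> a <= b}.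
  by move=> a b ab; exact/lefP/nd_nnsfun_approx.
have fE k : (\int[nu]_x (f_ k x)%:E = \int[mu]_x ((q x)%:E * (f_ k x)%:E))%E.
  transitivity (\sum_(r \in range (f_ k)) (r%:E * nu (f_ k @^-1` [set r])))%E.
    under eq_integral do rewrite fimfunE -fsumEFin//.
    rewrite ge0_integral_fsum//; last 2 first.
    - by move=> r; exact/measurable_EFinP/measurable_funM.
    - by move=> r x _; rewrite nnfun_muleindic_ge0.
    by apply: eq_fsbigr => r _; rewrite integralZl_indic_nnsfun// integral_indic// setIT.
  transitivity (\int[mu]_x (\sum_(r \in range (f_ k)) ((q x)%:E * (r * \1_(f_ k @^-1` [set r]) x)%:E)))%E; last first.
    apply: eq_integral => x _; rewrite [in RHS]fimfunE -fsumEFin// ge0_mule_fsumr//.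
    by move=> r; exact: nnfun_muleindic_ge0.
  rewrite ge0_integral_fsum//; last 2 first.
  - move=> r; apply: emeasurable_funM => //; exact/measurable_EFinP/measurable_funM.
  - by move=> r x _; apply: mule_ge0; [rewrite lee_fin|exact: nnfun_muleindic_ge0].
  apply: eq_fsbigr => r; rewrite inE => -[x0 _ rE].
  have r0 : 0 <= r by rewrite -rE.
  rewrite nuE// -ge0_integralZl//; last by move=> x _; rewrite lee_fin.
  - rewrite integral_mkcond; apply: eq_integral => x _; rewrite epatch_indic /= !EFinM.
    by rewrite muleCA muleA muleAC.
  - exact: measurable_funTS.
transitivity (limn (fun k => \int[nu]_x (f_ k x)%:E))%E.
  rewrite -monotone_convergence//=.
  - apply: eq_integral => x _; apply/esym/cvg_lim => //.
    by apply: cvg_nnsfun_approx.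
  - by move=> k x _; rewrite lee_fin.
  - by move=> x _ a b ab; rewrite lee_fin nd.
transitivity (limn (fun k => \int[mu]_x ((q x)%:E * (f_ k x)%:E)))%E.
  by congr (limn _); apply/funext.
rewrite -monotone_convergence//=.
- apply: eq_integral => x _; apply/cvg_lim => //; apply: cvgeZl => //.
  by apply: cvg_nnsfun_approx.
- by move=> k; exact: emeasurable_funM.
- by move=> k x _; rewrite mule_ge0 ?lee_fin.
- by move=> x _ a b ab; apply: lee_wpmul2l; rewrite lee_fin ?nd.
Qed.

Variable P : probability Omega R.

Lemma eq_law_integral {d'} {T : measurableType d'} (Y Z : Omega -> T) (f : T -> \bar R) :
  measurable_fun setT Y -> measurable_fun setT Z ->
  (forall B, measurable B -> P (Y @^-1` B) = P (Z @^-1` B)) ->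
  measurable_fun setT f -> (forall x, 0 <= f x)%E ->
  (\int[P]_w f (Y w) = \int[P]_w f (Z w))%E.
Proof.
move=> mY mZ YZ mf f0.
transitivity (\int[pushforward P Y]_x f x)%E; first by rewrite ge0_integral_pushforward.
transitivity (\int[pushforward P Z]_x f x)%E; last by rewrite ge0_integral_pushforward.
by apply: eq_measure_integral => A mA _; exact: YZ.
Qed.

(** The joint law is the product of the laws. *)
Lemma indep_integral {d'} {T : measurableType d'} (Y Z : Omega -> T) (f : T * T -> \bar R) :
  measurable_fun setT Y -> measurable_fun setT Z ->
  (forall A B, measurable A -> measurable B ->
     P (Y @^-1` A `&` Z @^-1` B) = P (Y @^-1` A) * P (Z @^-1` B))%E ->
  measurable_fun setT f -> (forall x, 0 <= f x)%E ->
  (\int[P]_w f (Y w, Z w) = \int[P]_w \int[P]_w' f (Y w, Z w'))%E.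
Proof.
move=> mY mZ YZ mf f0.
pose Y' : {mfun Omega >-> T} := HB.pack Y (isMeasurableFun.Build _ _ _ _ _ mY).
pose Z' : {mfun Omega >-> T} := HB.pack Z (isMeasurableFun.Build _ _ _ _ _ mZ).
have mYZ : measurable_fun setT (fun w => (Y w, Z w)) by exact: measurable_fun_pair.
pose m' := measure_function_pushforward__canonical__measure_function_Measure P mYZ.
transitivity (\int[m']_x f x)%E; first by rewrite ge0_integral_pushforward.
transitivity (\int[distribution P Y' \x distribution P Z']_x f x)%E.
  apply: eq_measure_integral => A mA _; apply/esym.
  apply: (@product_measure_unique _ _ _ _ _ (distribution P Y') (distribution P Z') m') => //.
rewrite (fubini_tonelli1 (m1 := distribution P Y') (m2 := distribution P Z') f mf f0).
rewrite (ge0_integral_distribution Y'); last 2 first.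
- by apply: measurable_fun_fubini_tonelli_F.
- by move=> y; exact: integral_ge0.
apply: eq_integral => w _ /=; rewrite /fubini_F ge0_integral_distribution//.
by apply: measurableT_comp => //; exact: measurable_pair1.
Qed.

End laws.

(** * The energy identity for the process *)

Section levy_energy.
Context {R : realType} {n : nat} {d : measure_display} {Omega : measurableType d}.
Variables (P : probability Omega R) (X : R -> Omega -> 'rV[R]_n) (Psi : 'rV[R]_n -> R).
Variables (gamma ghat : 'rV[R]_n -> \bar R).
Hypothesis L : levy_process P X.
Hypothesis X_sym : symmetric_process P X.
Hypothesis X_exp : characteristic_exponent P X Psi.
Hypothesis X_dens : has_transition_densities P X.
Hypothesis K : admissible_kernel gamma ghat.
Local Notation rV := 'rV[R]_n.
Local Notation spec := (spec ghat).

Let mX t : 0 <= t -> measurable_fun setT (X t).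
Proof. exact: (levy_meas L). Qed.

Let g0 := kernel_ge0 K.
Let mg := measurable_kernel K.

Let one_fin : (\int[P]_w (1 : R)%:E < +oo)%E.
Proof. by rewrite integral_cst// [X in (_ * X)%E](@probability_setT _ _ _ P) mul1e ltry. Qed.

Lemma chf_levy t xi : 0 <= t -> weighted_chf P (X t) (fun=> 1) xi = expR (- (t * Psi xi)).
Proof.
move=> t0; have := X_exp xi t0 => /(congr1 (@complex.Re _)) /= <-.
by apply: eq_Rintegral => w _; rewrite mul1r dotC.
Qed.

Lemma exponent_ge0 xi : 0 <= Psi xi.
Proof.
have := @chf_levy 1 xi ler01; rewrite mul1r => E.
suff : expR (- Psi xi) <= expR 0 by rewrite ler_expR oppr_le0.
rewrite expR0 -E -lee_fin -weighted_chfE//; last exact: mX.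
have -> : 1%:E = (\int[P]_w (1 : R)%:E)%E by rewrite integral_cst// [X in (_ * X)%E](@probability_setT _ _ _ P) mul1e.
apply: le_integral => //.
- by apply: integrable_weighted_cos => //; exact: mX.
- exact: finite_measure_integrable_cst.
- by move=> w _; rewrite mul1r lee_fin cos_le1.
Qed.

(** The exponent is minus the logarithm of the characteristic function at time 1. *)
Lemma measurable_exponent : measurable_fun setT (Psi : rV -> measurableTypeR R).
Proof.
rewrite (_ : Psi = fun xi => - ln (weighted_chf P (X 1) (fun=> 1) xi)).
  apply: measurableT_comp => //; apply: measurableT_comp => //.
  by apply: measurable_weighted_chf => //; exact: mX.
by apply/funext => xi; rewrite chf_levy// expRK mul1r opprK.
Qed.

(** [energy_le_spectral] for the law of [X u]. *)
Lemma levy_energy_le u : 0 <= u ->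
  ((gmass ^+ n)%:E * ((gmass ^+ n)%:E * \int[P]_w gamma (X u w)) <=
   \int[leb n]_xi (spec xi * expR (- (u * Psi xi)))%:E)%E.
Proof.
move=> u0.
have -> : (\int[P]_w gamma (X u w) = \int[P]_w ((1 : R)%:E * gamma (X u w)))%E.
  by apply: eq_integral => w _; rewrite mul1e.
have -> : (\int[leb n]_xi (spec xi * expR (- (u * Psi xi)))%:E =
    \int[leb n]_xi (spec xi * weighted_chf P (X u) (fun=> 1) xi)%:E)%E.
  by apply: eq_integral => xi _; rewrite chf_levy.
apply: (energy_le_spectral K) => //; first exact: mX.
by move=> xi; rewrite chf_levy ?expR_ge0.
Qed.

Let ae_law (Y Z : Omega -> rV) : measurable_fun setT Y -> measurable_fun setT Z ->
  {ae P, forall w, Y w = Z w} -> forall B, measurable B -> P (Y @^-1` B) = P (Z @^-1` B).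
Proof.
move=> mY mZ YZ B mB.
have mYB : measurable (Y @^-1` B) by rewrite -[X in measurable X]setTI; exact: mY.
have mZB : measurable (Z @^-1` B) by rewrite -[X in measurable X]setTI; exact: mZ.
have E C : measurable C -> (\int[P]_w (\1_C w)%:E = P C)%E.
  by move=> mC; rewrite integral_indic// setIT.
rewrite -E// -(E (Z @^-1` B))//; apply: ae_eq_integral => //.
- by apply/measurable_EFinP; exact: measurable_indic.
- by apply/measurable_EFinP; exact: measurable_indic.
- apply: filterS YZ => w YZw _; congr (_%:E); rewrite !indicE.
  by congr (nat_of_bool _)%:R; apply/idP/idP; rewrite !inE /= YZw.
Qed.

Let ae_X0 : {ae P, forall w, X 0 w = 0} := levy_0 L.

Lemma law_increment s t B : 0 <= s -> 0 <= t -> measurable B ->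
  P ((fun w => X (s + t) w - X s w) @^-1` B) = P (X t @^-1` B).
Proof.
move=> s0 t0 mB; rewrite (levy_stat L)//; apply: ae_law => //.
- by apply: measurable_rVB; exact: mX.
- exact: mX.
- by apply: filterS ae_X0 => w ->; rewrite subr0.
Qed.

Lemma integral_increment (f : rV -> \bar R) s t : 0 <= s -> 0 <= t ->
  measurable_fun setT f -> (forall x, 0 <= f x)%E ->
  (\int[P]_w f (X (s + t) w - X s w)%R = \int[P]_w f (X t w))%E.
Proof.
move=> s0 t0 mf f0.
apply: (eq_law_integral (Y := fun w => X (s + t) w - X s w)) => //.
- by apply: measurable_rVB; apply: mX => //; exact: addr_ge0.
- exact: mX.
- by move=> B mB; exact: law_increment.
Qed.

Lemma indep_increments t (A B : set rV) : 0 <= t -> measurable A -> measurable B ->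
  (P ((fun w => X (t + t) w - X t w)%R @^-1` A `&` (fun w => X t w - X 0 w)%R @^-1` B) =
   P ((fun w => X (t + t) w - X t w)%R @^-1` A) * P ((fun w => X t w - X 0 w)%R @^-1` B))%E.
Proof.
move=> t0 mA mB.
have h0 : 0 <= (fun i : nat => i%:R * t) 0%N by rewrite mul0r.
have hm : {homo (fun i : nat => i%:R * t) : i j / (i <= j)%N >-> i <= j}.
  by move=> i j ij; rewrite ler_wpM2r// ler_nat.
have := @levy_indep _ _ _ _ _ _ L 2 _ h0 hm (fun i : 'I_2 => if i == ord0 then B else A).
rewrite big_ord_recl big_ord1 /= mul0r !mul1r (_ : 2 * t = t + t); last by lra.
move=> h; rewrite muleC -h; last by move=> i; case: ifP.
congr (P _); apply/seteqP; split => w /=.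
  move=> [wA wB] i _ /=; have [->|i0] := eqVneq i ord0 => /=.
    by rewrite mul0r mul1r.
  have -> : (i : nat) = 1%N by case: i i0 => -[|[|]].
  by rewrite mul1r (_ : 2 * t = t + t)//; lra.
move=> H; split.
  by have := H (lift ord0 ord0) I => /=; rewrite mul1r (_ : 2 * t = t + t)//; lra.
by have := H ord0 I => /=; rewrite mul0r mul1r.
Qed.

(** [X (t + t)] is a sum of two independent increments with the law of [X t];
    symmetry turns the sum into a difference, as autocorrelations require. *)
Lemma integral_double_time (f : rV -> \bar R) t : 0 <= t ->
  measurable_fun setT f -> (forall x, 0 <= f x)%E ->
  (\int[P]_w f (X (t + t) w) = \int[P]_w \int[P]_w' f (X t w - X t w')%R)%E.
Proof.
move=> t0 mf f0.
have tt0 : 0 <= t + t by rewrite addr_ge0.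
have mD : measurable_fun setT (fun w => X (t + t) w - X t w) by apply: measurable_rVB; exact: mX.
have mD0 : measurable_fun setT (fun w => X t w - X 0 w) by apply: measurable_rVB; exact: mX.
have madd : measurable_fun setT (fun z : rV * rV => f (z.1 + z.2)).
  by apply: measurableT_comp => //; apply: measurable_rVD; [exact: measurable_fst|exact: measurable_snd].
transitivity (\int[P]_w f ((X (t + t) w - X t w) + (X t w - X 0 w))%R)%E.
  apply: ge0_ae_eq_integral => //.
  - by apply: measurableT_comp => //; exact: mX.
  - by apply: measurableT_comp => //; exact: measurable_rVD.
  - by apply: filterS ae_X0 => w -> _; rewrite subr0 subrK.
transitivity (\int[P]_w \int[P]_w' f ((X (t + t) w - X t w) + (X t w' - X 0 w'))%R)%E.
  apply: (indep_integral (f := fun z : rV * rV => f (z.1 + z.2)) mD mD0) => //.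
  by move=> A B mA mB; exact: indep_increments.
pose G (a : rV) := (\int[P]_w' f (a - X t w')%R)%E.
have mG : measurable_fun setT G.
  apply: (measurable_fun_fubini_tonelli_F (fun z : rV * Omega => f (z.1 - X t z.2))) => //.
  apply: measurableT_comp => //; apply: measurable_rVB; first exact: measurable_fst.
  by apply: (measurableT_comp (mX t0)); exact: measurable_snd.
transitivity (\int[P]_w G (X (t + t) w - X t w)%R)%E; last first.
  by apply: integral_increment => // a; exact: integral_ge0.
apply: eq_integral => w _; rewrite /G.
set a := (X (t + t) w - X t w).
have mfa : measurable_fun setT (fun x : rV => f (a + x)).
  by apply: measurableT_comp => //; exact: measurable_rVD.
transitivity (\int[P]_w' f (a + X t w')%R)%E.
  transitivity (\int[P]_w' f (a + (X (0 + t) w' - X 0 w'))%R)%E.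
    by apply: eq_integral => w' _; rewrite add0r.
  exact: (@integral_increment (fun x => f (a + x)) 0 t).
apply: (eq_law_integral (f := fun x => f (a + x)) (Z := fun w' => - X t w')) => //.
- exact: mX.
- by under eq_fun do rewrite -scaleN1r; apply: measurable_rVZ; exact: mX.
- by move=> B mB; rewrite -X_sym.
Qed.

(** [density_spectral_le_energy] for the density of [X (u / 2)]. *)
Lemma levy_energy_ge u : 0 < u ->
  (\int[leb n]_xi (spec xi * expR (- (u * Psi xi)))%:E <=
   (gmass ^+ n)%:E * ((gmass ^+ n)%:E * \int[P]_w gamma (X u w)))%E.
Proof.
move=> u0; pose t := u / 2; have t0 : 0 < t by rewrite divr_gt0.
have tt : t + t = u by rewrite /t; lra.
have [q0_ Hq] := X_dens; pose q := q0_ t; have [mq q0 qE] := Hq t t0.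
have t0' := ltW t0.
have dens (f : rV -> \bar R) : measurable_fun setT f -> (forall x, 0 <= f x)%E ->
    (\int[P]_w f (X t w) = \int[leb n]_x ((q x)%:E * f x))%E.
  move=> mf f0.
  pose nu := measure_function_pushforward__canonical__measure_function_Measure P (mX t0').
  rewrite -(@ge0_integral_density R _ _ (leb n) nu q mq q0)//.
  by rewrite /nu /= ge0_integral_pushforward//; exact: mX.
have q1 : (\int[leb n]_x (q x)%:E = 1)%E.
  have := dens (cst 1%E) (measurable_cst _) (fun=> lee01).
  under [RHS]eq_integral do rewrite mule1.
  by move=> <-; rewrite integral_cst// [X in (_ * X)%E](@probability_setT _ _ _ P) mul1e.
have qfin : (\int[leb n]_x (q x)%:E < +oo)%E by rewrite q1 ltry.
have mid : measurable_fun setT (id : rV -> rV) by exact: measurable_id.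
(* [1 + cos] is nonnegative, so the change of variables for nonnegative
   functions suffices. *)
have cq xi : cosT q xi = expR (- (t * Psi xi)).
  have mc : measurable_fun setT (fun x : rV => cos (dot x xi) : measurableTypeR R).
    by apply: measurable_cos_dot => //; exact: measurable_cst.
  have m1c : measurable_fun setT (fun x : rV => (1 + cos (dot x xi))%:E).
    by apply/measurable_EFinP; apply: measurable_funD.
  have := dens _ m1c (fun x => _).
  have c0 (x : rV) : (0 <= (1 + cos (dot x xi))%:E)%E.
    by rewrite lee_fin; have := cos_geN1 (dot x xi); lra.
  move=> /(_ c0).
  have -> : (\int[P]_w (1 + cos (dot (X t w) xi))%:E = (1 + expR (- (t * Psi xi)))%:E)%E.
    have -> : (\int[P]_w (1 + cos (dot (X t w) xi))%:E =
      \int[P]_w ((1 : R)%:E + (1 * cos (dot (X t w) xi))%:E))%E.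
      by apply: eq_integral => w _; rewrite mul1r EFinD.
    rewrite integralD//; last 2 first.
    - exact: finite_measure_integrable_cst.
    - by apply: integrable_weighted_cos => //; exact: mX.
    rewrite weighted_chfE//; last exact: mX.
    by rewrite chf_levy// integral_cst// [X in (_ * X)%E](@probability_setT _ _ _ P) mul1e.
  have -> : (\int[leb n]_x ((q x)%:E * (1 + cos (dot x xi))%:E) = (1 + cosT q xi)%:E)%E.
    have -> : (\int[leb n]_x ((q x)%:E * (1 + cos (dot x xi))%:E) =
       \int[leb n]_x ((q x)%:E + (q x * cos (dot x xi))%:E))%E.
      by apply: eq_integral => x _; rewrite -EFinM mulrDr mulr1 EFinD.
    rewrite integralD//; last 2 first.
    - apply/integrableP; split; first exact/measurable_EFinP.
      by under eq_integral do rewrite gee0_abs ?lee_fin//.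
    - exact: (@integrable_weighted_cos R n _ _ (leb n) id q mid mq q0 qfin xi).
    by rewrite q1 EFinD; congr (_ + _)%E;
      exact: (@weighted_chfE R n _ _ (leb n) id q mid mq q0 qfin xi).
  by move=> -[] /addrI.
have -> : (\int[leb n]_xi (spec xi * expR (- (u * Psi xi)))%:E =
   \int[leb n]_xi (spec xi * cosT q xi ^+ 2)%:E)%E.
  apply: eq_integral => xi _; rewrite cq -expRM_natl; congr (_ * expR _)%:E.
  by rewrite -tt; ring.
have -> : (\int[P]_w gamma (X u w) = \int[leb2]_z ((q z.1 * q z.2)%:E * gamma (pair_diff z)))%E.
  rewrite -tt (integral_double_time t0' mg g0).
  pose G (a : rV) := (\int[P]_w' gamma (a - X t w')%R)%E.
  have mG : measurable_fun setT G.
    apply: (measurable_fun_fubini_tonelli_F (fun z : rV * Omega => gamma (z.1 - X t z.2))) => //.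
    apply: measurableT_comp => //; apply: measurable_rVB; first exact: measurable_fst.
    by apply: (measurableT_comp (mX t0')); exact: measurable_snd.
  rewrite -[LHS]/(\int[P]_w G (X t w))%E dens//; last by move=> a; exact: integral_ge0.
  have mF : measurable_fun setT (fun z : rV * rV => ((q z.1 * q z.2)%:E * gamma (pair_diff z))%E).
    apply: emeasurable_funM.
      apply/measurable_EFinP; apply: measurable_funM; apply: (measurableT_comp mq).
        exact: measurable_fst.
      exact: measurable_snd.
    by apply: measurableT_comp => //; exact: measurable_pair_diff.
  rewrite integral_leb2//; last by move=> z; rewrite mule_ge0 ?lee_fin ?mulr_ge0.
  have ma (a : rV) : measurable_fun setT (fun x : rV => gamma (a - x)).
    by apply: measurableT_comp => //; exact: measurable_rVB.
  apply: eq_integral => a _; rewrite /G (dens (fun x => gamma (a - x)))//.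
  rewrite -ge0_integralZl//.
  - by apply: eq_integral => b _; rewrite muleA EFinM.
  - by apply: emeasurable_funM => //; exact/measurable_EFinP.
  - by move=> b _; rewrite mule_ge0 ?lee_fin.
  - by rewrite lee_fin.
exact: (density_spectral_le_energy K).
Qed.

(** The energy identity. Both sides may be infinite. *)
Lemma levy_energyE u : 0 < u ->
  ((gmass ^+ n)%:E * ((gmass ^+ n)%:E * \int[P]_w gamma (X u w)) =
   \int[leb n]_xi (spec xi * expR (- (u * Psi xi)))%:E)%E.
Proof.
move=> u0; apply/eqP; rewrite eq_le; apply/andP; split; last exact: levy_energy_ge.
by apply: levy_energy_le; exact: ltW.
Qed.

End levy_energy.

(** * The time kernel *)

Section time_kernel.
Context {R : realType}.
Local Notation mu := (@lebesgue_measure R).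
Variable beta : R.
Hypothesis beta01 : 0 < beta < 1.

Let b0 : 0 < beta. Proof. by case/andP: beta01. Qed.
Let b1 : beta < 1. Proof. by case/andP: beta01. Qed.
Let a0 : 0 < 1 - beta. Proof. by rewrite subr_gt0. Qed.
Let nb0 : - beta != 0. Proof. by rewrite oppr_eq0 gt_eqF. Qed.

Let measurable_itv_indic (i : interval R) :
  measurable_fun setT (\1_([set` i] : set (measurableTypeR R)) : measurableTypeR R -> measurableTypeR R).
Proof. by apply: measurable_indic; exact: measurable_itv. Qed.

Let mpow : measurable_fun setT (fun u : measurableTypeR R => u `^ (- beta) : measurableTypeR R).
Proof. exact: measurable_powR. Qed.

Let mexp (psi : R) : measurable_fun setT (fun u : measurableTypeR R => expR (- (u * psi)) : measurableTypeR R).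
Proof. by apply: measurableT_comp => //; apply: measurableT_comp => //; exact: measurable_funM. Qed.

(** On [1/(k+2), 1] the fundamental theorem of calculus gives a bound that does
    not depend on [k]. *)
Lemma integral_powR_near0_lty :
  (\int[mu]_u (\1_(`]0, 1]%classic : set (measurableTypeR R)) u * u `^ (- beta))%:E < +oo)%E.
Proof.
apply: (@le_lt_trans _ _ ((1 - beta)^-1)%:E); last exact: ltry.
pose f (k : nat) (u : measurableTypeR R) :=
  (\1_(`[(k.+2%:R)^-1, 1]%classic : set (measurableTypeR R)) u * u `^ (- beta))%:E.
apply: (fatou_le (f := f)).
- by move=> k; apply/measurable_EFinP; apply: measurable_funM.
- by move=> k u; rewrite lee_fin mulr_ge0 ?powR_ge0.
- move=> u; apply: cvg_near_cst.
  exists (Num.bound (u^-1)) => // k /= uk; rewrite /f; congr (_ * _)%:E.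
  rewrite !indicE; congr (nat_of_bool _)%:R; apply/idP/idP; rewrite !inE /= !in_itv /=.
    by move=> /andP[ku ->]; rewrite andbT (lt_le_trans _ ku)// invr_gt0.
  move=> /andP[u0 ->]; rewrite andbT invf_ple ?posrE//.
  have ui0 : 0 <= u^-1 by rewrite invr_ge0 ltW.
  apply: le_trans (ltW (archi_boundP ui0)) _; rewrite ler_nat.
  by apply: (leq_trans uk); rewrite -addn2 leq_addr.
- move=> k; set c : R := (k.+2%:R)^-1.
  have c0 : 0 < c by rewrite invr_gt0.
  have c1 : c < 1 by rewrite invf_lt1// ltr1n.
  pose F (u : R) := (1 - beta)^-1 * u `^ (1 - beta).
  have dF (u : R) : 0 < u -> is_derive u (1 : R) F (u `^ (- beta)).
    move=> u0; rewrite /F; have := is_derive1_powR (1 - beta) u0 => D.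
    apply: is_derive_eq; rewrite /GRing.scale /= mulrA mulVf ?gt_eqF// mul1r.
    by congr (_ `^ _); ring.
  have -> : (\int[mu]_u f k u = \int[mu]_(u in `[c, 1%R]) (u `^ (- beta))%:E)%E.
    rewrite [RHS]integral_mkcond; apply: eq_integral => u _.
    by rewrite epatch_indic /= muleC -EFinM.
  have pos (u : R) : c <= u -> 0 < u by exact: lt_le_trans.
  have cP (p u : R) : 0 < u -> {for u, continuous (@powR R ^~ p)}.
    move=> u0; apply/differentiable_continuous/derivable1_diffP.
    by case: (is_derive1_powR p u0).
  rewrite (@continuous_FTC2 R _ F)//.
  + rewrite -EFinB lee_fin /F powR1 mulr1 gerBl mulr_ge0 ?powR_ge0// invr_ge0 ltW//.
  + apply: continuous_in_subspaceT => u; rewrite inE /= in_itv /= => /andP[cu _].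
    by apply: cP; exact: pos.
  + split.
    * move=> u; rewrite in_itv /= => /andP[cu _].
      by case: (dF u (lt_trans c0 cu)).
    * apply: cvg_at_right_filter; apply: cvgM; first exact: cvg_cst.
      exact: (cP (1 - beta) c c0).
    * apply: cvg_at_left_filter; apply: cvgM; first exact: cvg_cst.
      exact: (cP (1 - beta) 1 ltr01).
  + move=> u; rewrite in_itv /= => /andP[cu _]; rewrite derive1E.
    by case: (dF u (lt_trans c0 cu)).
Qed.

(** The integrand of Euler's Gamma function at [1 - beta]. *)
Definition gamma_density (u : measurableTypeR R) : R :=
  \1_(`]0, +oo[%classic : set (measurableTypeR R)) u * (u `^ (- beta) * expR (- u)).

Lemma gamma_density_ge0 u : 0 <= gamma_density u.
Proof. by rewrite mulr_ge0// mulr_ge0 ?powR_ge0 ?expR_ge0. Qed.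

Lemma measurable_gamma_density :
  measurable_fun setT (gamma_density : _ -> measurableTypeR R).
Proof.
apply: measurable_funM => //; apply: measurable_funM => //.
by apply: measurableT_comp.
Qed.

(** Compare with the power near 0 and with the exponential density beyond 1. *)
Lemma integral_gamma_density_lty : (\int[mu]_u (gamma_density u)%:E < +oo)%E.
Proof.
pose p (u : measurableTypeR R) := \1_(`]0, 1]%classic : set (measurableTypeR R)) u * u `^ (- beta).
have p0 u : 0 <= p u by rewrite mulr_ge0 ?powR_ge0.
have mp : measurable_fun setT (fun u => (p u)%:E).
  by apply/measurable_EFinP; apply: measurable_funM.
have me : measurable_fun setT (fun u : measurableTypeR R => (exponential_pdf 1 u)%:E).
  by apply/measurable_EFinP; exact: measurable_exponential_pdf.
have e0 (u : R) : 0 <= exponential_pdf 1 u by apply: exponential_pdf_ge0.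
apply: (@le_lt_trans _ _ (\int[mu]_u ((p u)%:E + (exponential_pdf 1 u)%:E))%E).
  apply: ge0_le_integral => //.
  - by move=> u _; rewrite lee_fin gamma_density_ge0.
  - by apply/measurable_EFinP; exact: measurable_gamma_density.
  - exact: emeasurable_funD.
  - move=> u _; rewrite -EFinD lee_fin /gamma_density indicE.
    have [|] := boolP (_ \in _); last by rewrite mul0r addr_ge0.
    rewrite inE /= in_itv /= andbT mul1r => u0.
    have -> : exponential_pdf 1 u = expR (- u).
      rewrite /exponential_pdf patchE mem_set /= ?mul1r ?mulN1r//.
      by rewrite in_itv /= andbT ltW.
    have [u1|u1] := leP u 1.
      rewrite /p indicE mem_set /= ?in_itv /= ?u0// mul1r.
      rewrite (le_trans (ler_piMr _ _)) ?powR_ge0// ?lerDl ?expR_ge0//.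
      by rewrite -expR0 ler_expR oppr_le0 ltW.
    rewrite (@le_trans _ _ (expR (- u)))// ?lerDr// ler_piMl ?expR_ge0//.
    rewrite powRN invf_le1 ?powR_gt0//.
    have := @ge0_ler_powR R beta (ltW b0) 1 u; rewrite powR1 !nnegrE; apply => //; exact: ltW.
rewrite ge0_integralD//; last 2 first.
- by move=> u _; rewrite lee_fin.
- by move=> u _; rewrite lee_fin.
by rewrite integral_exponential_pdf// lte_add_pinfty ?ltry// integral_powR_near0_lty.
Qed.

Definition gamma_mass : R := fine (\int[mu]_u (gamma_density u)%:E)%E.

Lemma gamma_massE : (\int[mu]_u (gamma_density u)%:E = gamma_mass%:E)%E.
Proof.
rewrite fineK// ge0_fin_numE ?integral_gamma_density_lty//.
by apply: integral_ge0 => u _; rewrite lee_fin gamma_density_ge0.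
Qed.

Lemma gamma_mass_ge0 : 0 <= gamma_mass.
Proof.
rewrite -lee_fin -gamma_massE; apply: integral_ge0 => u _.
by rewrite lee_fin gamma_density_ge0.
Qed.

(** What a frequency of exponent [psi] contributes for a time lag [u]. *)
Definition tkernel (psi u : R) : R := u `^ (- beta) * expR (- (u * psi)).

Lemma tkernel_ge0 psi u : 0 <= tkernel psi u.
Proof. by rewrite mulr_ge0 ?powR_ge0 ?expR_ge0. Qed.

Lemma measurable_tkernel psi :
  measurable_fun setT (tkernel psi : measurableTypeR R -> measurableTypeR R).
Proof. exact: (measurable_funM mpow (mexp psi)). Qed.

Definition tkernel_upto (t psi : R) (u : measurableTypeR R) : R :=
  \1_(`]0, t]%classic : set (measurableTypeR R)) u * tkernel psi u.

Lemma tkernel_upto_ge0 t psi u : 0 <= tkernel_upto t psi u.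
Proof. by rewrite mulr_ge0 ?tkernel_ge0. Qed.

Lemma measurable_tkernel_upto t psi : measurable_fun setT (tkernel_upto t psi : _ -> measurableTypeR R).
Proof. by apply: measurable_funM => //; exact: measurable_tkernel. Qed.

(** Two bounds are added: [exp (- u psi) <= 1 <= exp t * exp (- u)] on ]0, t], and
    the substitution [v = psi u], which produces the factor [psi ^ (1 - beta)]. *)
Lemma integral_tkernel_upto_le t psi : 0 <= psi ->
  (\int[mu]_u (tkernel_upto t psi u)%:E <=
   ((expR t + 1) * gamma_mass / (1 + psi `^ (1 - beta)))%:E)%E.
Proof.
move=> psi0; have mtk := measurable_tkernel_upto t psi.
have pa : 0 <= psi `^ (1 - beta) := powR_ge0 _ _.
have mgd := measurable_gamma_density.
have i0 : (0 <= \int[mu]_u (tkernel_upto t psi u)%:E)%E.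
  by apply: integral_ge0 => u _; rewrite lee_fin tkernel_upto_ge0.
have h1 : (\int[mu]_u (tkernel_upto t psi u)%:E <= (expR t * gamma_mass)%:E)%E.
  rewrite EFinM -gamma_massE -ge0_integralZl//; last 2 first.
  - exact/measurable_EFinP.
  - by move=> u _; rewrite lee_fin gamma_density_ge0.
  apply: ge0_le_integral => //.
  - by move=> u _; rewrite lee_fin tkernel_upto_ge0.
  - exact/measurable_EFinP.
  - by apply: emeasurable_funM => //; exact/measurable_EFinP.
  - move=> u _; rewrite -EFinM lee_fin /tkernel_upto indicE.
    have [|] := boolP (_ \in _); last by rewrite mul0r mulr_ge0 ?expR_ge0 ?gamma_density_ge0.
    rewrite inE /= in_itv /= mul1r => /andP[u0 ut].
    rewrite /gamma_density indicE mem_set /= ?in_itv /= ?u0// mul1r /tkernel.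
    rewrite mulrCA ler_wpM2l ?powR_ge0// -expRD ler_expR.
    by have : 0 <= u * psi by [rewrite mulr_ge0// ltW]; lra.
have h2 : ((psi `^ (1 - beta))%:E * \int[mu]_u (tkernel_upto t psi u)%:E <= gamma_mass%:E)%E.
  move: psi0; rewrite le_eqVlt => /predU1P[<-|psi0].
    by rewrite powR0 ?gt_eqF// mul0e lee_fin gamma_mass_ge0.
  rewrite -gamma_massE -(@ge0_integral_affine1 R psi 0 (fun u => (gamma_density u)%:E))//; last 2 first.
  - exact/measurable_EFinP.
  - by move=> u; rewrite lee_fin gamma_density_ge0.
  have mgdp : measurable_fun setT (fun u : measurableTypeR R => (gamma_density (0 + psi * u))%:E).
    by apply/measurable_EFinP; apply: (measurableT_comp mgd); exact: measurable_affine1.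
  have mtkE : measurable_fun setT (fun u => (tkernel_upto t psi u)%:E) by exact/measurable_EFinP.
  rewrite -(ge0_integralZl mu measurableT mgdp); last 2 first.
  - by move=> u _; rewrite lee_fin gamma_density_ge0.
  - by rewrite lee_fin ltW.
  rewrite -(ge0_integralZl mu measurableT mtkE); last 2 first.
  - by move=> u _; rewrite lee_fin tkernel_upto_ge0.
  - by rewrite lee_fin.
  apply: ge0_le_integral => //.
  - by move=> u _; rewrite mule_ge0 ?lee_fin ?tkernel_upto_ge0.
  - exact: emeasurable_funM.
  - exact: emeasurable_funM.
  - move=> u _; rewrite -!EFinM lee_fin /tkernel_upto indicE.
    have [|] := boolP (_ \in _); last first.
      by rewrite mul0r mulr0 mulr_ge0 ?gamma_density_ge0// ltW.
    rewrite inE /= in_itv /= mul1r add0r => /andP[u0 ut].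
    rewrite /gamma_density indicE mem_set /= ?in_itv /= ?mulr_gt0// mul1r /tkernel.
    have E : psi * (psi * u) `^ (- beta) = psi `^ (1 - beta) * u `^ (- beta).
      rewrite powRM ?(ltW psi0) ?(ltW u0)// mulrA powRD; last by rewrite gt_eqF// implybT.
      by rewrite powRr1 ?(ltW psi0).
    by rewrite !mulrA E [psi * u]mulrC.
have If : (\int[mu]_u (tkernel_upto t psi u)%:E)%E \is a fin_num.
  by rewrite ge0_fin_numE// (le_lt_trans h1)// ltry.
move: h1 h2; rewrite -(fineK If) -EFinM !lee_fin => h1 h2.
by rewrite ler_pdivlMr ?ltr_pwDl// mulrDr mulr1 mulrDl mul1r lerD// mulrC.
Qed.

(** On ]0, b] with [b] the minimum of 1 and [1 / psi], the time kernel is at least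
    its value for [u = b], which is at least [b ^ (- beta) / e]. *)
Lemma integral_tkernel_upto_ge psi : 0 <= psi ->
  ((expR (- 1) / (1 + psi `^ (1 - beta)))%:E <= \int[mu]_u (tkernel_upto 1 psi u)%:E)%E.
Proof.
move=> psi0; have pa : 0 <= psi `^ (1 - beta) := powR_ge0 _ _.
pose b : R := if psi <= 1 then 1 else psi^-1.
have b_gt0 : 0 < b.
  by rewrite /b; case: ifP => // /negbT; rewrite -ltNge => p1; rewrite invr_gt0 (lt_trans _ p1).
have b_le1 : b <= 1.
  rewrite /b; case: ifP => // /negbT; rewrite -ltNge => p1; rewrite invf_le1 ?ltW//.
  exact: lt_trans p1.
have b_psi : b * psi <= 1.
  rewrite /b; case: ifP => [|/negbT]; first by rewrite mul1r.
  by rewrite -ltNge => p1; rewrite mulVf// gt_eqF// (lt_trans _ p1).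
have b_ge : (1 + psi `^ (1 - beta))^-1 <= b `^ (1 - beta).
  rewrite /b; case: ifP => [|/negbT].
    by rewrite powR1 invf_le1 ?ltr_pwDl// lerDl.
  rewrite -ltNge => p1; have p0 : 0 < psi by exact: lt_trans p1.
  rewrite -(powR_inv1 (ltW p0)) -powRrM mulN1r powRN lef_pV2 ?posrE ?ltr_pwDl ?powR_gt0//.
  by rewrite lerDr.
pose c := b `^ (- beta) * expR (- 1).
have c0 : 0 <= c by rewrite mulr_ge0 ?powR_ge0 ?expR_ge0.
apply: (@le_trans _ _ (\int[mu]_(u in `]0%R, b]) c%:E)%E).
  rewrite integral_cst//= lebesgue_measure_itv /= lte_fin b_gt0 -EFinB -EFinM lee_fin subr0.
  rewrite /c mulrAC mulrC ler_wpM2r ?expR_ge0// mulrC.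
  by rewrite -[X in X * _](powRr1 (ltW b_gt0)) -powRD// gt_eqF// implybT.
rewrite integral_mkcond; apply: ge0_le_integral => //.
- by move=> u _; rewrite erestrict_ge0// => v _; rewrite lee_fin.
- by apply/(measurable_restrictT _ _).1 => //; exact: measurable_cst.
- by apply/measurable_EFinP; exact: measurable_tkernel_upto.
- move=> u _; rewrite epatch_indic /= -EFinM lee_fin indicE.
  have [|] := boolP (_ \in _); last by rewrite mulr0 tkernel_upto_ge0.
  rewrite inE /= in_itv /= mulr1 => /andP[u0 ub].
  rewrite /tkernel_upto indicE mem_set ?mul1r /=; last by rewrite in_itv /= u0 (le_trans ub).
  rewrite /c /tkernel ler_pM ?powR_ge0 ?expR_ge0//.
    rewrite !powRN lef_pV2 ?posrE ?powR_gt0//.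
    by rewrite ge0_ler_powR ?nnegrE ?(ltW b0) ?(ltW u0) ?(ltW b_gt0).
  rewrite ler_expR lerN2 (le_trans _ b_psi)// ler_wpM2r//.
Qed.

(** The double time integral of the theorem, seen from one frequency. *)
Definition time_energy (t psi : R) : \bar R :=
  (\int[mu]_(s in `[0%R, t]) \int[mu]_(r in `[0%R, t]) (tkernel psi `|r - s|)%:E)%E.

Lemma integral_shift (f : measurableTypeR R -> \bar R) (s : R) :
  measurable_fun setT f -> (forall x, 0 <= f x)%E ->
  (\int[mu]_r f (r - s)%R = \int[mu]_r f r)%E.
Proof.
move=> mf f0; rewrite -(@ge0_integral_affine1 R 1 (- s) f)// mul1e.
by apply: eq_integral => r _; rewrite mul1r addrC.
Qed.

Let mabs (psi s : R) : measurable_fun setT (fun r : measurableTypeR R => (tkernel psi `|r - s|)%:E).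
Proof.
apply/measurable_EFinP; apply: (measurableT_comp (measurable_tkernel psi)).
by apply: measurableT_comp => //; exact: measurable_funB.
Qed.

Lemma measurable_inner_time t psi : measurable_fun setT (fun s : measurableTypeR R =>
  \int[mu]_(r in `[0%R, t]) (tkernel psi `|r - s|)%:E)%E.
Proof.
under eq_fun do rewrite integral_mkcond.
apply: (measurable_fun_fubini_tonelli_F (fun z : measurableTypeR R * measurableTypeR R =>
   ((fun r => (tkernel psi `|r - z.1|)%:E) \_ `[0%R, t]) z.2)).
  under eq_fun do rewrite epatch_indic -EFinM.
  apply/measurable_EFinP; apply: measurable_funM.
    apply: (measurableT_comp (measurable_tkernel psi)); apply: measurableT_comp => //.
    by apply: measurable_funB; [exact: measurable_snd|exact: measurable_fst].
  by apply: measurableT_comp => //; exact: measurable_snd.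
by move=> z; rewrite erestrict_ge0// => v _; rewrite lee_fin tkernel_ge0.
Qed.

Let tkernel0 psi : tkernel psi 0 = 0.
Proof. by rewrite /tkernel powR0 ?mul0r. Qed.

(** For each [s], the inner integral is at most twice a one-sided one. *)
Lemma time_energy_le t psi : 0 < t -> 0 <= psi ->
  (time_energy t psi <= (2 * t * ((expR t + 1) * gamma_mass) / (1 + psi `^ (1 - beta)))%:E)%E.
Proof.
move=> t0 psi0.
have mtk := measurable_tkernel_upto t psi.
have mtkE : measurable_fun setT (fun u => (tkernel_upto t psi u)%:E) by exact/measurable_EFinP.
have tkE0 u : (0 <= (tkernel_upto t psi u)%:E)%E by rewrite lee_fin tkernel_upto_ge0.
set I := (\int[mu]_u (tkernel_upto t psi u)%:E)%E.
have inner s : `[0, t]%classic s -> (\int[mu]_(r in `[0%R, t]) (tkernel psi `|r - s|)%:E <= I + I)%E.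
  rewrite /= in_itv /= => /andP[s0 st].
  have mN : measurable_fun setT (fun u : measurableTypeR R => (tkernel_upto t psi (- u))%:E).
    by apply: (measurableT_comp mtkE); exact: oppr_measurable.
  have ms (f : measurableTypeR R -> \bar R) : measurable_fun setT f ->
      measurable_fun setT (fun r : measurableTypeR R => f (r - s)).
    by move=> mf; apply: (measurableT_comp mf); exact: measurable_funB.
  have -> : (I + I = \int[mu]_r ((tkernel_upto t psi (r - s))%:E + (tkernel_upto t psi (- (r - s)))%:E))%E.
    rewrite ge0_integralD//; [|exact: (ms _ mtkE)|exact: (ms _ mN)].
    rewrite (integral_shift s mtkE tkE0) (integral_shift s mN (fun u => tkE0 _)).
    by rewrite (ge0_integral_opp1 mtkE tkE0).
  rewrite integral_mkcond; apply: ge0_le_integral => //.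
  - by move=> r _; rewrite erestrict_ge0// => v _; rewrite lee_fin tkernel_ge0.
  - apply/(measurable_restrictT _ _).1 => //; exact: measurable_funTS.
  - by apply: emeasurable_funD; [exact: (ms _ mtkE)|exact: (ms _ mN)].
  - move=> r _; rewrite epatch_indic /= -EFinM -EFinD lee_fin indicE.
    have [|] := boolP (_ \in _); last by rewrite mulr0 addr_ge0 ?tkernel_upto_ge0.
    rewrite inE /= in_itv /= mulr1 => /andP[r0 rt].
    have tkE u : 0 < u <= t -> tkernel_upto t psi u = tkernel psi u.
      by move=> ut; rewrite /tkernel_upto indicE mem_set ?mul1r//= in_itv.
    have [rs|sr|->] := ltgtP r s.
    + rewrite distrC gtr0_norm ?subr_gt0// opprB [X in _ <= _ + X]tkE ?lerDr ?tkernel_upto_ge0//.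
      by rewrite subr_gt0 rs /= lerBlDr (le_trans st)// lerDl.
    + rewrite gtr0_norm ?subr_gt0// [X in _ <= X + _]tkE ?lerDl ?tkernel_upto_ge0//.
      by rewrite subr_gt0 sr /= lerBlDr (le_trans rt)// lerDl.
    + by rewrite subrr normr0 tkernel0 addr_ge0 ?tkernel_upto_ge0.
have I0 : (0 <= I)%E by apply: integral_ge0.
have Ile := integral_tkernel_upto_le t psi0.
have If : I \is a fin_num by rewrite ge0_fin_numE// (le_lt_trans Ile)// ltry.
apply: (@le_trans _ _ (\int[mu]_(s in `[0%R, t]) (I + I))%E).
  apply: ge0_le_integral => //.
  - by move=> s _; apply: integral_ge0 => r _; rewrite lee_fin tkernel_ge0.
  - by apply: measurable_funTS; exact: measurable_inner_time.
rewrite -(fineK If) -EFinD integral_cst//= lebesgue_measure_itv /= lte_fin t0 -EFinB subr0 -EFinM.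
move: Ile; rewrite -/I -(fineK If) !lee_fin => Ile.
rewrite [leRHS](_ : _ = 2 * t * ((expR t + 1) * gamma_mass / (1 + psi `^ (1 - beta)))); last by rewrite !mulrA.
have : 0 <= t by exact: ltW.
nra.
Qed.

(** Restrict to [s] in [0, 1] and [r] in ]s, s + 1]. *)
Lemma time_energy_ge psi : 0 <= psi ->
  ((expR (- 1) / (1 + psi `^ (1 - beta)))%:E <= time_energy 2 psi)%E.
Proof.
move=> psi0; apply: (le_trans (integral_tkernel_upto_ge psi0)).
have mtk := measurable_tkernel_upto 1 psi.
have mtkE : measurable_fun setT (fun u => (tkernel_upto 1 psi u)%:E) by exact/measurable_EFinP.
have tkE0 u : (0 <= (tkernel_upto 1 psi u)%:E)%E by rewrite lee_fin tkernel_upto_ge0.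
set I := (\int[mu]_u (tkernel_upto 1 psi u)%:E)%E.
have I0 : (0 <= I)%E by apply: integral_ge0.
apply: (@le_trans _ _ (\int[mu]_(s in `[0%R, 1%R]) I)%E).
  by rewrite integral_cst//= lebesgue_measure_itv /= lte_fin ltr01 -EFinB subr0 mule1.
apply: (@le_trans _ _ (\int[mu]_(s in `[0%R, 1%R]) \int[mu]_(r in `[0%R, 2%R]) (tkernel psi `|r - s|)%:E)%E).
  apply: ge0_le_integral => //; first by apply: measurable_funTS; exact: measurable_inner_time.
  move=> s /=; rewrite in_itv /= => /andP[s0 s1].
  rewrite /I -(integral_shift s mtkE tkE0) [leRHS]integral_mkcond; apply: ge0_le_integral => //.
  - by apply: (measurableT_comp mtkE); exact: measurable_funB.
  - apply/(measurable_restrictT _ _).1 => //; exact: measurable_funTS.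
  - move=> r _; rewrite epatch_indic /= -EFinM lee_fin /tkernel_upto indicE.
    have [|] := boolP (_ \in _); last by rewrite mul0r mulr_ge0 ?tkernel_ge0.
    rewrite inE /= in_itv /= mul1r subr_gt0 => /andP[sr rs].
    rewrite indicE mem_set ?mulr1 ?gtr0_norm ?subr_gt0//= in_itv /=.
    by apply/andP; split; lra.
apply: ge0_subset_integral => //.
- by apply: measurable_funTS; exact: measurable_inner_time.
- by move=> s _; apply: integral_ge0 => r _; rewrite lee_fin tkernel_ge0.
- by apply: subset_itvl; rewrite bnd_simp; lra.
Qed.

End time_kernel.

(** * Joint measurability of the paths *)

Section null_modification.
Context {R : realType} {d : measure_display} {T : measurableType d}.
Variable mu : {measure set T -> \bar R}.
Import HBNNSimple.

(** Needed because the path integrals of the theorem may fail to be measurable: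
    on a null set nothing is known about the paths. The simple functions below
    [F] become simple functions below [G] once they are cut off on [N]. *)
Lemma integral_eq_off_null (N : set T) (F G : T -> \bar R) :
  measurable N -> mu N = 0%E -> (forall x, 0 <= F x)%E -> (forall x, 0 <= G x)%E ->
  (forall x, ~ N x -> F x = G x) -> (\int[mu]_x F x = \int[mu]_x G x)%E.
Proof.
move=> mN N0; wlog suff : F G / (forall x, 0 <= F x)%E -> (forall x, 0 <= G x)%E ->
    (forall x, ~ N x -> F x = G x) -> (\int[mu]_x F x <= \int[mu]_x G x)%E.
  move=> h F0 G0 FG; apply/eqP; rewrite eq_le !h// => x Nx; exact/esym/FG.
move=> F0 G0 FG; rewrite !ge0_integralTE//.
apply: ge_ereal_sup => _ [/= h hF <-].
pose h' := proj_nnsfun h (measurableC mN).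
apply: (@le_trans _ _ (sintegral mu h')); last first.
  apply: ereal_sup_ubound; exists h' => // x.
  rewrite /h' -mrestrict patchE; case: ifPn => [|_]; last exact: G0.
  by rewrite inE => Nx; rewrite -FG.
rewrite -!integralT_nnsfun le_eqVlt; apply/orP; left; apply/eqP.
apply: ge0_ae_eq_integral => //.
- exact/measurable_EFinP.
- exact/measurable_EFinP.
- by move=> x _; rewrite lee_fin.
- by move=> x _; rewrite lee_fin.
exists N; split => // x /= xN; apply: contrapT => Nx; apply: xN => _.
have E : h' x = h x by rewrite /h' -mrestrict patchE mem_set.
by rewrite -[RHS]/((h' x)%:E) E.
Qed.

End null_modification.

Section joint_measurability.
Context {R : realType} {n : nat} {d : measure_display} {Omega : measurableType d}.
Variables (P : probability Omega R) (X : R -> Omega -> 'rV[R]_n).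
Hypothesis mX : forall t, 0 <= t -> measurable_fun [set: Omega] (X t).
Hypothesis X_cadlag : {ae P, forall w, cadlag (X ^~ w)}.
Local Notation rV := 'rV[R]_n.

Let grid (k j : nat) : R := j%:R / k.+1%:R.

Let cell k j : set (measurableTypeR R) := `[grid k j, grid k j.+1[%classic.

Let grid_ge0 k j : 0 <= grid k j. Proof. by rewrite divr_ge0. Qed.

Let cellP k j s : 0 <= s -> cell k j s <-> Num.truncn (s * k.+1%:R) = j.
Proof.
move=> s0; have sk0 : 0 <= s * k.+1%:R by rewrite mulr_ge0.
have k0 : 0 < k.+1%:R :> R by [].
rewrite /cell /= in_itv /= /grid ler_pdivrMr// ltr_pdivlMr//; split.
  move=> /andP[h1 h2]; apply/eqP; rewrite eqn_leq truncn_le_nat h2 /=.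
  by rewrite truncn_ge_nat.
by move=> <-; rewrite truncn_itv.
Qed.

Let cell_ge0 k j s : cell k j s -> 0 <= s.
Proof. by rewrite /cell /= in_itv /= => /andP[+ _]; apply: le_trans. Qed.

(** The process is sampled at the end of each cell of a grid of mesh
    [1 / (k + 1)]; by right-continuity the samples converge to the process. *)
Lemma jointly_measurable_modification (T : nat) :
  exists N (Z : Omega * measurableTypeR R -> rV),
    [/\ measurable N, P N = 0%E, measurable_fun setT Z &
        forall w s, ~ N w -> 0 <= s < T%:R -> Z (w, s) = X s w].
Proof.
have [N [mN N0 Nc]] := X_cadlag.
pose T0 : set (measurableTypeR R) := `[0, T%:R[%classic.
pose Z (z : Omega * measurableTypeR R) : rV := (\1_(~` N) z.1 * \1_T0 z.2) *: X z.2 z.1.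
exists N, Z; split => //; last first.
  by move=> w s Nw sT; rewrite /Z /= !indicE !mem_set ?mulr1 ?scale1r//=.
apply: measurable_fun_rVP => i.
pose Zk (k : nat) (z : Omega * measurableTypeR R) : R :=
  \sum_(j < k.+1 * T) (\1_(~` N) z.1 * \1_(cell k j) z.2 * X (grid k j.+1) z.1 0 i).
apply: (measurable_fun_cvg (h := Zk : nat -> _ -> measurableTypeR R)).
  move=> k; apply: measurable_sum => j; apply: measurable_funM.
    apply: measurable_funM.
      apply: measurableT_comp; last exact: measurable_fst.
      by apply: measurable_indic; exact: measurableC.
    apply: measurableT_comp; last exact: measurable_snd.
    by apply: measurable_indic; exact: measurable_itv.
  apply: (measurableT_comp (measurable_coord i)).
  by apply: (measurableT_comp (mX (grid_ge0 k j.+1))); exact: measurable_fst.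
move=> [w s] _; rewrite /Z /Zk /=.
have [Nw|Nw] := pselect (N w).
  have N1 : \1_(~` N) w = 0 :> R by rewrite indicE memNset//; exact.
  rewrite N1 mul0r scale0r mxE; apply: cvg_near_cst; apply: nearW => k.
  by rewrite big1// => j _; rewrite !mul0r.
rewrite !indicE (mem_set (Nw : (~` N) w)) mul1r.
have [s0|s0] := leP 0 s; last first.
  rewrite memNset; last by rewrite /T0 /= in_itv /= leNgt s0.
  rewrite scale0r mxE; apply: cvg_near_cst; apply: nearW => k.
  rewrite big1// => j _; rewrite indicE memNset ?mulr0 ?mul0r//.
  by move=> /cell_ge0; rewrite leNgt s0.
have [Ts|sT] := leP T%:R s.
  rewrite memNset; last by rewrite /T0 /= in_itv /= ltNge Ts andbF.
  rewrite scale0r mxE; apply: cvg_near_cst; apply: nearW => k.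
  rewrite big1// => j _; rewrite indicE memNset ?mulr0 ?mul0r//.
  rewrite /cell /= in_itv /= => /andP[_].
  rewrite ltNge => /negP; apply; apply: le_trans Ts.
  by rewrite /grid ler_pdivrMr// -natrM ler_nat (mulnC T).
rewrite mem_set; last by rewrite /T0 /= in_itv /= s0.
rewrite scale1r.
(* The sampling time is strictly to the right of [s]. *)
pose tau k : R := grid k (Num.truncn (s * k.+1%:R)).+1.
have tauP k : s < tau k <= s + k.+1%:R^-1.
  have : cell k (Num.truncn (s * k.+1%:R)) s by apply/cellP.
  rewrite /cell /= in_itv /= => /andP[h1 h2]; rewrite /tau h2 /=.
  by rewrite /grid -natr1 mulrDl mul1r lerD2r.
have E k : \sum_(j < k.+1 * T) (true%:R * \1_(cell k j) s * X (grid k j.+1) w 0 i) = X (tau k) w 0 i.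
  have jT : (Num.truncn (s * k.+1%:R) < k.+1 * T)%N.
    rewrite -(ltr_nat R) (@le_lt_trans _ _ (s * k.+1%:R))//.
      by rewrite truncn_le mulr_ge0.
    by rewrite mulnC natrM ltr_pM2r.
  rewrite (bigD1 (Ordinal jT))//= mul1r indicE mem_set ?mul1r; last exact/cellP.
  rewrite big1 ?addr0// => j jne; rewrite indicE memNset ?mulr0 ?mul0r// => /(cellP _ _ s0) h.
  by move/negP: jne; apply; apply/eqP/val_inj; rewrite /= h.
under eq_fun do rewrite E.
have [cr _] : cadlag (X ^~ w) by apply: contrapT => h; apply: Nw; exact: Nc.
have tau_s : tau k @[k --> \oo] --> s.
  apply: (@squeeze_cvgr _ _ _ _ (cst s) (fun k => s + k.+1%:R^-1)).
  - by apply: nearW => k; have /andP[/ltW -> ->] := tauP k.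
  - exact: cvg_cst.
  - by rewrite -[X in _ --> X]addr0; apply: cvgD; [exact: cvg_cst|exact: cvg_harmonic].
have /cvg_at_rightP h : X u w 0 i @[u --> s^'+] --> X s w 0 i.
  exact: (cvg_comp _ _ (cr s s0) (@coord_continuous _ _ _ 0 i (X s w))).
by apply: h; split => // k; have /andP[] := tauP k.
Qed.

End joint_measurability.

(** * Averaging in time *)

Section tonelli3.
Context {R : realType} {d : measure_display} {T : measurableType d}.
Variable m : {sigma_finite_measure set T -> \bar R}.
Local Notation mu := (@lebesgue_measure R).
Local Notation tR := (measurableTypeR R).
Variable f : (T * tR) * tR -> \bar R.
Hypothesis mf : measurable_fun setT f.
Hypothesis f0 : forall z, (0 <= f z)%E.

Lemma measurable_tonelli_inner : measurable_fun setT (fun z : T * tR => \int[mu]_r f (z, r))%E.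
Proof. exact: (measurable_fun_fubini_tonelli_F f mf f0). Qed.

Lemma tonelli3 : (\int[m]_x \int[mu]_s \int[mu]_r f ((x, s), r) =
  \int[mu]_s \int[mu]_r \int[m]_x f ((x, s), r))%E.
Proof.
rewrite (fubini_tonelli (m1 := m) (m2 := mu) _ measurable_tonelli_inner)/=; last first.
  by move=> z; exact: integral_ge0.
apply: eq_integral => s _.
rewrite (fubini_tonelli (m1 := m) (m2 := mu) (fun z : T * tR => f ((z.1, s), z.2)))//.
apply: (measurableT_comp mf); apply/measurable_fun_pair => /=; last exact: measurable_snd.
by apply/measurable_fun_pair => //=; exact: measurable_fst.
Qed.

End tonelli3.

Lemma measurable_time_energy {R : realType} (beta t : R) :
  measurable_fun setT (time_energy beta t : measurableTypeR R -> \bar R).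
Proof.
pose tR : measurableType _ := measurableTypeR R.
pose D : set tR := `[0, t]%classic.
have mD : measurable_fun setT (\1_D : tR -> tR) by apply: measurable_indic; exact: measurable_itv.
pose f (z : (tR * tR) * tR) : \bar R :=
  (\1_D z.1.2 * (\1_D z.2 * tkernel beta z.1.1 `|z.2 - z.1.2|))%:E.
have f0 z : (0 <= f z)%E by rewrite lee_fin !mulr_ge0 ?tkernel_ge0.
have m12 : measurable_fun setT (fun z : (tR * tR) * tR => z.1.2).
  by apply: measurableT_comp; [exact: measurable_snd|exact: measurable_fst].
have mr : measurable_fun setT (fun z : (tR * tR) * tR => `|z.2 - z.1.2| : tR).
  by apply: measurableT_comp => //; apply: measurable_funB => //; exact: measurable_snd.
have mf : measurable_fun setT f.
  apply/measurable_EFinP; apply: measurable_funM; first exact: (measurableT_comp mD m12).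
  apply: measurable_funM; first by apply: (measurableT_comp mD); exact: measurable_snd.
  apply: measurable_funM; first exact: (measurableT_comp (@measurable_powR R (- beta)) mr).
  apply: measurableT_comp => //; apply: measurableT_comp => //; apply: measurable_funM => //.
  by apply: measurableT_comp; exact: measurable_fst.
rewrite (_ : time_energy beta t = fun psi =>
   \int[lebesgue_measure]_s \int[lebesgue_measure]_r f ((psi, s), r))%E.
  exact: (measurable_fun_fubini_tonelli_F _ (measurable_tonelli_inner mf f0)
           (fun z => integral_ge0 _ (fun r _ => f0 _))).
apply/funext => psi; rewrite /time_energy integral_mkcond.
congr (integral _ _ _); apply/funext => s.
rewrite patchE; case: ifPn => sD; last first.
  rewrite integral0_eq// => r _; rewrite /f /=.
  by rewrite [\1_D s]indicE (negbTE sD) mul0r.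
rewrite integral_mkcond; congr (integral _ _ _); apply/funext => r.
rewrite patchE /f /= [\1_D s]indicE sD mul1r indicE.
by case: ifPn => rD; rewrite ?mul1r ?mul0r.
Qed.

Section time_average.
Context {R : realType} {n : nat} {d : measure_display} {Omega : measurableType d}.
Variables (P : probability Omega R) (X : R -> Omega -> 'rV[R]_n) (Psi : 'rV[R]_n -> R).
Variables (gamma ghat : 'rV[R]_n -> \bar R) (beta : R).
Hypothesis beta01 : 0 < beta < 1.
Hypothesis L : levy_process P X.
Hypothesis X_sym : symmetric_process P X.
Hypothesis X_exp : characteristic_exponent P X Psi.
Hypothesis X_dens : has_transition_densities P X.
Hypothesis K : admissible_kernel gamma ghat.
Local Notation rV := 'rV[R]_n.
Local Notation spec := (spec ghat).
Local Notation mu := (@lebesgue_measure R).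
Local Notation tR := (measurableTypeR R).

Definition path_energy (t : R) (w : Omega) : \bar R :=
  (\int[mu]_(s in `[0%R, t]) \int[mu]_(r in `[0%R, t])
    ((`|r - s| `^ (- beta))%:E * gamma (X r w - X s w)%R))%E.

Let g0 := kernel_ge0 K.
Let mg := measurable_kernel K.
Let c : R := gmass ^+ n * gmass ^+ n.
Let c0 : 0 < c. Proof. by rewrite mulr_gt0// exprn_gt0// gmass_gt0. Qed.

(** Stationarity reduces to [levy_energyE]; for [r < s] use the symmetry of the
    kernel. The diagonal is excluded, as the kernel may be infinite at 0. *)
Lemma increment_energyE s r : 0 <= s -> 0 <= r -> s != r ->
  (c%:E * \int[P]_w gamma (X r w - X s w)%R =
   \int[leb n]_xi (spec xi * expR (- (`|r - s| * Psi xi)))%:E)%E.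
Proof.
wlog : s r / s < r => [h s0 r0|sr s0 r0 _].
  rewrite neq_lt => /orP[sr|rs]; first by apply: h => //; rewrite lt_eqF.
  rewrite distrC -(h r s)//; last by rewrite lt_eqF.
  congr (_ * _)%E; apply: eq_integral => w _.
  by rewrite -(kernel_sym K) opprB.
have rs0 : 0 < r - s by rewrite subr_gt0.
rewrite gtr0_norm// -(levy_energyE L X_sym X_exp X_dens K rs0) muleA -EFinM.
congr (_ * _)%E; rewrite -(integral_increment L s0 (ltW rs0) mg g0).
by apply: eq_integral => w _; rewrite [s + _]addrC subrK.
Qed.

(** Tonelli's theorem on both sides of [increment_energyE]. On the diagonal both
    integrands vanish, since [0 `^ (- beta)] is 0. *)
Lemma expected_path_energyE t : 0 < t ->
  (c%:E * \int[P]_w path_energy t w =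
   \int[leb n]_xi ((spec xi)%:E * time_energy beta t (Psi xi)))%E.
Proof.
move=> t0.
have mX := levy_meas L.
have [N [Z [mN N0 mZ ZX]]] := jointly_measurable_modification mX (levy_cadlag L) (Num.bound t).
pose D : set tR := `[0, t]%classic.
have DZ w s : ~ N w -> D s -> Z (w, s) = X s w.
  move=> Nw; rewrite /D /= in_itv /= => /andP[s0 st]; apply: ZX => //.
  by rewrite s0 (le_lt_trans st)// archi_boundP// ltW.
have mD : measurable_fun setT (\1_D : tR -> R) by apply: measurable_indic; exact: measurable_itv.
pose k (z : tR * tR) : R := \1_D z.1 * \1_D z.2 * `|z.2 - z.1| `^ (- beta).
have k0 z : 0 <= k z by rewrite mulr_ge0 ?powR_ge0.
have mk : measurable_fun setT (k : _ -> tR).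
  apply: measurable_funM.
    by apply: measurable_funM; apply: (measurableT_comp mD); [exact: measurable_fst|exact: measurable_snd].
  apply: (measurableT_comp (@measurable_powR R (- beta))); apply: measurableT_comp => //.
  by apply: measurable_funB; [exact: measurable_snd|exact: measurable_fst].
have m1 d' (T : measurableType d') : measurable_fun setT (fun z : (T * tR) * tR => (z.1.2, z.2)).
  apply/measurable_fun_pair => /=; last exact: measurable_snd.
  by apply: measurableT_comp; [exact: measurable_snd|exact: measurable_fst].
pose F1 (z : (Omega * tR) * tR) : \bar R :=
  ((k (z.1.2, z.2))%:E * gamma (Z (z.1.1, z.2) - Z z.1)%R)%E.
have mF1 : measurable_fun setT F1.
  apply: emeasurable_funM.
    by apply/measurable_EFinP; exact: (measurableT_comp mk (m1 _ _)).
  apply: measurableT_comp => //; apply: measurable_rVB; last first.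
    by apply: measurableT_comp => //; exact: measurable_fst.
  apply: measurableT_comp => //; apply/measurable_fun_pair => /=; last exact: measurable_snd.
  by apply: measurableT_comp; exact: measurable_fst.
have F10 z : (0 <= F1 z)%E by rewrite mule_ge0 ?lee_fin.
pose F z := (c%:E * F1 z)%E.
have mF : measurable_fun setT F by exact: emeasurable_funM.
have F0 z : (0 <= F z)%E by rewrite mule_ge0 ?lee_fin// ltW.
pose S (z : (rV * tR) * tR) : \bar R :=
  (spec z.1.1 * (k (z.1.2, z.2) * expR (- (`|z.2 - z.1.2| * Psi z.1.1))))%:E.
have mPsi := measurable_exponent L X_exp.
have mS : measurable_fun setT S.
  apply/measurable_EFinP; apply: measurable_funM.
    apply: (measurableT_comp (measurable_spec K)).
    by apply: measurableT_comp; exact: measurable_fst.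
  apply: measurable_funM; first exact: (measurableT_comp mk (m1 _ _)).
  apply: measurableT_comp => //; apply: measurableT_comp => //; apply: measurable_funM.
    apply: measurableT_comp => //; apply: measurable_funB; first exact: measurable_snd.
    by apply: measurableT_comp; [exact: measurable_snd|exact: measurable_fst].
  apply: (measurableT_comp mPsi).
  by apply: measurableT_comp; exact: measurable_fst.
have S0 z : (0 <= S z)%E by rewrite lee_fin !mulr_ge0 ?spec_ge0 ?expR_ge0.
transitivity (\int[P]_w \int[mu]_s \int[mu]_r F ((w, s), r))%E.
  have -> : (\int[P]_w path_energy t w = \int[P]_w \int[mu]_s \int[mu]_r F1 ((w, s), r))%E.
    apply: (integral_eq_off_null mN N0).
    - move=> w; apply: integral_ge0 => s _; apply: integral_ge0 => r _.
      by rewrite mule_ge0 ?lee_fin ?powR_ge0.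
    - by move=> w; apply: integral_ge0 => s _; apply: integral_ge0.
    move=> w Nw; rewrite /path_energy integral_mkcond; apply: eq_integral => s _.
    rewrite patchE; case: ifPn => sD; last first.
      rewrite integral0_eq// => r _; rewrite /F1 /k /=.
      by rewrite [\1_D s]indicE (negbTE sD) !mul0r mul0e.
    rewrite integral_mkcond; apply: eq_integral => r _.
    rewrite patchE /F1 /k /= [\1_D s]indicE sD mul1r indicE.
    case: ifPn => rD; last by rewrite mul0r mul0e.
    by rewrite mul1r !DZ//; [exact: set_mem sD|exact: set_mem rD].
  have m3 := measurable_tonelli_inner mF1 F10.
  rewrite -ge0_integralZl//; last 3 first.
  - exact: (measurable_fun_fubini_tonelli_F _ m3 (fun z => integral_ge0 _ (fun r _ => F10 _))).
  - by move=> w _; apply: integral_ge0 => s _; apply: integral_ge0.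
  - by rewrite lee_fin ltW.
  apply: eq_integral => w _; rewrite -ge0_integralZl//; last 3 first.
  - by apply: (measurableT_comp m3); exact: measurable_pair1.
  - by move=> s _; apply: integral_ge0.
  - by rewrite lee_fin ltW.
  apply: eq_integral => s _; rewrite -ge0_integralZl//.
  - by apply: (measurableT_comp mF1); exact: measurable_pair1.
  - by rewrite lee_fin ltW.
rewrite (tonelli3 P mF F0).
transitivity (\int[mu]_s \int[mu]_r \int[leb n]_xi S ((xi, s), r))%E.
  congr (integral _ _ _); apply/funext => s; congr (integral _ _ _); apply/funext => r.
  (* [k] vanishes outside the square [0, t]^2 and on its diagonal. *)
  have [k00|kn0] := eqVneq (k (s, r)) 0.
    rewrite !integral0_eq// => z _; first by rewrite /S /= k00 mul0r mulr0.
    by rewrite /F /F1 /= k00 mul0e mule0.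
  have [sD rD sr] : [/\ D s, D r & s != r].
    move: kn0; rewrite /k /= !mulf_eq0 !negb_or => /andP[/andP[sD rD] sr]; split.
    - by apply: contrapT => h; move: sD; rewrite indicE memNset// eqxx.
    - by apply: contrapT => h; move: rD; rewrite indicE memNset// eqxx.
    - apply: contraNneq sr => ->; rewrite subrr normr0 powR0// oppr_eq0 gt_eqF//.
      by case/andP: beta01.
  have [s0 r0] : 0 <= s /\ 0 <= r.
    by move: sD rD; rewrite /D /= !in_itv /= => /andP[-> _] /andP[-> _].
  have mZs u : measurable_fun setT (fun w => Z (w, u)).
    by apply: measurableT_comp => //; exact: measurable_pair2.
  have mgZ : measurable_fun setT (fun w => gamma (Z (w, r) - Z (w, s))).
    by apply: measurableT_comp => //; apply: measurable_rVB; exact: mZs.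
  have mSx : measurable_fun setT (fun xi => (spec xi * expR (- (`|r - s| * Psi xi)))%:E).
    apply/measurable_EFinP; apply: measurable_funM; first exact: (measurable_spec K).
    by apply: measurableT_comp => //; apply: measurableT_comp => //; exact: measurable_funM.
  transitivity ((k (s, r))%:E * (c%:E * \int[P]_w gamma (Z (w, r) - Z (w, s))%R))%E.
    have c0' : (0 <= c%:E)%E by rewrite lee_fin ltW.
    have k0' : (0 <= (k (s, r))%:E)%E by rewrite lee_fin.
    have cg0 w : setT w -> (0 <= c%:E * gamma (Z (w, r) - Z (w, s))%R)%E by rewrite mule_ge0.
    have mcg : measurable_fun setT (fun w => c%:E * gamma (Z (w, r) - Z (w, s))%R)%E.
      exact: emeasurable_funM.
    rewrite -(ge0_integralZl P measurableT mgZ (fun w _ => g0 _) c0').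
    rewrite -(ge0_integralZl P measurableT mcg cg0 k0').
    by apply: eq_integral => w _; rewrite /F /F1 /= muleCA.
  transitivity ((k (s, r))%:E * (c%:E * \int[P]_w gamma (X r w - X s w)%R))%E.
    by congr (_ * (_ * _))%E; apply: (integral_eq_off_null mN N0) => // w Nw; rewrite !DZ.
  rewrite increment_energyE//.
  have k0' : (0 <= (k (s, r))%:E)%E by rewrite lee_fin.
  have S0' xi : setT xi -> (0 <= (spec xi * expR (- (`|r - s| * Psi xi)))%:E)%E.
    by rewrite lee_fin mulr_ge0 ?spec_ge0 ?expR_ge0.
  rewrite -(ge0_integralZl (leb n) measurableT mSx S0' k0').
  by apply: eq_integral => xi _; rewrite /S /= -EFinM mulrCA.
transitivity (\int[leb n]_xi \int[mu]_s \int[mu]_r S ((xi, s), r))%E.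
  by apply/esym; exact: (tonelli3 (leb n) mS S0).
apply: eq_integral => xi _.
have tk0 u : (0 <= (tkernel beta (Psi xi) u)%:E)%E by rewrite lee_fin tkernel_ge0.
have mi := measurable_inner_time beta t (Psi xi).
rewrite /time_energy -ge0_integralZl//; last 3 first.
- exact: measurable_funTS.
- by move=> s _; apply: integral_ge0.
- by rewrite lee_fin spec_ge0.
rewrite [RHS]integral_mkcond; congr (integral _ _ _); apply/funext => s.
rewrite patchE; case: ifPn => sD; last first.
  rewrite integral0_eq// => r _; rewrite /S /k /=.
  by rewrite [\1_D s]indicE (negbTE sD) !(mul0r, mulr0).
rewrite -ge0_integralZl//; last 2 first.
- apply: measurable_funTS; apply/measurable_EFinP.
  apply: (measurableT_comp (measurable_tkernel beta (Psi xi))); apply: measurableT_comp => //.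
  exact: measurable_funB.
- by rewrite lee_fin spec_ge0.
rewrite [RHS]integral_mkcond; congr (integral _ _ _); apply/funext => r.
rewrite patchE /S /k /= [\1_D s]indicE sD mul1r indicE.
case: ifPn => rD; last by rewrite !(mul0r, mulr0).
by rewrite mul1r -EFinM.
Qed.

End time_average.

Theorem proposition3p2 (R : realType) (d : nat) (beta0 : R)
    (dO : measure_display) (Omega : measurableType dO) (P : probability Omega R)
    (X : R -> Omega -> 'rV[R]_d) (Psi : 'rV[R]_d -> R)
    (gamma gammahat : 'rV[R]_d -> \bar R)
    (d_ge1 : (1 <= d)%N)
    (beta0_01 : 0 < beta0 < 1)
    (X_levy : levy_process P X)
    (X_sym : symmetric_process P X)
    (X_exponent : characteristic_exponent P X Psi)
    (X_density : has_transition_densities P X)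
    (gamma_kernel : admissible_kernel gamma gammahat) :
  (\int[lebesgue_rV d]_xi
     ((1 + Psi xi `^ (1 - beta0))^-1%:E * gammahat xi) < +oo)%E <->
  (forall t : R, 0 < t ->
    (\int[P]_w \int[lebesgue_measure]_(s in `[0%R, t])
       \int[lebesgue_measure]_(r in `[0%R, t])
         ((`|r - s| `^ (- beta0))%:E * gamma (X r w - X s w)%R) < +oo)%E).
Proof.
have Psi0 := exponent_ge0 X_levy X_exponent.
have mPsi := measurable_exponent X_levy X_exponent.
pose W (xi : 'rV[R]_d) : R := (1 + Psi xi `^ (1 - beta0))^-1.
have W0 xi : 0 <= W xi by rewrite invr_ge0 addr_ge0 ?powR_ge0.
have mW : measurable_fun setT (W : _ -> measurableTypeR R).
  rewrite (_ : W = fun xi => (1 + Psi xi `^ (1 - beta0)) `^ (-1)); last first.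
    by apply/funext => xi; rewrite powR_inv1// addr_ge0 ?powR_ge0.
  apply: (measurableT_comp (@measurable_powR R (-1))); apply: measurable_funD => //.
  exact: (measurableT_comp (@measurable_powR R (1 - beta0))).
set c : R := gmass ^+ d * gmass ^+ d.
have c0 : 0 < c by rewrite mulr_gt0// exprn_gt0// gmass_gt0.
have E t : 0 < t -> (c%:E * \int[P]_w path_energy X gamma beta0 t w =
    \int[leb d]_xi ((spec gammahat xi)%:E * time_energy beta0 t (Psi xi)))%E.
  exact: expected_path_energyE.
set I := (\int[lebesgue_rV d]_xi _)%E.
have IE : I = (\int[leb d]_xi (spec gammahat xi * W xi)%:E)%E.
  rewrite -(integral_spec gamma_kernel)//; apply: eq_integral => xi _.
  exact: muleC.
have V0 t : (0 <= \int[P]_w path_energy X gamma beta0 t w)%E.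
  apply: integral_ge0 => w _; apply: integral_ge0 => s _; apply: integral_ge0 => r _.
  by rewrite mule_ge0 ?lee_fin ?powR_ge0 ?(kernel_ge0 gamma_kernel).
have sW0 xi : setT xi -> (0 <= (spec gammahat xi * W xi)%:E)%E.
  by rewrite lee_fin mulr_ge0 ?spec_ge0.
have msW : measurable_fun setT (fun xi => (spec gammahat xi * W xi)%:E).
  by apply/measurable_EFinP; apply: measurable_funM => //; exact: (measurable_spec gamma_kernel).
have mT t : measurable_fun setT (fun xi => (spec gammahat xi)%:E * time_energy beta0 t (Psi xi))%E.
  apply: emeasurable_funM; first by apply/measurable_EFinP; exact: (measurable_spec gamma_kernel).
  by apply: (measurableT_comp (measurable_time_energy beta0 t)).
have te0 t psi : (0 <= time_energy beta0 t psi)%E.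
  by apply: integral_ge0 => s _; apply: integral_ge0 => r _; rewrite lee_fin tkernel_ge0.
rewrite IE; split => [Ifin t t0|h].
- rewrite -[X in (X < _)%E]/(\int[P]_w path_energy X gamma beta0 t w)%E.
  suff : (c%:E * \int[P]_w path_energy X gamma beta0 t w < +oo)%E.
    case: (\int[P]_w _)%E (V0 t) => [v _ _|_|//]; first exact: ltry.
    by rewrite gt0_muley ?lte_fin.
  rewrite E//; pose C : R := 2 * t * ((expR t + 1) * gamma_mass beta0).
  have C0 : 0 <= C.
    by rewrite !mulr_ge0 ?gamma_mass_ge0 ?addr_ge0 ?expR_ge0// ltW.
  have C0' : (0 <= C%:E)%E by rewrite lee_fin.
  apply: (@le_lt_trans _ _ (\int[leb d]_xi (C%:E * (spec gammahat xi * W xi)%:E))%E).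
    apply: ge0_le_integral => //.
    + by move=> xi _; rewrite mule_ge0 ?lee_fin ?spec_ge0.
    + exact: emeasurable_funM.
    + move=> xi _; rewrite -EFinM mulrCA EFinM; apply: lee_wpmul2l; first by rewrite lee_fin spec_ge0.
      exact: time_energy_le.
  by rewrite (ge0_integralZl (leb d) measurableT msW sW0 C0') lte_mul_pinfty.
have t2 : 0 < 2 :> R by [].
have := h 2 t2; rewrite -[X in (X < _)%E]/(\int[P]_w path_energy X gamma beta0 2 w)%E => {}h.
have e0 : (0 <= (expR (- 1) : R)%:E)%E by rewrite lee_fin expR_ge0.
suff : ((expR (- 1))%:E * \int[leb d]_xi (spec gammahat xi * W xi)%:E < +oo)%E.
  have : (0 <= \int[leb d]_xi (spec gammahat xi * W xi)%:E)%E by exact: integral_ge0.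
  case: (\int[leb d]_xi _)%E => [v _ _|_|//]; first exact: ltry.
  by rewrite gt0_muley ?lte_fin ?expR_gt0.
apply: (@le_lt_trans _ _ (c%:E * \int[P]_w path_energy X gamma beta0 2 w)%E); last first.
  by rewrite lte_mul_pinfty// lee_fin ltW.
rewrite E// -(ge0_integralZl (leb d) measurableT msW sW0 e0).
apply: ge0_le_integral => //.
- by move=> xi _; rewrite mule_ge0 ?sW0.
- exact: emeasurable_funM.
- move=> xi _; rewrite -EFinM mulrCA EFinM; apply: lee_wpmul2l; first by rewrite lee_fin spec_ge0.
  exact: time_energy_ge.
Qed.
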